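(* Let $X$ be a finite set and let $G\leq\operatorname{Aut}(X^* )$ be a finitely generated self-replicating regular branch group with trivial branch kernel, satisfying the subgroup induction property, and acting tree-primitively on $X^*$. Let $K$ be the maximal branching subgroup of $G$. Then every finitely generated subgroup $H\leq G$ is virtually a regular block subgroup over $K$, i.e. $H$ admits a finite index subgroup that is a regular block subgroup over $K$.
   Context: Words and automorphisms. $\mathbf{N}=\{0,1,2,\dots\}$. $X^n$ is the set of words of length $n$ over the finite set $X$, $X^*=\bigcup_{n\in\mathbf{N}}X^n$, with partial order $u\leq v$ iff $v=uw$ for some $w\in X^*$; two words are comparable if $u\le v$ or $v\le u$. $\operatorname{Aut}(X^* )$ is the group of automorphisms of the poset $X^*$ (equivalently, of the $|X|$-regular rooted tree). For $g\in\operatorname{Aut}(X^* )$ and $v\in X^*$, the section $\varphi_v(g)\in \operatorname{Aut}(X^* )$ is the unique element with $g\cdot(vw)=(g\cdot v)(\varphi_v(g)\cdot w)$ for all $w\in X^*$. Stabilisers. For $G\leq\operatorname{Aut}(X^* )$: $\operatorname{St}_G(v)$ is the stabiliser of $v$; $\operatorname{St}_G(V)=\bigcap_{v\in V}\operatorname{St}_G(v)$ for $V\subseteq X^*$; $\operatorname{Rist}_G(v)=\{g\in G\mid g\cdot w=w \text{ for all } w\in X^* \text{ with } v\not\leq w\}$; $\operatorname{Rist}_G(V)=\{g\in G\mid g\cdot w=w\text{ for all } w\in X^*\text{ not comparable to any } v\in V\}$; $\operatorname{SRist}_G(V)=\operatorname{Rist}_G(V)\cap \operatorname{St}_G(V)$;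 for $n\in\mathbf{N}$, $\operatorname{Rist}_G(n)=\langle\bigcup_{v\in X^n}\operatorname{Rist}_G(v)\rangle$. Branch notions. $G$ is a branch group if it acts transitively on $X^n$ for every $n$ and $\operatorname{Rist}_G(n)$ has finite index in $G$ for every $n$. A non-trivial group $G\le\operatorname{Aut}(X^* )$ is self-similar if $\varphi_v(G)\subseteq G$ for all $v\in X^*$, and self-replicating if moreover $\varphi_v(\operatorname{St}_G(v))=G$ for all $v\in X^*$. A self-similar group $G$ acting transitively on every $X^n$ is regular branch over a finite index subgroup $K\leq G$ if $K\leq\varphi_x(\operatorname{Rist}_K(x))$ for all $x\in X$ (such a $G$ is a branch group); $G$ is regular branch if it is regular branch over some finite index subgroup. A maximal branching subgroup is a subgroup $K$ such that $G$ is regular branch over $K$ and which is maximal (for inclusion) with this property; for a self-replicating regular branch group it exists and is unique. A branch group $G$ has trivial branch kernel if for every normal subgroup $N\trianglelefteq G$ of finite index there is $n\in\mathbf{N}$ with $\operatorname{Rist}_G(n)\leq N$. Tree-primitivity. The action of $G$ on $X^*$ is tree-primitive if for every $n\in\mathbf{N}$ the only $G$-invariant partitions of $X^n$ are the partitions $\{vX^{n-m}\}_{v\in X^m}$, $0\leq m\leq n$. Subgroup induction property. For $G$ self-replicating, a collection $\mathcal{C}$ of subgroups of $G$ is inductive if (I) $1,G\in\mathcal{C}$; (II) if $H\in\mathcal{C}$ and $L\leq G$ contains $H$ as a finite index subgroup, then $L\in\mathcal{C}$; (III) if $H\leq\operatorname{St}_G(X)$ is finitely generated and $\varphi_x(H)\in\mathcal{C}$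 for all $x\in X$, then $H\in\mathcal{C}$. A finitely generated self-replicating group $G$ has the subgroup induction property if every inductive collection of subgroups of $G$ contains all finitely generated subgroups of $G$. Block subgroups. Let $V\subseteq X^*$ be a finite set of pairwise incomparable elements. A subgroup $H\leq G$ is a diagonal block subgroup with supporting vertex set $V$ if (i) $H\leq\operatorname{SRist}_G(V)$; (ii) $\varphi_v(H)$ has finite index in $\varphi_v(\operatorname{St}_G(v))$ for all $v\in V$; (iii) $\varphi_v$ is injective on $H$ for all $v\in V$. If $V=\bigsqcup_{i=1}^bV_i$ is a finite set of pairwise incomparable elements partitioned into $b\ge0$ non-empty subsets, $H\leq G$ is a block subgroup with supporting partition $\{V_i\}_{i=1}^b$ if $H=H_1\cdots H_b$ where each $H_i$ is a diagonal block subgroup with supporting vertex set $V_i$ (for $b=0$, $H$ is trivial). If $G$ is regular branch over $K$, such a block subgroup $H$ is a regular block subgroup over $K$ if $\varphi_v(H)=K$ for all $v\in V$. *)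

(* Defs.v *)
From HB Require Import structures.
From mathcomp Require Import all_boot.
From mathcomp Require Import boolp classical_sets functions cardinality.

Set Implicit Arguments.
Unset Strict Implicit.
Unset Printing Implicit Defensive.

Local Open Scope classical_set_scope.
Local Open Scope group_scope.

(* Automorphisms of the poset (seq X, prefix).  The inverse is carried as data
   but is determined by [aut_fun], see [tree_aut_ext]. *)
Record tree_aut (X : finType) := TreeAut {
  aut_fun :> seq X -> seq X;
  aut_inv : seq X -> seq X;
  aut_funK : cancel aut_fun aut_inv;
  aut_invK : cancel aut_inv aut_fun;
  aut_prefix : {mono aut_fun : u v / prefix u v} }.

Section Group.
Variable X : finType.
Implicit Types g h : tree_aut X.

Lemma tree_aut_ext g h : g =1 h -> g = h.
Proof.
case: g h => [f f' fK f'K fP] [k k' kK k'K kP] /= fk.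
have {fk} E : f = k by apply: funext.
subst k; have E' : f' = k'.
  by apply: funext => w; rewrite -{1}(k'K w) fK.
subst k'; congr TreeAut; exact: Prop_irrelevance.
Qed.

Fact aut_one_prefix : {mono @id (seq X) : u v / prefix u v}.
Proof. by []. Qed.

Definition aut_one : tree_aut X :=
  TreeAut (fun _ => erefl) (fun _ => erefl) aut_one_prefix.

Fact aut_mul_prefix g h : {mono g \o h : u v / prefix u v}.
Proof. by move=> u v /=; rewrite !aut_prefix. Qed.

(* Left action: (g * h) w = g (h w). *)
Definition aut_mul g h : tree_aut X :=
  TreeAut (can_comp (aut_funK g) (aut_funK h))
          (can_comp (aut_invK h) (aut_invK g))
          (aut_mul_prefix g h).

Fact aut_inv_prefix g : {mono aut_inv g : u v / prefix u v}.
Proof. by move=> u v; rewrite -(aut_prefix g) !aut_invK. Qed.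

Definition aut_invg g : tree_aut X :=
  TreeAut (aut_invK g) (aut_funK g) (aut_inv_prefix g).

HB.instance Definition _ := gen_eqMixin (tree_aut X).
HB.instance Definition _ := gen_choiceMixin (tree_aut X).

Fact aut_mulA : associative aut_mul.
Proof. by move=> f g h; apply: tree_aut_ext. Qed.
Fact aut_mul1 : left_id aut_one aut_mul.
Proof. by move=> g; apply: tree_aut_ext. Qed.
Fact aut_mulr1 : right_id aut_one aut_mul.
Proof. by move=> g; apply: tree_aut_ext. Qed.
Fact aut_mulV : left_inverse aut_one aut_invg aut_mul.
Proof. by move=> g; apply: tree_aut_ext => w /=; rewrite aut_funK. Qed.
Fact aut_mulVr : right_inverse aut_one aut_invg aut_mul.
Proof. by move=> g; apply: tree_aut_ext => w /=; rewrite aut_invK. Qed.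

HB.instance Definition _ := isGroup.Build (tree_aut X)
  aut_mulA aut_mul1 aut_mulr1 aut_mulV aut_mulVr.

Lemma aut1E w : (1 : tree_aut X) w = w. Proof. by []. Qed.
Lemma autME g h w : (g * h) w = g (h w). Proof. by []. Qed.
Lemma autVK g : cancel (g^-1)%g g. Proof. exact: aut_invK. Qed.
Lemma autKV g : cancel g (g^-1)%g. Proof. exact: aut_funK. Qed.

End Group.

Section Sections.
Variable X : finType.
Implicit Types (g h : tree_aut X) (u v w : seq X).

Lemma leq_size_aut g w : size w <= size (g w).
Proof.
elim/last_ind: w => [//|w x IHw]; rewrite size_rcons.
have : prefix (g w) (g (rcons w x)) by rewrite aut_prefix prefix_rcons.
case/prefixP => t E; rewrite E size_cat.
case: t E => [|y t _]; last by rewrite /= addnS ltnS (leq_trans IHw) ?leq_addr.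
rewrite cats0 => /(can_inj (aut_funK g)) /(congr1 size).
by rewrite size_rcons => /eqP; rewrite eq_sym ltn_eqF.
Qed.

Lemma size_aut g w : size (g w) = size w.
Proof.
apply/eqP; rewrite eqn_leq leq_size_aut andbT.
by rewrite -{2}(autKV g w) leq_size_aut.
Qed.

(* [size (g v) = size v], so this drops the prefix [g v] of [g (v ++ w)]. *)
Definition sect_fun v g : seq X -> seq X := fun w => drop (size v) (g (v ++ w)).

Fact sect_funE v g w : g (v ++ w) = g v ++ sect_fun v g w.
Proof.
have : prefix (g v) (g (v ++ w)) by rewrite aut_prefix prefix_prefix.
by case/prefixP => t E; rewrite /sect_fun E -(size_aut g v) drop_size_cat.
Qed.

Fact sect_funK v g : cancel (sect_fun v g) (sect_fun (g v) (g^-1)%g).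
Proof.
by move=> w; rewrite {1}/sect_fun -sect_funE autKV size_aut drop_size_cat.
Qed.

Fact sect_invK v g : cancel (sect_fun (g v) (g^-1)%g) (sect_fun v g).
Proof. by move=> w; have := sect_funK (g v) (g^-1)%g w; rewrite invgK autKV. Qed.

Fact sect_prefix v g : {mono sect_fun v g : u w / prefix u w}.
Proof.
move=> u w; have := aut_prefix g (v ++ u) (v ++ w).
by rewrite !sect_funE !prefix_catr ?eqxx.
Qed.

Definition sect v g : tree_aut X :=
  TreeAut (sect_funK v g) (sect_invK v g) (sect_prefix v g).

Lemma sectE v g w : g (v ++ w) = g v ++ sect v g w.
Proof. exact: sect_funE. Qed.

Lemma sect_uniq v g h :
  (forall w, g (v ++ w) = g v ++ h w) -> h = sect v g.
Proof.
move=> E; apply: tree_aut_ext => w.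
by have /eqP := E w; rewrite sectE eqseq_cat // eqxx /= => /eqP/esym.
Qed.

End Sections.

Section Subgroups.
Variable gT : groupType.
Implicit Types A G H K N : set gT.

Definition is_subgroup H :=
  [/\ H 1, (forall g h, H g -> H h -> H (g * h)) & (forall g, H g -> H g^-1)].

Definition subgroup_of G H := is_subgroup H /\ H `<=` G.

Definition generated A : set gT := smallest is_subgroup A.

Definition finitely_generated H := exists2 A, finite_set A & H = generated A.

Definition has_finite_index G H :=
  H `<=` G /\ finite_set [set [set g * h | h in H] | g in G].

Definition normal_subgroup G N :=
  subgroup_of G N /\ forall g n, G g -> N n -> N (n ^ g).

Definition prod_sets b (H_ : 'I_b -> set gT) : set gT :=
  [set \prod_(i < b) h i | h in [set h : 'I_b -> gT | forall i, H_ i (h i)]].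

End Subgroups.

Section Branch.
Variable X : finType.
Implicit Types (u v w : seq X) (V : set (seq X)) (g h : tree_aut X).
Implicit Types (G H K L N : set (tree_aut X)).

Definition level n : set (seq X) := [set w | size w = n].

Definition comparable_words u v := prefix u v || prefix v u.

Definition antichain V :=
  forall u v, V u -> V v -> comparable_words u v -> u = v.

Definition St G v : set (tree_aut X) := [set g | G g /\ g v = v].

Definition St_set G V : set (tree_aut X) :=
  [set g | G g /\ forall v, V v -> g v = v].

Definition Rist G v : set (tree_aut X) :=
  [set g | G g /\ forall w, ~~ prefix v w -> g w = w].

Definition Rist_set G V : set (tree_aut X) :=
  [set g | G g /\
    forall w, (forall v, V v -> ~~ comparable_words w v) -> g w = w].

Definition SRist_set G V := Rist_set G V `&` St_set G V.

Definition Rist_level G n := generated (\bigcup_(v in level n) Rist G v).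

Definition level_transitive G :=
  forall n u v, level n u -> level n v -> exists2 g, G g & g u = v.

Definition branch_group G :=
  [/\ is_subgroup G, level_transitive G &
      forall n, has_finite_index G (Rist_level G n)].

Definition self_similar G :=
  [/\ is_subgroup G, G <> [set 1] & forall v, sect v @` G `<=` G].

Definition self_replicating G :=
  self_similar G /\ forall v, sect v @` St G v = G.

Definition regular_branch_over G K :=
  [/\ self_similar G, level_transitive G, subgroup_of G K,
      has_finite_index G K &
      forall x : X, K `<=` sect [:: x] @` Rist K [:: x]].

Definition regular_branch G := exists K, regular_branch_over G K.

Definition maximal_branching_subgroup G K :=
  regular_branch_over G K /\
  forall L, regular_branch_over G L -> K `<=` L -> L = K.

Definition trivial_branch_kernel G :=
  branch_group G /\
  forall N, normal_subgroup G N -> has_finite_index G N ->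
    exists n, Rist_level G n `<=` N.

Definition invariant_collection G (P : set (set (seq X))) :=
  forall g B, G g -> P B -> P (g @` B).

Definition cone_partition n m : set (set (seq X)) :=
  [set [set v ++ w | w in level (n - m)] | v in level m].

(* Only the inclusion "invariant partition => cone partition" is asserted: cone
   partitions are invariant under every tree automorphism. *)
Definition tree_primitive G :=
  forall n (P : set (set (seq X))),
    partition P id (level n) -> invariant_collection G P ->
    exists2 m, m <= n & P = cone_partition n m.

Definition inductive_collection G (C : set (set (tree_aut X))) :=
  [/\ forall H, C H -> subgroup_of G H,
      C [set 1] /\ C G,
      (forall H L, C H -> subgroup_of G L -> has_finite_index L H -> C L) &
      (forall H, subgroup_of (St_set G (level 1)) H -> finitely_generated H ->
         (forall x : X, C (sect [:: x] @` H)) -> C H)].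

Definition subgroup_induction_property G :=
  [/\ finitely_generated G, self_replicating G &
      forall C, inductive_collection G C ->
        forall H, subgroup_of G H -> finitely_generated H -> C H].

Definition diagonal_block_subgroup G V H :=
  [/\ finite_set V, antichain V, subgroup_of (SRist_set G V) H,
      forall v, V v -> has_finite_index (sect v @` St G v) (sect v @` H) &
      forall v, V v -> set_inj H (sect v)].

(* [partition setT V_ V] includes that the blocks [V_ i] are non-empty.
   For b = 0, V is empty and H = [set 1]. *)
Definition block_subgroup G V b (V_ : 'I_b -> set (seq X)) H :=
  [/\ finite_set V, antichain V, partition [set: 'I_b] V_ V &
      exists2 H_ : 'I_b -> set (tree_aut X),
        forall i, diagonal_block_subgroup G (V_ i) (H_ i) &
        H = prod_sets H_].

(* Meant for G regular branch over K. *)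
Definition regular_block_subgroup G K H :=
  exists V b (V_ : 'I_b -> set (seq X)),
    block_subgroup G V V_ H /\ forall v, V v -> sect v @` H = K.

Definition virtually_regular_block G K H :=
  exists L, [/\ subgroup_of H L, has_finite_index H L &
                regular_block_subgroup G K L].

End Branch.

(* Main.v *)
(** Write K_v for the copy of K acting below v and d for the size of X; deep
rigid stabilisers are exactly the K_v.  Call L <= G decided if, for all deep
enough a, either K_a <= L or L is trivial below a; this passes to finite index
subgroups and to normal subgroups.  Call P good if it embeds in G with decided
image so that the preimages of all deep K_a are diagonal copies of K.  The
subgroup induction property is applied to the class of virtually good
subgroups: a subgroup fixing the first level is a subdirect product of its
sections, and a Goursat argument splits it, up to finite index, into the two
kernels and their common centraliser.

The key point is rigidity: an isomorphism f between decided subgroups maps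
every deep K_a to some K_b.  For a set S of words of length q let r(S) be the
index in Rb(S) (elements acting as K outside S) of the elements acting as K
everywhere at level q, and iota the index in K of the elements acting as K
everywhere at level 1.  As log r is supermodular, r(S)^(d-1) / iota^|S| attains
its maximum on a block of G, that is on a cone by tree-primitivity, and all deep
cones give the same value.  Comparing the bounds for f(K_a) and for the preimages of
the K_z it contains forces equality (tightness), and tight sets overlapping
each other have tight unions; hence f(K_a) moves words as freely as some K_v
does, and it is then a K_u one step further down.

Finally the supports of the diagonal copies of K inside a good subgroup are
pairwise incomparable, and those at a fixed level generate a finite index
regular block subgroup. *)

Require Import Defs.
From mathcomp Require Import all_boot finmap.
From mathcomp Require Import boolp classical_sets functions cardinality.
From mathcomp Require Import zify.

Set Implicit Arguments.
Unset Strict Implicit.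
Unset Printing Implicit Defensive.
Local Open Scope classical_set_scope.
Local Open Scope group_scope.

(** * Finite index, indices, finite generation *)

Section GroupSets.
Variable gT : groupType.
Implicit Types (A B C D G H K : set gT) (g h : gT).

(** An abstract isomorphism between subgroups of [G] sees nothing of the tree: only indices and
    centralisers survive it, which is why rigidity is obtained by counting. The index r_j of the
    elements of [K] acting as [K] at level j satisfies r_(j+1) = iota r_j^d, hence r_j^(d-1) iota =
    iota^(d^j); the exponent d-1 and the factor iota^|S| are what make all deep cones equal.
    Tree-primitivity is used a second time: [K] is normal, so its orbits on a level form an
    invariant partition and are cones. Below a fixed depth [kk] the group [K] is thus transitive,
    and one good cone can be carried to all others. Subgroup induction is also used twice. Applied
    to the subgroups that are finite if abelian, it makes [G] torsion; the derived subgroup of [K]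
    then has finite index, and trivial branch kernel puts deep rigid stabilisers inside it. This
    turns the commutators of cones found in a normal subgroup into whole cones. Rigidity enters
    through Goursat: on the common centraliser of the two kernels both projections are injective, so
    the two images are isomorphic decided subgroups, and their cones have to be matched. *)

Lemma sub1 A : is_subgroup A -> A 1. Proof. by case. Qed.
Lemma subM A g h : is_subgroup A -> A g -> A h -> A (g * h).
Proof. by case=> _ /(_ g h). Qed.
Lemma subV A g : is_subgroup A -> A g -> A g^-1.
Proof. by case=> _ _; apply. Qed.
Lemma subMl A g h : is_subgroup A -> A g -> A (g * h) -> A h.
Proof. by move=> sA Ag /(subM sA (subV sA Ag)); rewrite mulKg. Qed.
Lemma subMr A g h : is_subgroup A -> A h -> A (g * h) -> A g.
Proof. by move=> sA /(subV sA) Ah /subM/(_ Ah); rewrite mulgK; apply. Qed.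

Lemma is_subgroupI A B : is_subgroup A -> is_subgroup B -> is_subgroup (A `&` B).
Proof.
move=> sA sB; split; first by split; apply: sub1.
  by move=> g h [? ?] [? ?]; split; apply: subM.
by move=> g [? ?]; split; apply: subV.
Qed.

Lemma is_subgroup1 : is_subgroup [set (1 : gT)].
Proof.
by split=> [//|g h -> ->|g ->] /=; rewrite ?mulg1 ?invg1.
Qed.

Lemma generated_subgroup A : is_subgroup (generated A).
Proof.
split; first by move=> B [[]].
  by move=> g h Ag Ah B sB; case: (sB) => -[_ + _] _; apply; [apply: Ag|apply: Ah].
by move=> g Ag B sB; case: (sB) => -[_ _ +] _; apply; apply: Ag.
Qed.

Lemma sub_generated A : A `<=` generated A.
Proof. exact: sub_smallest. Qed.

Lemma generated_sub A B : is_subgroup B -> A `<=` B -> generated A `<=` B.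
Proof. by move=> sB AB; apply: smallest_sub. Qed.

Definition coset_of g H := [set g * h | h in H].
Definition cosets G H := [set coset_of g H | g in G].

Lemma coset_ofP H g h : is_subgroup H ->
  coset_of g H = coset_of h H <-> H (g^-1 * h).
Proof.
move=> sH; split=> [E|Hgh].
  have : coset_of h H h by exists 1; rewrite ?mulg1 //; apply: sub1.
  by rewrite -E => -[x Hx <-]; rewrite mulKg.
apply/seteqP; split=> _ [x Hx <-].
  exists ((g^-1 * h)^-1 * x); first by apply: subM => //; apply: subV.
  by rewrite invgM invgK -!mulgA mulVKg.
exists ((g^-1 * h) * x); first exact: subM.
by rewrite -mulgA mulVKg.
Qed.

Lemma fi_sub G H : has_finite_index G H -> H `<=` G. Proof. by case. Qed.

Lemma fi_fin G H : has_finite_index G H -> finite_set (cosets G H).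
Proof. by case. Qed.

(** A colouring [c] with finitely many values, each fibre inside one left coset: one element chosen
    per colour reaches every coset. *)
Lemma fi_by (T : Type) (c : gT -> T) G H :
  is_subgroup H -> H `<=` G -> finite_set [set c g | g in G] ->
  (forall g h, G g -> G h -> c g = c h -> H (g^-1 * h)) ->
  has_finite_index G H.
Proof.
move=> sH HG fin inj; split=> //.
have [->|/set0P [g0 Gg0]] := eqVneq G set0; first by rewrite image_set0.
pose r t := coset_of (xget g0 [set g | G g /\ c g = t]) H.
apply: (@sub_finite_set _ _ (r @` [set c g | g in G])); last exact: finite_image.
move=> _ [g Gg <-]; exists (c g); first by exists g.
rewrite /r; case: xgetP => [y _ [Gy Ey]|/(_ g) /=]; last by case.
by apply/coset_ofP => //; apply: inj.
Qed.

Lemma fi_refl G : is_subgroup G -> has_finite_index G G.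
Proof.
move=> sG; apply: (@fi_by unit (fun _ => tt)) => //.
by move=> g h Gg Gh _; apply: subM => //; apply: subV.
Qed.

Lemma finite_pair_image (T U V : Type) (S : set T) (f : T -> U) (g : T -> V) :
  finite_set (f @` S) -> finite_set (g @` S) ->
  finite_set [set (f x, g x) | x in S].
Proof.
move=> ff fg; apply: sub_finite_set (finite_setX ff fg).
by move=> _ [x Sx <-]; split; exists x.
Qed.

(** Multiplicativity is asked on [A] only: the main instance [sect v] is a homomorphism on the
    stabiliser of [v] and not on the whole group. *)
Lemma fi_preim (hT : groupType) (f : gT -> hT) A (C D : set hT) :
  is_subgroup A -> (forall g h, A g -> A h -> f (g * h) = f g * f h) ->
  is_subgroup D -> f @` A `<=` C -> has_finite_index C D ->
  has_finite_index A [set a | A a /\ D (f a)].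
Proof.
move=> sA fM sD fC [DC fin].
have f1 : f 1 = 1.
  by apply: (mulgI (f 1)); rewrite mulg1 -fM ?mulg1 //; apply: sub1.
have fV g : A g -> f g^-1 = (f g)^-1.
  move=> Ag; apply: (mulgI (f g)); rewrite mulgV -fM ?mulgV //; exact: subV.
apply: (@fi_by _ (fun g => [set f g * h | h in D])).
- split; first by split; [apply: sub1|rewrite f1; case: sD].
    move=> g h [Ag Dg] [Ah Dh]; split; first exact: subM.
    by rewrite fM //; case: sD => _ + _; apply.
  move=> g [Ag Dg]; split; first exact: subV.
  by rewrite fV //; case: sD => _ _; apply.
- by move=> g [].
- apply: sub_finite_set fin => _ [g Ag <-]; exists (f g) => //.
  by apply: fC; exists g.
- move=> g h Ag Ah E; split; first by apply: subM => //; apply: subV.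
  rewrite fM ?fV //; last exact: subV.
  have : [set f h * h0 | h0 in D] (f h) by exists 1; rewrite ?mulg1 //; case: sD.
  by rewrite -E => -[x Dx <-]; rewrite mulKg.
Qed.

Lemma fi_image (hT : groupType) (f : gT -> hT) A B :
  is_subgroup A -> is_subgroup B ->
  (forall g h, A g -> A h -> f (g * h) = f g * f h) ->
  has_finite_index A B -> has_finite_index (f @` A) (f @` B).
Proof.
move=> sA sB fM [BA fin]; split; first by move=> _ [b Bb <-]; exists b => //; apply: BA.
apply: (@sub_finite_set _ _ ((fun Y => f @` Y) @` cosets A B)); last exact: finite_image.
move=> _ [_ [a Aa <-] <-]; exists (coset_of a B); first by exists a.
apply/seteqP; split.
  move=> _ [_ [b Bb <-] <-]; exists (f b); first by exists b.
  by rewrite fM //; apply: BA.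
move=> _ [_ [b Bb <-] <-]; exists (a * b); first by exists b.
by rewrite fM //; apply: BA.
Qed.

Lemma fi_setI A B C : is_subgroup A -> is_subgroup B -> is_subgroup C -> C `<=` A ->
  has_finite_index A B -> has_finite_index C (C `&` B).
Proof.
move=> sA sB sC CA fi.
apply: (@fi_preim _ id C A B) => //.
by move=> _ [c Cc <-]; apply: CA.
Qed.

Lemma fi_trans A B C : is_subgroup A -> is_subgroup B -> is_subgroup C ->
  has_finite_index A B -> has_finite_index B C -> has_finite_index A C.
Proof.
move=> sA sB sC [BA finB] [CB finC].
pose r g := xget 1 [set a | A a /\ coset_of a B = coset_of g B].
have rP g : A g -> A (r g) /\ B ((r g)^-1 * g).
  move=> Ag; rewrite /r; case: xgetP => [y _ [Ay /coset_ofP]|/(_ g)]; last by case.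
  by move=> /(_ sB).
apply: (@fi_by _ (fun g => (coset_of g B, coset_of ((r g)^-1 * g) C))) => //.
- by move=> x /CB /BA.
- apply: finite_pair_image => //; apply: sub_finite_set finC.
  by move=> _ [g Ag <-]; exists ((r g)^-1 * g) => //; apply: (rP _ Ag).2.
- move=> g h Ag Ah [Eg /coset_ofP]; move=> /(_ sC).
  have -> : r h = r g by rewrite /r Eg.
  by rewrite invgM invgK -mulgA mulVKg.
Qed.

Lemma fi_I A B C : is_subgroup A -> is_subgroup B -> is_subgroup C ->
  has_finite_index A B -> has_finite_index A C -> has_finite_index A (B `&` C).
Proof.
move=> sA sB sC fB fC; apply: (fi_trans (B := B)) => //; first exact: is_subgroupI.
apply: fi_setI fC => //; exact: fi_sub fB.
Qed.

Lemma fi_upper A B C : is_subgroup A -> is_subgroup B -> is_subgroup C ->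
  has_finite_index A C -> C `<=` B -> B `<=` A -> has_finite_index A B.
Proof.
move=> sA sB sC [CA fin] CB BA.
apply: (@fi_by _ (fun g => coset_of g C)) => // g h Ag Ah /coset_ofP.
by move=> /(_ sC) /CB.
Qed.

Lemma fi_lower A B C : is_subgroup A -> is_subgroup B -> is_subgroup C ->
  has_finite_index A C -> C `<=` B -> B `<=` A -> has_finite_index B C.
Proof.
move=> sA sB sC fi CB BA; rewrite -(setIidr CB); apply: fi_setI fi => //.
Qed.

Lemma fi_bigI (I : finType) A (B : I -> set gT) : is_subgroup A ->
  (forall i, is_subgroup (B i)) -> (forall i, has_finite_index A (B i)) ->
  has_finite_index A [set a | A a /\ forall i, B i a].
Proof.
move=> sA sB fB.
pose c g : {ffun I -> set gT} := [ffun i => coset_of g (B i)].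
apply: (@fi_by _ c).
- split; first by split=> [|i]; apply: sub1.
    by move=> g h [? Bg] [? Bh]; split=> [|i]; apply: subM.
  by move=> g [? Bg]; split=> [|i]; apply: subV.
- by move=> g [].
- pose F i := fset_set (cosets A (B i)).
  have Fin i : finite_set (cosets A (B i)) by apply: fi_fin.
  have : finite_set [set` (fun f : {ffun I -> set gT} => [forall i, f i \in F i])].
    pose S := \big[fsetU/fset0]_i F i.
    pose e (f : {ffun I -> S}) : {ffun I -> set gT} := [ffun i => val (f i)].
    apply: (@sub_finite_set _ _ (e @` [set: {ffun I -> S}])); last first.
      exact/finite_image/finite_finset.
    move=> f /= /forallP Ff.
    have FS i : f i \in S by apply/bigfcupP; exists i => //; rewrite mem_index_enum.
    by exists [ffun i => [` FS i]%fset] => //; apply/ffunP => i; rewrite !ffunE.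
  apply: sub_finite_set => _ [g Ag <-] /=; apply/forallP => i.
  by rewrite ffunE in_fset_set // inE; exists g.
- move=> g h Ag Ah E; split; first by apply: subM => //; apply: subV.
  move=> i; apply/coset_ofP => //.
  by have /ffunP/(_ i) := E; rewrite !ffunE.
Qed.

End GroupSets.

(** [fset_set] sends an infinite set to the empty one, so this is the index only under
    [has_finite_index]. *)
Definition idx (gT : groupType) (A B : set gT) := #|` fset_set (cosets A B)|.

Section Rep.
Variables (gT : groupType) (A B : set gT).

Definition rep (Y : set gT) := xget 1 [set a | A a /\ coset_of a B = Y].

Lemma repP Y : cosets A B Y -> A (rep Y) /\ coset_of (rep Y) B = Y.
Proof.
case=> a Aa E; rewrite /rep; case: xgetP => [y _ []//|/(_ a)]; by case.
Qed.

End Rep.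

Lemma in_cosets (gT : groupType) (A B : set gT) Y : has_finite_index A B ->
  reflect (cosets A B Y) (Y \in fset_set (cosets A B)).
Proof. by case=> _ fin; rewrite in_fset_set //; apply: (iffP idP); rewrite inE. Qed.

Lemma idx_gt0 (gT : groupType) (A B : set gT) : is_subgroup A ->
  has_finite_index A B -> 0 < idx A B.
Proof.
move=> sA fi; rewrite /idx cardfs_gt0; apply/fset0Pn; exists (coset_of 1 B).
by apply/in_cosets => //; exists 1 => //; apply: sub1.
Qed.

Section IdxLe.
Variables (gT hT : groupType) (A B : set gT) (C D : set hT) (phi : gT -> hT).
Hypotheses (sB : is_subgroup B) (sD : is_subgroup D).
Hypotheses (BA : B `<=` A) (fi : has_finite_index C D).
Hypothesis phiC : forall a, A a -> C (phi a).
Hypothesis phiI : forall g h, A g -> A h ->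
  D ((phi g)^-1 * phi h) -> B (g^-1 * h).

Lemma fi_idx_le : has_finite_index A B.
Proof.
apply: (@fi_by _ _ (fun g => coset_of (phi g) D)) => //.
  apply: sub_finite_set (fi_fin fi) => _ [g Ag <-]; exists (phi g) => //.
  exact: phiC.
by move=> g h Ag Ah /coset_ofP => /(_ sD); apply: phiI.
Qed.

Let F := fset_set (cosets A B).
Let m Y := coset_of (phi (rep A B Y)) D.

Let m_sub : (m @` F `<=` fset_set (cosets C D))%fset.
Proof.
apply/fsubsetP => _ /imfsetP [Y /= /(in_cosets _ fi_idx_le)/repP [Ar _] ->].
by apply/in_cosets => //; exists (phi (rep A B Y)) => //; apply: phiC.
Qed.

Let m_card : #|` (m @` F)%fset| = idx A B.
Proof.
apply: card_in_imfset => Y Z /(in_cosets _ fi_idx_le)/repP [AY EY].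
move=> /(in_cosets _ fi_idx_le)/repP [AZ EZ] /coset_ofP => /(_ sD) H.
by rewrite -EY -EZ; apply/coset_ofP => //; apply: phiI.
Qed.

Lemma idx_le : idx A B <= idx C D.
Proof. by rewrite -m_card; apply: fsubset_leq_card. Qed.

(** Through representatives [phi] injects the cosets of [B] in [A] into those of [D] in [C]; at
    equal finite cardinality it is onto. Every factorisation drawn later from an equality of indices
    comes from here. *)
Lemma idx_eq_surj c : idx A B = idx C D -> C c ->
  exists2 a, A a & D ((phi a)^-1 * c).
Proof.
move=> E Cc; have := fsubset_leqif_cards m_sub.
rewrite m_card => -[_]; rewrite E eqxx => /esym/eqP/fsetP/(_ (coset_of c D)).
have -> : coset_of c D \in fset_set (cosets C D) by apply/in_cosets => //; exists c.
case/imfsetP => Y /= /(in_cosets _ fi_idx_le)/repP [AY _] /esym/coset_ofP.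
by move=> /(_ sD); exists (rep A B Y).
Qed.

End IdxLe.

Section IdxTower.
Variable gT : groupType.
Implicit Types A B C D E U : set gT.

Lemma idx_tower A B C : is_subgroup A -> is_subgroup B -> is_subgroup C ->
  has_finite_index A B -> has_finite_index B C -> idx A C = (idx A B * idx B C)%N.
Proof.
move=> sA sB sC fAB fBC; have fAC := fi_trans sA sB sC fAB fBC.
pose F := enum_fset (fset_set (cosets A B)).
pose F' := enum_fset (fset_set (cosets B C)).
pose m Y Z := coset_of (rep A B Y * rep B C Z) C.
transitivity (size [seq m Y Z | Y <- F, Z <- F']); last by rewrite size_allpairs.
apply/perm_size/uniq_perm; first exact: fset_uniq.
  apply: allpairs_uniq => [||p1 p2].
  - exact: fset_uniq.
  - exact: fset_uniq.
  case/allpairsP => -[Y Z] /= [/(in_cosets _ fAB)/repP[AY EY] /(in_cosets _ fBC)/repP[BZ EZ] ->].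
  case/allpairsP => -[Y' Z'] /= [/(in_cosets _ fAB)/repP[AY' EY'] /(in_cosets _ fBC)/repP[BZ' EZ'] ->] /=.
  move=> /coset_ofP => /(_ sC); rewrite invgM -!mulgA => H.
  have E : Y = Y'.
    rewrite -EY -EY'; apply/coset_ofP => //.
    have := fi_sub fBC H; move/(subMl sB (subV sB BZ)); rewrite mulgA.
    exact: subMr.
  move: H; rewrite -E mulKg => H; congr pair.
  by rewrite -EZ -EZ'; apply/coset_ofP.
move=> Y; apply/(in_cosets _ fAC)/allpairsP => [[a Aa <-]|].
  have [AY EY] : A (rep A B (coset_of a B)) /\ coset_of (rep A B (coset_of a B)) B = coset_of a B.
    by apply: repP; exists a.
  set y := rep A B (coset_of a B) in AY EY.
  have By : B (y^-1 * a) by apply/coset_ofP.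
  have [BZ EZ] := @repP _ B C (coset_of (y^-1 * a) C) (ex_intro2 _ _ _ By erefl).
  set z := rep B C _ in BZ EZ.
  exists (coset_of a B, coset_of (y^-1 * a) C); split => /=.
  - by apply/in_cosets => //; exists a.
  - by apply/in_cosets => //; exists (y^-1 * a).
  - apply/coset_ofP => //; rewrite -/y -/z.
    have : C (z^-1 * (y^-1 * a)) by apply/coset_ofP.
    move/(subV sC); by rewrite !invgM !invgK -!mulgA.
case=> -[Y1 Z1] /= [/(in_cosets _ fAB)/repP[AY EY] /(in_cosets _ fBC)/repP[BZ EZ] ->].
exists (rep A B Y1 * rep B C Z1) => //; apply: subM => //.
exact: fi_sub fAB _ BZ.
Qed.

Lemma idx_id A : is_subgroup A -> idx A A = 1%N.
Proof.
move=> sA; have fA := fi_refl sA.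
have := idx_tower sA sA sA fA fA; have := idx_gt0 sA fA.
by case: (idx A A) => // n _ /eqP; rewrite -{1}(muln1 n.+1) eqn_pmul2l // => /eqP.
Qed.

Lemma idx_mono A B C : is_subgroup A -> is_subgroup B -> is_subgroup C ->
  has_finite_index A B -> has_finite_index A C -> C `<=` B -> idx A B <= idx A C.
Proof.
move=> sA sB sC fB fC CB.
rewrite (@idx_tower A B C) //; last exact: (fi_lower sA sB sC fC CB (fi_sub fB)).
apply: leq_pmulr; apply: idx_gt0 => //.
exact: (fi_lower sA sB sC fC CB (fi_sub fB)).
Qed.

Section Second.
Variables A U E : set gT.
Hypotheses (sA : is_subgroup A) (sU : is_subgroup U) (sE : is_subgroup E).
Hypotheses (AU : A `<=` U) (fi : has_finite_index U E).

Let sub x y : A x -> A y -> E (x^-1 * y) -> (A `&` E) (x^-1 * y).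
Proof. by move=> Ax Ay; split=> //; apply: subM => //; apply: subV. Qed.

Lemma idx_setI_le : idx A (A `&` E) <= idx U E.
Proof.
apply: (@idx_le _ _ _ _ _ _ id) => //; exact: is_subgroupI.
Qed.

Lemma idx_setI_eq u : idx A (A `&` E) = idx U E -> U u ->
  exists2 a, A a & E (a^-1 * u).
Proof.
apply: (@idx_eq_surj _ _ _ _ _ _ id) => //; exact: is_subgroupI.
Qed.

Lemma idx_setI_prod : (forall u, U u -> exists2 a, A a & E (a^-1 * u)) ->
  idx A (A `&` E) = idx U E.
Proof.
move=> H; apply/eqP; rewrite eqn_leq idx_setI_le /=.
have sAE : is_subgroup (A `&` E) by apply: is_subgroupI.
pose r u := xget 1 [set a | A a /\ E (a^-1 * u)].
have rP u : U u -> A (r u) /\ E ((r u)^-1 * u).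
  move=> /H [a Aa Ea]; rewrite /r; case: xgetP => [y _ //|/(_ a)]; by case.
apply: (@idx_le _ _ _ _ _ _ r) => //.
- exact: fi_sub fi.
- by apply: fi_setI fi.
- by move=> u /rP [].
- move=> g h /rP [_ Eg] /rP [_ Eh] [_ K].
  have : E (((r g)^-1 * g)^-1 * (((r g)^-1 * r h) * ((r h)^-1 * h))).
    by apply: subM; [|apply: subV|apply: subM].
  by rewrite invgM invgK -!mulgA mulVKg mulVKg.
Qed.

End Second.

Lemma idx_inter_le (I : eqType) (s : seq I) U (V : I -> set gT) :
  is_subgroup U -> (forall i, is_subgroup (V i)) ->
  (forall i, has_finite_index U (V i)) ->
  [/\ is_subgroup [set u | U u /\ forall i, i \in s -> V i u],
      has_finite_index U [set u | U u /\ forall i, i \in s -> V i u] &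
      idx U [set u | U u /\ forall i, i \in s -> V i u] <= (\prod_(i <- s) idx U (V i))%N].
Proof.
move=> sU sV fV; elim: s => [|i s [sW fW IH]].
  have -> : [set u | U u /\ forall i, i \in [::] -> V i u] = U.
    by apply/seteqP; split=> [u []|u].
  by split=> //; [exact: fi_refl|rewrite idx_id // big_nil].
have -> : [set u | U u /\ forall j, j \in i :: s -> V j u] =
    [set u | U u /\ forall j, j \in s -> V j u] `&` V i.
  apply/seteqP; split=> u.
    move=> [Uu H]; split; last by apply: H; rewrite mem_head.
    by split=> // j js; apply: H; rewrite inE js orbT.
  case=> -[Uu H] Vu; split=> // j; rewrite inE => /orP [/eqP ->//|]; exact: H.
set W := [set u | _] in sW fW IH *.
have fI : has_finite_index W (W `&` V i) by apply: fi_setI (fV i) => // u [].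
split; first exact: is_subgroupI.
  by apply: (fi_trans _ _ _ fW fI) => //; apply: is_subgroupI.
rewrite big_cons (@idx_tower U W) //; last exact: is_subgroupI.
rewrite mulnC; apply: leq_mul => //; apply: idx_setI_le => // u []; by [].
Qed.

(** The last hypothesis is independence, as in the Chinese remainder theorem: a coset of one [V i]
    is reached by an element lying in all the other [V j], so each new intersection multiplies the
    index by its full factor. *)
Lemma idx_inter_eq (I : eqType) (s : seq I) U (V : I -> set gT) :
  is_subgroup U -> (forall i, is_subgroup (V i)) ->
  (forall i, has_finite_index U (V i)) -> uniq s ->
  (forall u i, U u -> exists w, [/\ U w, V i (w^-1 * u) & forall j, j != i -> V j w]) ->
  idx U [set u | U u /\ forall i, i \in s -> V i u] = (\prod_(i <- s) idx U (V i))%N.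
Proof.
move=> sU sV fV + ind; elim: s => [_|i s IH /= /andP [nis us]].
  have -> : [set u | U u /\ forall i, i \in [::] -> V i u] = U.
    by apply/seteqP; split=> [u []|u].
  by rewrite idx_id // big_nil.
have [sW fW _] := idx_inter_le s sU sV fV.
have -> : [set u | U u /\ forall j, j \in i :: s -> V j u] =
    [set u | U u /\ forall j, j \in s -> V j u] `&` V i.
  apply/seteqP; split=> u.
    move=> [Uu H]; split; last by apply: H; rewrite mem_head.
    by split=> // j js; apply: H; rewrite inE js orbT.
  case=> -[Uu H] Vu; split=> // j; rewrite inE => /orP [/eqP ->//|]; exact: H.
have {}IH := IH us; set W := [set u | _] in sW fW IH *.
have fI : has_finite_index W (W `&` V i) by apply: fi_setI (fV i) => // u [].
rewrite big_cons (@idx_tower U W) //; last exact: is_subgroupI.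
rewrite mulnC IH; congr muln; apply: idx_setI_prod => //; first by move=> u [].
move=> u Uu; have [w [Uw Vw Wj]] := ind u i Uu; exists w => //; split=> // j js.
by apply: Wj; apply: contraNneq nis => <-.
Qed.

End IdxTower.

Lemma idx_hom (gT hT : groupType) (f : gT -> hT) (A B : set gT) (C D : set hT) :
  is_subgroup A -> is_subgroup B -> is_subgroup D -> B `<=` A ->
  has_finite_index C D ->
  (forall g h, A g -> A h -> f (g * h) = f g * f h) ->
  (forall a, A a -> C (f a)) -> (forall a, A a -> D (f a) -> B a) ->
  idx A B <= idx C D.
Proof.
move=> sA sB sD BA fi fM fC fD; apply: (@idx_le _ _ _ _ _ _ f) => // g h Ag Ah H.
apply: fD; first by apply: subM => //; apply: subV.
have f1 : f 1 = 1 by apply: (mulgI (f 1)); rewrite mulg1 -fM ?mulg1 //; apply: sub1.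
have fV : f g^-1 = (f g)^-1.
  by apply: (mulgI (f g)); rewrite mulgV -fM ?mulgV //; exact: subV.
by rewrite fM ?fV //; apply: subV.
Qed.

Lemma idx_iso (gT hT : groupType) (f : gT -> hT) (A B : set gT) :
  is_subgroup A -> is_subgroup B -> has_finite_index A B ->
  (forall g h, A g -> A h -> f (g * h) = f g * f h) ->
  (forall g h, A g -> A h -> f g = f h -> g = h) ->
  idx (f @` A) (f @` B) = idx A B.
Proof.
move=> sA sB fAB fM fI; have BA := fi_sub fAB.
have f1 : f 1 = 1 by apply: (mulgI (f 1)); rewrite mulg1 -fM ?mulg1 //; apply: sub1.
have fV g : A g -> f g^-1 = (f g)^-1.
  move=> Ag; apply: (mulgI (f g)); rewrite mulgV -fM ?mulgV //; exact: subV.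
have sfB : is_subgroup (f @` B).
  split; first by exists 1 => //; apply: sub1.
    move=> _ _ [b Bb <-] [c Bc <-]; exists (b * c); first exact: subM.
    by rewrite fM //; apply: BA.
  move=> _ [b Bb <-]; exists b^-1; first exact: subV.
  by rewrite fV //; apply: BA.
have fi' := fi_image sA sB fM fAB.
apply/eqP; rewrite eqn_leq; apply/andP; split; last first.
  apply: (@idx_hom _ _ f A B (f @` A) (f @` B)) => //.
  by move=> a Aa [b Bb E]; rewrite -(fI _ _ (BA _ Bb) Aa E).
pose r y := xget 1 [set a | A a /\ f a = y].
have rP y : (f @` A) y -> A (r y) /\ f (r y) = y.
  case=> a Aa <-; rewrite /r; case: xgetP => [z _ //|/(_ a)]; by case.
apply: (@idx_le _ _ _ _ _ _ r) => //; first by move=> _ [b Bb <-]; exists b => //; apply: BA.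
  by move=> y /rP [].
move=> y z /rP [Ay Ey] /rP [Az Ez] H; exists ((r y)^-1 * r z) => //.
by rewrite fM ?fV ?Ey ?Ez //; apply: subV.
Qed.

Section FinitelyGenerated.
Variable gT : groupType.
Implicit Types (A B D G K M N : set gT) (g h : gT).

(** Schreier's argument: the products of a representative and an element of the subgroup generated
    by [B] form a set [S] stable under left multiplication by [G], hence containing every element of
    [K]. *)
Lemma schreier G K : is_subgroup K -> finitely_generated G ->
  has_finite_index G K -> finitely_generated K.
Proof.
move=> sK [A finA EG] fi.
have sG : is_subgroup G by rewrite EG; apply: generated_subgroup.
pose R := rep G K @` cosets G K `|` [set 1].
have finR : finite_set R by rewrite finite_setU; split=> //; apply/finite_image/fi_fin.
have RG : R `<=` G.
  by move=> _ [[Y /repP [GY _] <-] //|->]; exact: sub1.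
have RP g : G g -> exists2 r, R r & K (r^-1 * g).
  move=> Gg; have CY : cosets G K (coset_of g K) by exists g.
  exists (rep G K (coset_of g K)); first by left; exists (coset_of g K).
  by apply/coset_ofP => //; have [] := repP CY.
pose A' := A `|` (fun a => a^-1) @` A.
have finA' : finite_set A' by rewrite finite_setU; split=> //; apply: finite_image.
have A'G : A' `<=` G.
  rewrite EG => _ [/sub_generated //|[a /sub_generated Aa <-]].
  exact: (subV (generated_subgroup A)).
(* [R] is added because the representative chosen for the coset [K] may be any element of [K]; it
   must then be a generator too. *)
pose W := [set (p.1^-1 * p.2.1 * p.2.2) | p in R `*` (A' `*` R)] `|` R.
pose B := W `&` K; exists B.
  apply: finite_setIl; rewrite finite_setU; split=> //; apply: finite_image.
  by do 2?apply: finite_setX.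
have sL := generated_subgroup B.
have LK : generated B `<=` K by apply: generated_sub => // x [].
apply/seteqP; split=> // k Kk.
pose S := [set x | exists r l, [/\ R r, generated B l & x = r * l]].
pose T := [set g | (forall x, S x -> S (g * x)) /\ (forall x, S x -> S (g^-1 * x))].
have sT : is_subgroup T.
  split; first by split=> x; rewrite ?invg1 mul1g.
    move=> g h [g1 g2] [h1 h2]; split=> x Sx; first by rewrite -mulgA; apply/g1/h1.
    by rewrite invgM -mulgA; apply/h2/g2.
  by move=> g [g1 g2]; split=> x; [apply: g2|rewrite invgK; apply: g1].
have step a x : A' a -> S x -> S (a * x).
  move=> Aa [r [l [Rr Ll ->]]].
  have [r' Rr' Kr] := RP (a * r) (subM sG (A'G _ Aa) (RG _ Rr)).
  exists r', ((r'^-1 * a * r) * l); split=> //; last by rewrite -!mulgA mulVKg.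
  apply: (subM sL) => //; apply: sub_generated; split; last by rewrite -mulgA.
  by left; exists (r', (a, r)).
have GT : G `<=` T.
  rewrite EG; apply: generated_sub => // a Aa; split=> x; apply: step; first by left.
  by right; exists a.
have [/(_ 1) + _] := GT _ (fi_sub fi Kk).
case.
  by exists 1, 1; split; [right|exact: (sub1 sL)|rewrite mulg1].
move=> r [l [Rr Ll]]; rewrite mulg1 => E; rewrite E; apply: (subM sL) => //.
apply: sub_generated; split; first by right.
by move: Kk; rewrite E; apply: (subMr sK); apply: LK.
Qed.

Definition derived K := generated [set [~ p.1, p.2] | p in K `*` K].

Lemma derived_sub K : is_subgroup K -> derived K `<=` K.
Proof.
move=> sK; apply: generated_sub => // _ [[x y] /= [Kx Ky] <-].
rewrite /commg /conjg; apply: subM => //; first exact: subV.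
by apply: subM => //; [apply: subV|apply: subM].
Qed.

Lemma derived_comm K x y : K x -> K y -> derived K [~ x, y].
Proof. by move=> Kx Ky; apply: sub_generated; exists (x, y). Qed.

Lemma derived_conj K d x : is_subgroup K -> derived K d -> K x -> derived K (d ^ x).
Proof.
move=> sK Dd Kx.
have -> : d ^ x = d * [~ d, x] by rewrite /commg mulVKg.
apply: (subM (generated_subgroup _)) => //.
by apply: derived_comm => //; apply: derived_sub Dd.
Qed.

(** A finitely generated torsion group has finite abelianisation: modulo [derived K] every element
    is an ordered product of powers of the generators with bounded exponents. [key] builds the
    finite set of these products one generator at a time. *)
Lemma derived_fi K : is_subgroup K -> finitely_generated K ->
  (forall x, K x -> exists n, x ^+ n.+1 = 1) -> has_finite_index K (derived K).
Proof.
move=> sK [A finA EK] tor; have sD := generated_subgroup [set [~ p.1, p.2] | p in K `*` K].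
rewrite -/(derived K) in sD.
have subX x n : K x -> K (x ^+ n).
  by move=> Kx; elim: n => [|n IH]; rewrite ?expg0 ?expgS; [apply: sub1|apply: subM].
have key (s : seq gT) : (forall a, a \in s -> K a) ->
  exists2 S : set gT, [/\ finite_set S, S 1 & S `<=` K] &
    forall a y, a \in s -> S y -> exists2 z, S z & derived K (z^-1 * (a * y)).
  elim: s => [|b s IH] sK'.
    by exists [set 1] => //; split=> // _ ->; apply: sub1.
  have [a ais|S [finS S1 SK] HS] := IH; first by apply: sK'; rewrite inE ais orbT.
  have Kb : K b by apply: sK'; rewrite mem_head.
  have [n bn] := tor _ Kb.
  exists [set b ^+ p.1 * p.2 | p in `I_n.+1 `*` S].
    split; first exact/finite_image/finite_setX.
      by exists (0, 1); rewrite //= mulg1.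
    by move=> _ [[e y] /= [_ Sy] <-]; apply: subM; [|exact: subX|exact: SK].
  move=> a _ /[swap] -[[e y] /= [le_e Sy] <-]; rewrite inE.
  have [->|nab] := eqVneq a b => /= [_|ais].
    (* Multiplying by [b] raises the exponent, which wraps from [n] to 0 because [b ^+ n.+1 = 1]. *)
    have [lt_e|] := ltnP e n.
      exists (b ^+ e.+1 * y); first by exists (e.+1, y).
      by rewrite expgS -mulgA mulVg; apply: (sub1 sD).
    move=> le_ne; have -> : e = n by apply/eqP; rewrite eqn_leq -ltnS le_e.
    exists y; first by exists (0, y); rewrite //= mul1g.
    have -> : b * (b ^+ n * y) = y by rewrite mulgA -expgS bn mul1g.
    by rewrite mulVg; apply: (sub1 sD).
  (* Another generator is moved past [b ^+ e] at the cost of a commutator, which conjugation by [y]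
     keeps in [derived K]. *)
  have [z Sz Dz] := HS a y ais Sy; exists (b ^+ e * z); first by exists (e, z).
  have -> : (b ^+ e * z)^-1 * (a * (b ^+ e * y)) =
     (z^-1 * (a * y)) * ([~ a, b ^+ e] ^ y).
    rewrite /commg /conjg invgM -!mulgA; congr mul.
    by rewrite !mulVKg.
  apply: (subM sD) => //; apply: derived_conj => //; last exact: SK.
  by apply: derived_comm; [apply: sK'; rewrite inE ais orbT|apply: subX].
have [|S [finS S1 SK] HS] := key (enum_fset (fset_set A)).
  move=> a; rewrite [_ \in _](in_fset_set finA) inE EK; exact: sub_generated.
pose T := [set g | K g /\ forall y, S y -> exists2 z, S z & derived K (z^-1 * (g * y))].
have TM g h : T g -> T h -> T (g * h).
  move=> [Kg Tg] [Kh Th]; split; first exact: subM.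
  move=> y Sy; have [z Sz Dz] := Th y Sy; have [w Sw Dw] := Tg z Sz; exists w => //.
  have -> : w^-1 * (g * h * y) = (w^-1 * (g * z)) * (z^-1 * (h * y)).
    by rewrite -!mulgA mulVKg.
  exact: (subM sD).
have T1 : T 1.
  split; first exact: sub1.
  by move=> y Sy; exists y => //; rewrite mul1g mulVg; apply: (sub1 sD).
have KT : K `<=` T.
  rewrite {1}EK; apply: generated_sub.
    split=> //; move=> g Tg; have [n gn] := tor _ Tg.1.
    have -> : g^-1 = g ^+ n by apply: (mulgI g); rewrite mulgV -expgS.
    by elim: n {gn} => [//|n IH]; rewrite expgS; apply: TM.
  move=> a Aa; split; first by rewrite EK; apply: sub_generated.
  by move=> y Sy; apply: HS => //; rewrite [_ \in _](in_fset_set finA) inE.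
pose c k := xget 1 [set z | S z /\ derived K (z^-1 * k)].
have cP k : K k -> S (c k) /\ derived K ((c k)^-1 * k).
  move=> /KT [_ /(_ 1 S1) [z Sz]]; rewrite mulg1 => Dz.
  rewrite /c; case: xgetP => [w _ //|/(_ z)]; by case.
apply: (@fi_by _ _ c) => //; first exact: derived_sub.
  by apply: sub_finite_set finS => _ [k Kk <-]; apply: (cP _ Kk).1.
move=> g h Kg Kh E; have [_ Dg] := cP g Kg; have [_ Dh] := cP h Kh.
have := subM sD (subV sD Dg) Dh; rewrite E invgM invgK -!mulgA; by rewrite mulVKg.
Qed.

(** The intersection of all conjugates of [M] is already that of the conjugates by coset
    representatives, a finite one, since conjugation by an element of [M] preserves [M]. *)
Lemma normal_core G M : is_subgroup G -> is_subgroup M -> has_finite_index G M ->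
  exists N, [/\ normal_subgroup G N, has_finite_index G N & N `<=` M].
Proof.
move=> sG sM fi; have finM := fi_fin fi.
pose I : finType := fset_set (cosets G M).
have IP (i : I) : G (rep G M (val i)).
  by have /(in_cosets _ fi)/repP [] := valP i.
pose B (i : I) := [set a | G a /\ M (a ^ rep G M (val i))].
have fB i : has_finite_index G (B i).
  apply: (@fi_preim _ _ _ G G M) => //; first by move=> g h _ _; rewrite conjMg.
  by move=> _ [g Gg <-]; rewrite /conjg; do 2?[apply: subM => //]; apply: subV.
have sB i : is_subgroup (B i).
  split; first by split; [apply: sub1|rewrite conj1g; apply: sub1].
    by move=> g h [? ?] [? ?]; split; rewrite ?conjMg; apply: subM.
  by move=> g [? ?]; split; rewrite ?conjVg; apply: subV.
have fN := fi_bigI sG sB fB.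
set N := [set a | _] in fN.
have NP n : N n <-> G n /\ forall g, G g -> M (n ^ g).
  split=> -[Gn H]; split=> //.
    move=> g Gg; have CY : cosets G M (coset_of g M) by exists g.
    have iF : coset_of g M \in fset_set (cosets G M) by apply/in_cosets.
    have [_] := H [` iF]%fset; rewrite /=.
    have [_ /coset_ofP] := repP CY => /(_ sM); set r := rep _ _ _ => Mr Mn.
    have -> : g = r * (r^-1 * g) by rewrite mulVKg.
    rewrite conjgM [X in M X]/conjg; apply: subM => //; first exact: subV.
    exact: subM.
  by move=> i; split=> //; apply/H/IP.
exists N; split=> //; last by move=> n /NP [_ /(_ 1 (sub1 sG))]; rewrite conjg1.
split; first split.
- split; first by split; [apply: sub1|move=> i; apply: sub1].
    by move=> g h [? Hg] [? Hh]; split=> [|i]; apply: subM.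
  by move=> g [? Hg]; split=> [|i]; apply: subV.
- by move=> n [].
- move=> g n Gg /NP [Gn Hn]; apply/NP; split.
    by rewrite /conjg; do 2?[apply: subM => //]; apply: subV.
  by move=> h Gh; rewrite -conjgM; apply: Hn; apply: subM.
Qed.

End FinitelyGenerated.

(** * Tree automorphisms *)

Section Tree.
Variable X : finType.
Implicit Types (g h k : tree_aut X) (u v w : seq X) (x y : X).

Lemma aut_nil g : g [::] = [::].
Proof. by apply: size0nil; rewrite size_aut. Qed.

Lemma aut_inj g : injective g. Proof. exact: can_inj (autKV g). Qed.

Lemma sect_nil g : sect [::] g = g.
Proof. by apply/esym/sect_uniq => w; rewrite aut_nil. Qed.

Lemma sect_cat v w g : sect (v ++ w) g = sect w (sect v g).
Proof.
by apply/esym/sect_uniq => u; rewrite -catA !sectE !catA.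
Qed.

Lemma sectM v g h : sect v (g * h) = sect (h v) g * sect v h.
Proof. by apply/esym/sect_uniq => w; rewrite !autME !sectE. Qed.

Lemma sect1 v : sect v (1 : tree_aut X) = 1.
Proof. exact/esym/sect_uniq. Qed.

Lemma sectV v g : sect (g v) g^-1 = (sect v g)^-1.
Proof.
apply: (mulIg (sect v g)); rewrite mulVg -sectM mulVg; exact: sect1.
Qed.

Lemma aut_catl g v w : g (v ++ w) = v ++ w -> g v = v.
Proof. by rewrite sectE => /eqP; rewrite eqseq_cat ?size_aut // => /andP [/eqP]. Qed.

Lemma aut_take g n w : g (take n w) = take n (g w).
Proof.
have [le|lt] := leqP n (size w).
  rewrite -{2}(cat_take_drop n w) sectE take_size_cat // size_aut size_takel //.
by rewrite !take_oversize ?size_aut // ltnW.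
Qed.

Definition dl1_fun x g w : seq X :=
  if w is y :: w' then if y == x then x :: g w' else y :: w' else [::].

Fact dl1_funK x g : cancel (dl1_fun x g) (dl1_fun x g^-1).
Proof.
case=> [//|y w] /=; have [->|nyx] /= := eqVneq y x; last by rewrite (negPf nyx).
by rewrite eqxx; congr cons; exact: autKV.
Qed.

Fact dl1_invK x g : cancel (dl1_fun x g^-1) (dl1_fun x g).
Proof. by rewrite -{2}(invgK g); apply: dl1_funK. Qed.

Fact dl1_prefix x g : {mono dl1_fun x g : u v / prefix u v}.
Proof.
case=> [|y u] [|z v]; rewrite ?prefix0s //=; first by case: (y == x).
case: (eqVneq y x) => [->|nyx]; case: (eqVneq z x) => [Ez|nzx] /=.
- by rewrite eqxx aut_prefix.
- by rewrite eq_sym (negPf nzx).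
- by rewrite Ez (negPf nyx).
- by [].
Qed.

Definition dl1 x g : tree_aut X :=
  TreeAut (@dl1_funK x g) (@dl1_invK x g) (@dl1_prefix x g).

Fixpoint dl v g : tree_aut X := if v is x :: v' then dl1 x (dl v' g) else g.

Lemma dlE v g w : dl v g (v ++ w) = v ++ g w.
Proof. by elim: v => [//|x v IH] /=; rewrite eqxx IH. Qed.

Lemma dl_out v g w : ~~ prefix v w -> dl v g w = w.
Proof.
elim: v w => [|x v IH] [|y w] //=; rewrite eq_sym.
by case: eqVneq => [->|//] /= /IH ->.
Qed.

Lemma dl_cat v w g : dl (v ++ w) g = dl v (dl w g).
Proof. by elim: v => [//|x v IH] /=; rewrite IH. Qed.

Lemma dl_self v g : dl v g v = v.
Proof. by rewrite -{2}(cats0 v) dlE aut_nil cats0. Qed.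

Lemma sect_dl v g : sect v (dl v g) = g.
Proof. by apply/esym/sect_uniq => w; rewrite dlE dl_self. Qed.

Lemma dl_inj v : injective (dl v).
Proof. exact: can_inj (sect_dl v). Qed.

Lemma dlM v g h : dl v (g * h) = dl v g * dl v h.
Proof.
apply: tree_aut_ext => w; have [/prefixP [u ->]|nvw] := boolP (prefix v w).
  by rewrite autME !dlE.
by rewrite autME !dl_out.
Qed.

Lemma dl_1 v : dl v 1 = 1.
Proof. by apply: (mulIg (dl v 1)); rewrite -dlM !mul1g. Qed.

Lemma dlV v g : dl v g^-1 = (dl v g)^-1.
Proof. by apply: (mulIg (dl v g)); rewrite -dlM !mulVg dl_1. Qed.

Lemma dl_conj h v g : h * dl v g * h^-1 = dl (h v) (sect v h * g * (sect v h)^-1).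
Proof.
apply: (mulIg h); rewrite mulgVK; apply: tree_aut_ext => w; rewrite !autME.
have [/prefixP [u ->]|nvw] := boolP (prefix v w).
  by rewrite dlE !(sectE v h) dlE !autME autKV.
by rewrite !dl_out // aut_prefix.
Qed.

(* [triv v g] asks [g] to fix all words below [v]; [supp v g] all the others. *)
Definition supp v g := forall w, ~~ prefix v w -> g w = w.
Definition triv v g := forall w, g (v ++ w) = v ++ w.

Lemma supp_dl v g : supp v (dl v g). Proof. by move=> w; apply: dl_out. Qed.

Lemma supp_self v g : supp v g -> g v = v.
Proof.
move=> sg; have [|/sg/aut_inj //] := boolP (prefix v (g v)).
by rewrite prefixE take_oversize ?size_aut // => /eqP.
Qed.

Lemma suppE v g : supp v g -> g = dl v (sect v g).
Proof.
move=> sg; apply: tree_aut_ext => w; have [/prefixP [u ->]|nvw] := boolP (prefix v w).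
  by rewrite dlE sectE supp_self.
by rewrite sg // dl_out.
Qed.

Lemma triv_sect v g : triv v g -> g v = v /\ sect v g = 1.
Proof.
move=> tg; have E : g v = v by rewrite -{1}(cats0 v) tg cats0.
by split=> //; apply/esym/sect_uniq => w; rewrite E tg.
Qed.

Lemma triv_cat v u g : triv v g -> triv (v ++ u) g.
Proof. by move=> tg w; rewrite -catA tg. Qed.

Lemma trivM v g h : triv v g -> triv v h -> triv v (g * h).
Proof. by move=> tg th w; rewrite autME th tg. Qed.

Lemma trivV v g : triv v g -> triv v g^-1.
Proof. by move=> tg w; apply: (@aut_inj g); rewrite autVK tg. Qed.

Lemma triv1 v : triv v 1. Proof. by []. Qed.

Lemma comparable_cat u v w : prefix u (v ++ w) -> comparable_words u v.
Proof.
rewrite /comparable_words !prefixE take_cat; case: ltnP => le /eqP E.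
  by rewrite E eqxx.
by apply/orP; right; rewrite -E take_size_cat.
Qed.

Lemma supp_triv u v g : supp u g -> ~~ comparable_words u v -> triv v g.
Proof. by move=> sg n w; apply: sg; apply: contra n; apply: comparable_cat. Qed.

Lemma triv_level_eq1 n g : (forall v, size v = n -> triv v g) -> g = 1.
Proof.
move=> H; apply: tree_aut_ext => w /=.
(* A letter is needed to pad short words to length [n]; over the empty alphabet the empty word is
   the only one. *)
have [x _|nX] := pickP (@predT X).
  pose w' := w ++ nseq n x.
  apply: (@aut_catl g w (nseq n x)).
  by rewrite -(cat_take_drop n (w ++ _)); apply: H; rewrite size_takel // size_cat size_nseq leq_addl.
case: w => [|x w]; first exact: aut_nil.
by have := nX x.
Qed.

Lemma triv_comm v g h : supp v h -> triv v g -> g * h = h * g.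
Proof.
move=> sh tg; have [gv _] := triv_sect tg; apply: tree_aut_ext => w; rewrite !autME.
have [/prefixP [u ->]|nvw] := boolP (prefix v w).
  by rewrite (suppE sh) tg dlE tg.
rewrite sh // sh //; apply: contra nvw => p.
by rewrite -(aut_prefix g) gv.
Qed.

Lemma incomp_size v w : size v = size w -> v != w -> ~~ comparable_words v w.
Proof.
move=> E n; by rewrite negb_or !prefixE !take_oversize ?E // n eq_sym n.
Qed.

Lemma nprefix_incomp v w : size v <= size w -> ~~ prefix v w -> ~~ comparable_words v w.
Proof.
move=> le n; rewrite negb_or n /=; apply: contra n => /prefixP [s E].
move: le; rewrite E size_cat -{2}(addn0 (size w)) leq_add2l leqn0 size_eq0 => /eqP ->.
by rewrite cats0 prefix_refl.
Qed.

Lemma comparable_sym u v : comparable_words u v = comparable_words v u.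
Proof. by rewrite /comparable_words orbC. Qed.

Lemma sect_triv_dl u v g : ~~ comparable_words u v -> triv v (dl u g).
Proof. by move=> n; apply: supp_triv n; apply: supp_dl. Qed.

Lemma triv_aut_fix v g : triv v g <-> (g v = v /\ sect v g = 1).
Proof.
split; first exact: triv_sect.
by case=> gv sg w; rewrite sectE gv sg.
Qed.

End Tree.

Lemma fi1_finite (gT : groupType) (H : set gT) :
  has_finite_index H [set 1] <-> H 1 /\ finite_set H.
Proof.
split=> [fi|[H1 finH]]; last first.
  apply: (@fi_by _ _ id); [exact: is_subgroup1|by move=> _ ->|by rewrite image_id|].
  by move=> g h _ _ ->; rewrite mulVg.
split; first exact: (fi_sub fi).
apply: (@sub_finite_set _ _ (rep H [set 1] @` cosets H [set 1])); last first.
  exact/finite_image/fi_fin.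
move=> h Hh; have C : cosets H [set 1] (coset_of h [set 1]) by exists h.
exists (coset_of h [set 1]) => //; have [_ /coset_ofP] := repP C.
move/(_ (is_subgroup1 _)) => E; apply/esym; apply: (mulgI (rep H [set 1] (coset_of h [set 1]))^-1).
by rewrite E mulVg.
Qed.

Lemma idx_eq1 (gT : groupType) (A B : set gT) : is_subgroup A -> is_subgroup B ->
  has_finite_index A B -> idx A B = 1%N -> A `<=` B.
Proof.
move=> sA sB fi /eqP /cardfs1P [Y EY] a Aa.
have in1 b : A b -> coset_of b B = Y.
  move=> Ab; apply/eqP; rewrite -in_fset1 -EY; apply/in_cosets => //; by exists b.
have : coset_of 1 B = coset_of a B by rewrite !in1 //; apply: sub1.
by move=> /coset_ofP => /(_ sB); rewrite invg1 mul1g.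
Qed.

Lemma finite_range_eq (T : choiceType) (S : set T) (f : nat -> T) :
  finite_set S -> (forall i, S (f i)) -> exists i j, (i < j)%N /\ f i = f j.
Proof.
move=> finS Sf; pose F := enum_fset (fset_set S).
pose s := [seq f i | i <- iota 0 (size F).+1].
have : ~~ uniq s.
  have sub : {subset s <= F}.
    by move=> _ /mapP [i _ ->]; rewrite [_ \in F](in_fset_set finS) inE.
  by apply/negP => us; have := uniq_leq_size us sub; rewrite size_map size_iota ltnn.
case/(uniqPn (f 0)) => i [j [ij]]; rewrite size_map size_iota => jF.
rewrite !(nth_map 0) ?size_iota // ?(ltn_trans ij) // !nth_iota // ?(ltn_trans ij) //.
by move=> E; exists i, j.
Qed.

(* [kk] is the length of the prefix of a word determining its K-orbit, and
   below level [n0] (resp. [mm]) rigid stabilisers in G are copies of K (resp.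
   lie in the derived subgroup of K). *)
Record branch_data (X : finType) (G K : set (tree_aut X)) (n0 kk mm : nat) : Prop :=
  BranchData {
  bdG : is_subgroup G;
  bdLT : level_transitive G;
  bdsect : forall v g, G g -> G (sect v g);
  bdsurj : forall v, sect v @` St G v = G;
  bdprim : tree_primitive G;
  bdK : is_subgroup K;
  bdKG : K `<=` G;
  bdfi : has_finite_index G K;
  bdnorm : forall g k, G g -> K k -> K (g * k * g^-1);
  bddl : forall v k, K k -> K (dl v k);
  bdne : exists2 k, K k & k <> 1;
  bdrist : forall v g, n0 <= size v -> G g -> supp v g -> K (sect v g);
  bdfix : forall k w, K k -> size w = kk -> k w = w;
  bdtrans : forall u w1 w2, size u = kk -> size w1 = size w2 ->
    exists2 k, K k & k (u ++ w1) = u ++ w2;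
  bdder : forall v g, mm <= size v -> G g -> supp v g -> derived K g;
  bdcong : forall M, is_subgroup M -> has_finite_index G M ->
    exists n, forall v g, n <= size v -> G g -> supp v g -> M g;
  bdX : 1 < #|X| }.

Lemma bd_weaken (X : finType) (G K : set (tree_aut X)) n0 kk mm n1 :
  branch_data G K n0 kk mm -> n0 <= n1 -> branch_data G K n1 kk mm.
Proof.
case=> sG LT sec sur pr sK KG fi nm dlK ne rs fx tr de cg cX le; split=> //.
by move=> v g len; apply: rs; apply: leq_trans len.
Qed.

(** * What the hypotheses on [G] give: the data of [branch_data] *)

Section Base.
Variables (X : finType) (G K : set (tree_aut X)).
Implicit Types (g h k : tree_aut X) (u v w : seq X).
Hypothesis hG : is_subgroup G.
Hypothesis hfg : finitely_generated G.
Hypothesis hrep : self_replicating G.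
Hypothesis hker : trivial_branch_kernel G.
Hypothesis hind : subgroup_induction_property G.
Hypothesis hprim : tree_primitive G.
Hypothesis hK : maximal_branching_subgroup G K.

Let LT : level_transitive G. Proof. by case: hker => -[]. Qed.
Let secG v g : G g -> G (sect v g).
Proof. by move=> Gg; case: hrep => -[_ _ /(_ v) H] _; apply: H; exists g. Qed.
Let secS v : sect v @` St G v = G. Proof. by case: hrep. Qed.
Let sK : is_subgroup K. Proof. by case: hK => -[_ _ []]. Qed.
Let KG : K `<=` G. Proof. by case: hK => -[_ _ []]. Qed.
Let Kfi : has_finite_index G K. Proof. by case: hK => -[]. Qed.

Lemma base_cardX : 1 < #|X|.
Proof.
rewrite ltnNge; apply/negP => /fintype_le1P E.
case: hrep => -[_ + _] _; apply; apply/seteqP; split=> [g Gg /=|_ ->]; last exact: sub1.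
apply: tree_aut_ext => w /=; have : size (g w) = size w by rewrite size_aut.
move: (g w) => s; elim: s w => [|x s IH] [|y t] //= [/IH ->]; congr cons; exact: E.
Qed.

Lemma dl_branching L x l : regular_branch_over G L -> L l -> L (dl [:: x] l).
Proof.
case=> _ _ _ _ /(_ x) + Ll => /(_ _ Ll) [g [Lg sg] <-].
by rewrite -(suppE sg).
Qed.

Lemma dl_branching_word L v l : regular_branch_over G L -> L l -> L (dl v l).
Proof.
move=> bL; elim: v => [//|x v IH] Ll.
by rewrite -cat1s dl_cat; apply: (dl_branching _ bL); apply: IH.
Qed.

(* [R n] is the section of the rigid stabiliser of a word of length [n]; the
   sequence decreases and stabilises at a branching subgroup, which is K by maximality. *)
Let R n : set (tree_aut X) := [set k | exists2 v, size v = n & G (dl v k)].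

Let R_conj h v k : G h -> G (dl v k) ->
  G (dl (h v) (sect v h * k * (sect v h)^-1)).
Proof.
by move=> Gh Gk; rewrite -dl_conj; apply: subM => //; [apply: subM|apply: subV].
Qed.

(** Self-replication writes [t] as the section at [v] of an element of [G] fixing [v]; conjugation
    by that element acts on copies below [v] as conjugation by [t]. *)
Let R_norm v t k : G t -> G (dl v k) -> G (dl v (t * k * t^-1)).
Proof. by rewrite -{1}(secS v) => -[h [Gh hv] <-] /(R_conj Gh); rewrite hv. Qed.

Let R_all n k v : size v = n -> R n k -> G (dl v k).
Proof.
move=> sv [w sw Gk]; have [h Gh hw] := LT sw sv.
have := R_norm (subV hG (secG w Gh)) (Gk); rewrite invgK => /(R_conj Gh).
by rewrite hw -!mulgA mulgV mulg1 mulVKg.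
Qed.

Let R_sub n : is_subgroup (R n).
Proof.
have [x _] : exists x, x \in X by apply/card_gt0P; apply: ltnW base_cardX.
split.
- by exists (nseq n x); rewrite ?size_nseq // dl_1; apply: sub1.
- move=> g h [v sv Gg] /(R_all sv) Gh; exists v => //; rewrite dlM; exact: subM.
- by move=> g [v sv Gg]; exists v => //; rewrite dlV; apply: subV.
Qed.

Let R_G n : R n `<=` G.
Proof. by move=> k [v _ /(secG v)]; rewrite sect_dl. Qed.

Let R_dec n : R n.+1 `<=` R n.
Proof.
move=> k [[|x v] //= [sv]] /(secG [:: x]).
by rewrite (sect_dl [:: x] (dl v k)) => Gk; exists v.
Qed.

Let R_decr n m : n <= m -> R m `<=` R n.
Proof.
move=> /subnK <-; elim: (m - n) => [|j IH] //.
exact: subset_trans (@R_dec _) IH.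
Qed.

Let R_K n : K `<=` R n.
Proof.
have [x _] : exists x, x \in X by apply/card_gt0P; apply: ltnW base_cardX.
move=> k Kk; exists (nseq n x); first by rewrite size_nseq.
by apply: KG; apply: dl_branching_word => //; case: hK.
Qed.

Let R_fi n : has_finite_index G (R n).
Proof. exact: (fi_upper hG (R_sub n) sK Kfi (@R_K n) (@R_G n)). Qed.

(** All [R n] contain [K], so their indices in [G] are bounded; once the index is maximal the
    decreasing chain cannot drop any more. *)
Let R_stab : exists n0, forall n, n0 <= n -> R n = R n0.
Proof.
pose Q i := `[< exists n, idx G (R n) = i >].
have exQ : exists i, Q i by exists (idx G (R 0)); apply/asboolP; exists 0.
have bQ i : Q i -> i <= idx G K.
  by move/asboolP => [n <-]; apply: idx_mono => //; apply: R_K.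
case: (ex_maxnP exQ bQ) => i /asboolP [n0 En0] maxi; exists n0 => n len.
apply/seteqP; split; first exact: R_decr.
have finn := fi_lower hG (R_sub n0) (R_sub n) (R_fi n) (R_decr len) (@R_G n0).
apply: idx_eq1 => //.
have : idx G (R n) <= idx G (R n0) by rewrite En0; apply: maxi; apply/asboolP; exists n.
rewrite (idx_tower hG (R_sub n0) (R_sub n)) //.
have := idx_gt0 (R_sub n0) finn; have := idx_gt0 hG (R_fi n0).
case: (idx G (R n0)) => // a _; case: (idx _ _) => // -[//|b] _.
by rewrite -{2}(muln1 a.+1) leq_pmul2l.
Qed.

Lemma base_rist : exists n0, forall n, n0 <= n -> R n = K.
Proof.
have [n0 H] := R_stab; exists n0 => n /H ->.
have [bK maxK] := hK; case: (bK) => hss hlt _ _ _; apply: maxK; last exact: R_K.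
split=> //.
move=> x l Rl; exists (dl [:: x] l); last by rewrite sect_dl.
have [y _] : exists y, y \in X by apply/card_gt0P; apply: ltnW base_cardX.
split; last exact: supp_dl.
exists (nseq n0 y); first by rewrite size_nseq.
(* Stability makes [R n0] branching: [l] also belongs to [R n0.+1], so it may sit at a word one
   letter longer. *)
rewrite -dl_cat; apply: (@R_all n0.+1); first by rewrite size_cat size_nseq addn1.
by rewrite H.
Qed.

Lemma base_norm g k : G g -> K k -> K (g * k * g^-1).
Proof.
have [n0 /(_ _ (leqnn _)) <-] := base_rist.
by move=> Gg [v sv Gk]; exists v => //; apply: R_norm.
Qed.

Lemma base_dl v k : K k -> K (dl v k).
Proof. by apply: dl_branching_word; case: hK. Qed.

(** If [K] were trivial, [G] would be finite of some order N, yet transitive on the words of length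
    N, of which there are more than N. *)
Lemma base_ne : exists2 k, K k & k <> 1.
Proof.
apply/not_exists2P => H.
have {}H k : K k -> k = 1 by have [//|/contrapT] := H k.
have EK : K = [set 1] by apply/seteqP; split=> [k /H //|_ ->]; apply: sub1.
have := Kfi; rewrite EK fi1_finite => -[_ finG].
pose N := #|` fset_set G|.
have [x _] : exists x, x \in X by apply/card_gt0P; apply: ltnW base_cardX.
have w0P : size (nseq N x) == N by rewrite size_nseq.
pose t (g : tree_aut X) : N.-tuple X := insubd (Tuple w0P) (g (nseq N x)).
have : #|{: N.-tuple X}| <= N.
  rewrite cardE; have -> : size (enum {: N.-tuple X}) = #|` [fset z in enum {: N.-tuple X}]%fset|.
    by rewrite card_fseq undup_id ?enum_uniq.
  apply: leq_trans (leq_imfset_card imfset_key t (mem (fset_set G))).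
  apply: fsubset_leq_card; apply/fsubsetP => z _.
  have [g Gg gz] := LT (n := N) (eqP w0P) (size_tuple z).
  apply/imfsetP; exists g; first by rewrite /= in_fset_set // inE.
  by apply: val_inj; rewrite insubdK gz // unfold_in size_tuple.
rewrite card_tuple leqNgt => /negP; apply.
apply: leq_trans (ltn_expl N (ltnSn 1)) _; case: (posnP N) => [->//|N0].
by rewrite leq_exp2r // base_cardX.
Qed.

Lemma base_cong M : is_subgroup M -> has_finite_index G M ->
  exists n, forall v g, n <= size v -> G g -> supp v g -> M g.
Proof.
move=> sM fi; have [N [nN fN NM]] := normal_core hG sM fi.
have [_ /(_ _ nN fN) [n RN]] := hker; exists n => v g len Gg sg.
apply: NM; apply: RN; apply: sub_generated; exists (take n v); first by rewrite /level /= size_takel.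
split=> // w nw; apply: sg; apply: contra nw => /prefixP [s ->].
by rewrite -{2}(cat_take_drop n v) -catA prefix_prefix.
Qed.

Definition abelian (H : set (tree_aut X)) := forall g h, H g -> H h -> g * h = h * g.

(** Conjugating a non-trivial element supported below a letter by one that moves this letter gives
    an element with disjoint support. *)
Lemma base_nonabelian : ~ abelian G.
Proof.
move=> ab; have [k Kk nk] := base_ne; apply: nk.
have /card_gt1P [x [y [_ _ nxy]]] := base_cardX.
have [h Gh hx] : exists2 h, G h & h [:: x] = [:: y] by apply: (LT (n := 1%N)).
have Gk := KG (base_dl [:: x] Kk).
have := ab h _ Gh Gk => /(congr1 (fun z => z * h^-1)); rewrite mulgK dl_conj hx => E.
apply: (@dl_inj _ [:: x]); rewrite dl_1 -E.
have t : triv [:: x] (dl [:: x] k).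
  rewrite -E; apply: sect_triv_dl; apply: incomp_size => //.
  by apply: contra nxy => /eqP [->].
have [_] := triv_sect t; rewrite sect_dl => ->.
by rewrite mulg1 mulgV dl_1.
Qed.

(** Subgroup induction for the class of subgroups that are finite if abelian. [G] belongs to it
    because it is not abelian, and a subgroup fixing the first level embeds in the product of its
    sections. The cyclic group generated by [g] is then finite. *)
Lemma base_torsion g : G g -> exists n, g ^+ n.+1 = 1.
Proof.
move=> Gg; pose C H := subgroup_of G H /\ (abelian H -> finite_set H).
have indC : inductive_collection G C.
  split.
  - by move=> H [].
  - split; last by split; [split|move/base_nonabelian].
    split=> [|_]; last exact: finite_set1.
    by split; [exact: is_subgroup1|move=> _ ->; apply: sub1].
  - move=> H L [[sH HG] fH] [sL LG] fi; split=> // abL.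
    have finH : finite_set H.
      by apply: fH => x y /(fi_sub fi) Lx /(fi_sub fi); apply: abL.
    suff /fi1_finite [] : has_finite_index L [set 1] by [].
    apply: (fi_trans sL sH (@is_subgroup1 _) fi).
    by apply/fi1_finite; split=> //; apply: sub1.
  - move=> H [sH HS] _ HC; split; first by split=> // h /HS [].
    have fixH h x : H h -> h [:: x] = [:: x] by move=> /HS [_]; apply.
    move=> abH; suff /fi1_finite [] : has_finite_index H [set 1] by [].
    pose B x := [set h | H h /\ [set (1 : tree_aut X)] (sect [:: x] h)].
    have fB x : has_finite_index H (B x).
      apply: (@fi_preim _ _ (sect [:: x]) H (sect [:: x] @` H) [set 1]) => //.
      - by move=> a b Ha Hb; rewrite sectM fixH.
      - exact: is_subgroup1.
      - have [[sS _] finS] := HC x; apply/fi1_finite; split; first exact: sub1.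
        apply: finS => _ _ [a Ha <-] [b Hb <-].
        by have := congr1 (sect [:: x]) (abH a b Ha Hb); rewrite !sectM !fixH.
    have sB x : is_subgroup (B x).
      split; first by split; [exact: sub1|rewrite /= sect1].
        move=> a b [Ha /= a1] [Hb /= b1]; split; first exact: subM.
        by rewrite /= sectM fixH // a1 b1 mulg1.
      move=> a [Ha /= a1]; split; first exact: subV.
      by rewrite /= -{1}(fixH a x Ha) sectV a1 invg1.
    have := fi_bigI sH sB fB; congr has_finite_index.
    apply/seteqP; split=> [h [Hh Bh]|_ ->]; last first.
      by split=> [|x]; apply: sub1.
    apply: (@triv_level_eq1 _ 1) => -[|x [|//]] // _; apply/triv_aut_fix; split; first exact: fixH.
    by have [] := Bh x.
pose H := generated [set g].
have sH : is_subgroup H := generated_subgroup _.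
have HG : subgroup_of G H by split=> //; apply: generated_sub => // _ ->.
have [_ _ /(_ _ indC H HG)] := hind.
case; first by exists [set g].
move=> _ fin; have {fin} finH : finite_set H.
  apply: fin.
  have centr (y : tree_aut X) : is_subgroup [set x | x * y = y * x].
    split; first by rewrite /= mul1g mulg1.
      by move=> a b /= Ea Eb; rewrite -mulgA Eb mulgA Ea mulgA.
    by move=> a /= Ea; apply: (mulgI a); rewrite mulVKg mulgA Ea mulgK.
  have Hg x : H x -> x * g = g * x.
    by apply: (generated_sub (B := [set x | x * g = g * x])) => // _ ->.
  move=> x y Hx Hy; apply: (generated_sub (B := [set x | x * y = y * x])) Hx => // _ ->.
  by rewrite /= Hg.
have HX n : H (g ^+ n).
  elim: n => [|n IH]; first exact: (sub1 sH).
  by rewrite expgS; apply: (subM sH) => //; apply: sub_generated.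
have [i [j [ij E]]] := finite_range_eq finH HX.
exists (j - i).-1; rewrite prednK ?subn_gt0 //.
by apply: (mulgI (g ^+ i)); rewrite -expgnDr subnKC ?(ltnW ij) // -E mulg1.
Qed.

Lemma base_derived : exists mm, forall v g, mm <= size v -> G g -> supp v g -> derived K g.
Proof.
have fD : has_finite_index K (derived K).
  apply: derived_fi => //; first exact: schreier Kfi.
  by move=> k /KG; apply: base_torsion.
apply: base_cong; first exact: generated_subgroup.
exact: (fi_trans hG sK (generated_subgroup _) Kfi fD).
Qed.

Definition orb_level n m := m <= n /\ forall w w', size w = n -> size w' = n ->
  ((exists2 k, K k & k w = w') <-> take m w = take m w').

(** [K] is normal in [G], so its orbits on the level form a [G]-invariant partition, which
    tree-primitivity identifies as a partition into cones. *)
Lemma base_orb n : exists m, orb_level n m.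
Proof.
pose O w : set (seq X) := [set k w | k in K].
have OP w w' : O w w' -> O w = O w'.
  case=> k Kk <-; apply/seteqP; split=> _ [j Kj <-].
    exists (j * k^-1); first by apply: subM => //; apply: subV.
    by rewrite autME autKV.
  by exists (j * k); first exact: subM.
have Oid w : O w w by exists 1 => //; apply: sub1.
have [||m lem E] := hprim (n := n) (P := [set O w | w in level n]).
- split.
  + apply/seteqP; split=> [w [_ [w' sw' <-] [k _ <-]]|w sw].
      by rewrite /level /= size_aut.
    by exists (O w) => //; exists w.
  + move=> _ _ [w sw <-] [w' sw' <-] [z [/OP Ez /OP Ez']] /=.
    by rewrite Ez Ez'.
  + by move=> _ [w _ <-]; exists w.
- move=> g _ Gg [w sw <-]; exists (g w); first by rewrite /level /= size_aut.
  apply/seteqP; split=> [_ [k Kk <-]|_ [_ [k Kk <-] <-]].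
    exists ((g^-1 * k * g) w); last by rewrite !autME autVK.
    exists (g^-1 * k * g) => //.
    have := base_norm (subV hG Gg) Kk; by rewrite invgK.
  exists (g * k * g^-1); first exact: base_norm.
  by rewrite !autME autKV.
exists m; split=> // w w' sw sw'.
have : cone_partition n m (O w) by rewrite -E; exists w.
case=> v sv Ov.
have tk z : O w z -> take m z = v.
  by rewrite -Ov => -[s _ <-]; rewrite take_size_cat.
split=> [Oz|Et]; first by rewrite !tk.
change (O w w'); rewrite -Ov; exists (drop m w').
  by rewrite /level /= size_drop sw'.
by rewrite -(tk w) // Et cat_take_drop.
Qed.

(** [kk] is the largest cone depth occurring in [base_orb]. It exists because [K] fixes every word
    whose length is such a depth, while some element of [K] moves a word [w0]. By maximality, the
    orbits on any level are cones over words of length at most [kk]. *)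
Lemma base_orbits : exists kk,
  (forall k w, K k -> size w = kk -> k w = w) /\
  (forall u w1 w2, size u = kk -> size w1 = size w2 ->
    exists2 k, K k & k (u ++ w1) = u ++ w2).
Proof.
have [k0 Kk0 nk0] := base_ne.
have [x0 _] : exists x, x \in X by apply/card_gt0P; apply: ltnW base_cardX.
have [w0 nw0] : exists w, k0 w <> w.
  by apply/existsNP => H; apply/nk0/tree_aut_ext.
pose Q m := `[< exists n, orb_level n m >].
have fixQ m k w : Q m -> K k -> size w = m -> k w = w.
  move=> /asboolP [n [lemn H]] Kk sw.
  pose w' := w ++ nseq (n - m) x0.
  have sw' : size w' = n by rewrite size_cat size_nseq sw subnKC.
  have /H : exists2 j, K j & j w' = k w' by exists k.
  by rewrite size_aut sw' -aut_take take_size_cat // => /(_ erefl erefl).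
have exQ : exists m, Q m by have [m Hm] := base_orb 0; exists m; apply/asboolP; exists 0.
have bQ m : Q m -> m <= size w0.
  move=> Qm; rewrite leqNgt; apply/negP => lt; apply: nw0.
  apply: (@aut_catl _ _ _ (nseq (m - size w0) x0)); apply: fixQ Qm Kk0 _.
  by rewrite size_cat size_nseq subnKC // ltnW.
case: (ex_maxnP exQ bQ) => kk Qkk maxk; exists kk; split=> [k w|u w1 w2 su sw].
  exact: fixQ.
have [m Hm] := base_orb (kk + size w1).
have lem : m <= kk by apply: maxk; apply/asboolP; exists (kk + size w1).
case: Hm => _ /(_ (u ++ w1) (u ++ w2)); rewrite !size_cat su -sw => /(_ erefl erefl) [_].
apply; move: lem; rewrite leq_eqVlt => /orP [/eqP E|lt].
  by rewrite !take_size_cat // su E.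
by rewrite !take_cat su lt.
Qed.

Lemma base_data : exists n0 kk mm, branch_data G K n0 kk mm.
Proof.
have [n0 Hn0] := base_rist; have [kk [fixk transk]] := base_orbits.
have [mm Hmm] := base_derived; exists n0, kk, mm; split=> //.
- exact: base_norm.
- exact: base_dl.
- exact: base_ne.
- move=> v g len Gg sg; rewrite -(Hn0 _ len); exists v => //.
  by rewrite -suppE.
- exact: base_cong.
- exact: base_cardX.
Qed.

End Base.

Section HomOn.
Variables (gT hT : groupType) (f : gT -> hT) (A : set gT).
Hypothesis sA : is_subgroup A.
Hypothesis fM : forall g h, A g -> A h -> f (g * h) = f g * f h.

Lemma hom1 : f 1 = 1.
Proof. by apply: (mulgI (f 1)); rewrite mulg1 -fM ?mulg1 //; apply: sub1. Qed.

Lemma homV g : A g -> f g^-1 = (f g)^-1.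
Proof.
move=> Ag; apply: (mulgI (f g)); rewrite mulgV -fM ?mulgV ?hom1 //; exact: subV.
Qed.

Lemma hom_image B : is_subgroup B -> B `<=` A -> is_subgroup (f @` B).
Proof.
move=> sB BA; split; first by exists 1; [exact: sub1|exact: hom1].
  move=> _ _ [b Bb <-] [c Bc <-]; exists (b * c); first exact: subM.
  by rewrite fM //; apply: BA.
move=> _ [b Bb <-]; exists b^-1; first exact: subV.
by rewrite homV //; apply: BA.
Qed.

Lemma hom_preim (D : set hT) : is_subgroup D -> is_subgroup [set a | A a /\ D (f a)].
Proof.
move=> sD; split; first by split; [exact: sub1|rewrite /= hom1; exact: sub1].
  by move=> g h [Ag Dg] [Ah Dh]; split; [exact: subM|rewrite /= fM //; apply: subM].
by move=> g [Ag Dg]; split; [exact: subV|rewrite /= homV //; apply: subV].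
Qed.

Lemma hom_inj : (forall g, A g -> f g = 1 -> g = 1) ->
  forall g h, A g -> A h -> f g = f h -> g = h.
Proof.
move=> inj g h Ag Ah E; apply: (mulgI h^-1); rewrite mulVg; apply: inj.
  by apply: subM => //; apply: subV.
by rewrite fM ?homV ?E ?mulVg //; apply: subV.
Qed.

End HomOn.

Lemma word_bound (X : finType) p (P : seq X -> nat -> Prop) :
  (forall a m m', m <= m' -> P a m -> P a m') ->
  (forall a, size a = p -> exists m, P a m) ->
  exists m, forall a, size a = p -> P a m.
Proof.
move=> mono H.
have /choice [F HF] : forall t : p.-tuple X, exists m, P t m.
  by move=> t; apply: H; apply: size_tuple.
exists (\max_t F t) => a /eqP sa; apply: (mono _ (F (Tuple sa))); last exact: (HF (Tuple sa)).
exact: leq_bigmax.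
Qed.

(** * Decided subgroups *)

Section Decided.
Variables (X : finType) (G K : set (tree_aut X)) (n0 kk mm : nat).
Hypothesis D : branch_data G K n0 kk mm.
Implicit Types (g h k x y : tree_aut X) (a b u v w z : seq X).
Implicit Types (L M N : set (tree_aut X)).

Let sG := bdG D.
Let sK := bdK D.
Let KG := bdKG D.

Definition cone a : set (tree_aut X) := dl a @` K.

Lemma cone_sub a : is_subgroup (cone a).
Proof. by apply: (hom_image sK) => // g h _ _; rewrite dlM. Qed.

Lemma cone_K a : cone a `<=` K.
Proof. by move=> _ [k Kk <-]; apply: (bddl D). Qed.

Lemma cone_G a : cone a `<=` G.
Proof. exact: subset_trans (@cone_K a) KG. Qed.

Lemma cone_supp a x : cone a x -> supp a x.
Proof. by case=> k _ <-; apply: supp_dl. Qed.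

Lemma cone_cat a w : cone (a ++ w) `<=` cone a.
Proof. by move=> _ [k Kk <-]; rewrite dl_cat; exists (dl w k) => //; apply: (bddl D). Qed.

Lemma cone_conj h a x : G h -> cone a x -> cone (h a) (h * x * h^-1).
Proof.
move=> Gh [k Kk <-]; rewrite dl_conj; eexists; last by [].
by apply: (bdnorm D) => //; apply: (bdsect D).
Qed.

Lemma cone_conj_fix h a x : G h -> h a = a -> cone a x -> cone a (h * x * h^-1).
Proof. by move=> Gh ha /(cone_conj Gh); rewrite ha. Qed.

Lemma cone_of a g : n0 <= size a -> G g -> supp a g -> cone a g.
Proof.
move=> le Gg sg; exists (sect a g); last by rewrite -suppE.
exact: (bdrist D).
Qed.

Lemma cone_ntriv a : exists2 x, cone a x & ~ triv a x.
Proof.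
have [k Kk nk] := bdne D; exists (dl a k); first by exists k.
by move/triv_sect => [_]; rewrite sect_dl.
Qed.

Lemma cone_sect a x : cone a x -> K (sect a x).
Proof. by case=> k Kk <-; rewrite sect_dl. Qed.

(** If [c] moved [a ++ w], it would conjugate an element supported below [a ++ w] to one supported
    below a different word of the same length, so it could not commute with it. *)
Lemma cone_centr a c : (forall x, cone a x -> c * x = x * c) -> triv a c.
Proof.
move=> H w; apply/eqP/contraT => ne.
have [x Kx nt] := cone_ntriv (a ++ w); case: nt.
have E : c * x * c^-1 = x by rewrite H ?mulgK //; apply: cone_cat Kx.
rewrite -E; case: Kx => k _ <-; rewrite dl_conj; apply: sect_triv_dl.
by apply: incomp_size; rewrite ?size_aut.
Qed.

Lemma cone_inter a b x : ~~ comparable_words a b -> cone a x -> cone b x -> x = 1.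
Proof.
move=> n ca /cone_supp cb; have := supp_triv (cone_supp ca) n.
by move=> /triv_sect [_ s1]; rewrite (suppE cb) s1 dl_1.
Qed.

Lemma cone_trans a c w1 w2 : size c = kk -> size w1 = size w2 ->
  exists2 x, cone a x & x (a ++ c ++ w1) = a ++ c ++ w2.
Proof.
move=> sc sw; have [k Kk E] := bdtrans D sc sw.
by exists (dl a k); [exists k|rewrite dlE E].
Qed.

(** If [a] were a proper prefix of [b], another letter after [a] would give elements of [cone a]
    that act off [b]. *)
Lemma cone_comparable a b : cone a `<=` cone b -> prefix b a.
Proof.
move=> ab; have [x cx nt] := cone_ntriv a.
have : comparable_words a b.
  apply/contraT => n; case: nt; apply: supp_triv (cone_supp (ab _ cx)) _.
  by rewrite comparable_sym.
case/orP => // /prefixP [w E]; subst b; case: w ab => [|y w] ab; first by rewrite cats0 prefix_refl.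
have [y' nyy] : exists y' : X, y' != y.
  have /card_gt1P [y1 [y2 [_ _ n12]]] := bdX D.
  by have [E|] := eqVneq y1 y; [exists y2; rewrite -E eq_sym|exists y1].
have [x' cx' nt'] := cone_ntriv (a ++ [:: y']); case: nt'.
have cb := ab _ (cone_cat cx'); apply: supp_triv (cone_supp cb) _.
rewrite /comparable_words !prefix_catr // eqxx !prefix_cons (negPf nyy) eq_sym.
by rewrite (negPf nyy).
Qed.

Definition decided L n := forall a, n <= size a ->
  cone a `<=` L \/ (forall g, L g -> triv a g).

Lemma decided_le L n m : n <= m -> decided L n -> decided L m.
Proof. by move=> le H a le'; apply: H; apply: leq_trans le'. Qed.

Lemma ncone_triv L a : cone a `<=` L -> ~ (forall g, L g -> triv a g).
Proof. by move=> aL H; have [x /aL /H] := cone_ntriv a. Qed.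

(** The double commutator trick. If some [g] in [N] moves a word below [a0], transitivity of a cone
    inside [L] gives, for each deep [a] below [a0], a conjugate of [g] moving a prefix [y] of [a].
    Commutators with it put the copy of [derived K] at [y] into [N], and this contains the cones
    lying [mm] levels further down. *)
Lemma normal_decided L N n : is_subgroup L -> L `<=` G -> is_subgroup N -> N `<=` L ->
  (forall l g, L l -> N g -> N (l * g * l^-1)) -> decided L n ->
  exists m, decided N m.
Proof.
move=> sL LG sN NL nN dL.
pose P a0 m := forall a, m <= size a -> prefix a0 a ->
  cone a `<=` N \/ (forall g, N g -> triv a g).
have [||m Hm] := @word_bound _ (n + kk) P.
- by move=> a0 m m' le H a le' p; apply: H p; apply: leq_trans le'.
- move=> a0 sa0; pose b := take n a0; pose c := drop n a0.
  have sb : size b = n by rewrite size_takel // sa0 leq_addr.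
  have sc : size c = kk by rewrite size_drop sa0 addKn.
  have a0E : a0 = b ++ c by rewrite cat_take_drop.
  have [bL|tb] := dL b (eq_leq (esym sb)); last first.
    exists 0 => a _ /prefixP [w ->]; right=> g /NL /tb tg.
    by rewrite a0E -catA; apply: triv_cat.
  have [tr|/existsNP [g /not_implyP [Ng /existsNP [w gw]]]] :=
      pselect (forall g, N g -> triv a0 g).
    exists 0 => a _ /prefixP [w ->]; right=> g /tr tg; exact: triv_cat.
  pose p := size w; exists (size a0 + p + mm) => a le /prefixP [t Ea]; left.
  have let_ : p + mm <= size t.
    by move: le; rewrite Ea size_cat -addnA leq_add2l.
  (* [y] has the length of the moved word [a0 ++ w], so that a conjugate of [g] moves it, and leaves
     at least [mm] letters of [a]. *)
  pose y := a0 ++ take p t; pose t' := drop p t.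
  have ay : a = y ++ t' by rewrite /y /t' -catA cat_take_drop.
  have st' : mm <= size t' by rewrite size_drop leq_subRL // (leq_trans _ let_) // leq_addr.
  have [l Kl El] : exists2 l, cone b l & l (a0 ++ w) = y.
    have sw : size w = size (take p t).
      by rewrite size_takel // (leq_trans _ let_) // leq_addr.
    have [l Kl El] := @cone_trans b c w (take p t) sc sw.
    by exists l => //; rewrite /y a0E -!catA.
  have [g' Ng' gy] : exists2 g', N g' & g' y != y.
    exists (l * g * l^-1); first by apply: nN => //; apply: bL.
    rewrite !autME -El autKV; apply/eqP => /aut_inj; exact: gw.
  have cyL : cone y `<=` L.
    by apply: subset_trans bL; rewrite /y a0E -!catA; apply: cone_cat.
  (* The conjugate [h] of [x1] by [g'] lives below another word, so [h * x1^-1], which lies in [N],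
     acts below [y] as [x1^-1]; its commutator with [x2] is that of [x1^-1] with [x2]. *)
  have comm x1 x2 : cone y x1 -> cone y x2 -> N (x1^-1 * x2 * x1 * x2^-1).
    move=> c1 c2; pose h := g' * x1 * g'^-1.
    have th : triv y h.
      rewrite /h; case: c1 => k _ <-; rewrite dl_conj; apply: sect_triv_dl.
      by apply: incomp_size; rewrite ?size_aut.
    have hc x : cone y x -> h * x = x * h by move=> /cone_supp sx; apply: triv_comm sx th.
    have N1 : N (h * x1^-1).
      have -> : h * x1^-1 = g' * (x1 * g'^-1 * x1^-1) by rewrite /h !mulgA.
      by apply: subM => //; apply: nN; [apply: cyL|apply: subV].
    pose p0 := x1^-1 * x2 * x1.
    have cp : cone y p0.
      by have sy := cone_sub y; apply: subM => //; apply: subM => //; apply: subV.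
    have Ep : h * p0 * h^-1 = p0 by rewrite (hc _ cp) mulgK.
    have -> : x1^-1 * x2 * x1 * x2^-1 = (h * x1^-1) * (x2 * (h * x1^-1)^-1 * x2^-1).
      by rewrite -/p0 -{1}Ep /p0 (invgM h) invgK !mulgA.
    by apply: subM => //; apply: nN; [exact: cyL|exact: subV].
  have DN : derived K `<=` [set d | N (dl y d)].
    apply: generated_sub.
      split; first by rewrite /= dl_1; apply: sub1.
        by move=> d e /= Nd Ne; rewrite /= dlM; apply: subM.
      by move=> d /= Nd; rewrite /= dlV; apply: subV.
    move=> _ [[x1 x2] /= [K1 K2] <-]; rewrite /commg /conjg !dlM !dlV !mulgA.
    have := @comm (dl y x1) (dl y x2)^-1; rewrite invgK; apply; first by exists x1.
    by apply: subV; [exact: cone_sub|exists x2].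
  move=> _ [k Kk <-]; rewrite ay dl_cat; apply: DN.
  by apply: (bdder D) st' _ (@supp_dl _ _ _); apply: cone_G; exists k.
exists (maxn m (n + kk)) => a; rewrite geq_max => /andP [le1 le2].
apply: (Hm (take (n + kk) a)) => //; first by rewrite size_takel.
by rewrite -{2}(cat_take_drop (n + kk) a) prefix_prefix.
Qed.

(** Below a word [a0] with [cone a0] inside [L], the elements of [K] whose copy at [a0] lies in [L1]
    form a finite index subgroup of [G]; trivial branch kernel, in the form [bdcong], puts all deep
    rigid stabilisers in it. *)
Lemma fi_cone L L1 n : is_subgroup L -> L `<=` G -> is_subgroup L1 ->
  has_finite_index L L1 -> decided L n ->
  exists m, forall a, m <= size a -> cone a `<=` L -> cone a `<=` L1.
Proof.
move=> sL LG sL1 fi dL; have L1L := fi_sub fi.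
pose P a0 m := forall a, m <= size a -> prefix a0 a -> cone a `<=` L -> cone a `<=` L1.
have [||m Hm] := @word_bound _ n P.
- by move=> a0 m m' le H a le' p; apply: H p; apply: leq_trans le'.
- move=> a0 sa0; have [aL|ta] := dL a0 (eq_leq (esym sa0)); last first.
    exists 0 => a _ /prefixP [w ->] /ncone_triv []; move=> g /ta; exact: triv_cat.
  pose M := [set k | K k /\ L1 (dl a0 k)].
  have sM : is_subgroup M by apply: (hom_preim sK) => // g h _ _; rewrite dlM.
  have fM : has_finite_index K M.
    apply: (@fi_preim _ _ (dl a0) K L L1) => //; first by move=> g h _ _; rewrite dlM.
  have [j Hj] := bdcong D sM (fi_trans sG sK sM (bdfi D) fM).
  exists (size a0 + j) => a le0 /prefixP [w Ea] _; move: le0.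
  rewrite Ea size_cat leq_add2l => le.
  move=> _ [k Kk <-]; rewrite dl_cat; have [] := Hj w (dl w k) => //.
    by apply: cone_G; exists k.
  exact: supp_dl.
exists (maxn m n) => a; rewrite geq_max => /andP [le1 le2].
apply: (Hm (take n a)) => //; first by rewrite size_takel.
by rewrite -{2}(cat_take_drop n a) prefix_prefix.
Qed.

Lemma fi_decided L L1 n : is_subgroup L -> L `<=` G -> is_subgroup L1 ->
  has_finite_index L L1 -> decided L n -> exists m, decided L1 m.
Proof.
move=> sL LG sL1 fi dL; have [m Hm] := fi_cone sL LG sL1 fi dL.
exists (maxn m n) => a; rewrite geq_max => /andP [le1 le2].
have [aL|tr] := dL a le2; first by left; apply: Hm.
by right=> g /(fi_sub fi) /tr.
Qed.

(** The product of all cones at words of length [q]: normal of finite index in [G], and the common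
    reference subgroup of the index computations. *)
Definition lev q : set (tree_aut X) :=
  [set g | G g /\ forall z, size z = q -> g z = z /\ K (sect z g)].

Lemma lev_sub q : is_subgroup (lev q).
Proof.
split; first by split=> [|z _]; [exact: sub1|rewrite sect1; split=> //; exact: sub1].
  move=> g h [Gg Hg] [Gh Hh]; split=> [|z sz]; first exact: subM.
  have [gz Kg] := Hg z sz; have [hz Kh] := Hh z sz.
  by rewrite autME sectM hz gz; split=> //; apply: subM.
move=> g [Gg Hg]; split=> [|z sz]; first exact: subV.
have [gz Kg] := Hg z sz; have gz' : g^-1 z = z by rewrite -{1}gz autKV.
by split=> //; rewrite -{1}gz sectV; apply: subV.
Qed.

Lemma lev_G q : lev q `<=` G. Proof. by move=> g []. Qed.

Lemma cone_lev a : cone a `<=` lev (size a).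
Proof.
move=> x cx; split; first exact: cone_G cx.
move=> z sz; have sx := cone_supp cx; have [<-|n] := eqVneq a z.
  by split; [exact: supp_self|exact: cone_sect].
have /triv_sect [-> ->] : triv z x by apply: supp_triv sx _; apply: incomp_size.
by split=> //; apply: sub1.
Qed.

(** [h] is the product of the components [dl t (sect t g)] over [P]. The second clause states this
    as membership in every subgroup containing the components. Nothing is asked of [g] outside
    [P]. *)
Lemma lev_part q g (P : pred (q.-tuple X)) :
  (forall t : q.-tuple X, P t -> g t = t /\ K (sect t g)) -> exists h,
  [/\ lev q h,
      forall M, is_subgroup M ->
        (forall t : q.-tuple X, P t -> M (dl t (sect t g))) -> M h,
      forall t : q.-tuple X, P t -> triv t (h^-1 * g) &
      forall t : q.-tuple X, ~~ P t -> triv t h].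
Proof.
move=> lg; suff H (s : seq (q.-tuple X)) : exists h,
  [/\ lev q h,
      forall M, is_subgroup M ->
        (forall t : q.-tuple X, P t -> M (dl t (sect t g))) -> M h,
      forall t : q.-tuple X, P t -> t \in s -> triv t (h^-1 * g) &
      forall t : q.-tuple X, ~~ (P t && (t \in s)) -> triv t h].
  have [h [lh Mh h1 h2]] := H (enum {: q.-tuple X}); exists h; split=> // t.
    by move=> Pt; apply: h1 => //; rewrite mem_enum.
  by move=> nP; apply: h2; rewrite (negPf nP).
elim: s => [|t s [h [lh Mh h1 h2]]].
  exists 1; split=> //; first exact: sub1 (lev_sub q).
  by move=> M sM _; apply: sub1.
have [Pt|nPt] := boolP (P t && (t \notin s)); last first.
  exists h; split=> // t'.
    rewrite inE => Pt' /orP [/eqP E|]; last exact: h1.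
    by subst t'; apply: h1 => //; move: nPt; rewrite Pt' negbK.
  rewrite inE => nP; apply: h2; apply: contra nP => /andP [-> ->].
  by rewrite orbT.
case/andP: Pt => Pt nts; pose c := dl t (sect t g).
have cc : cone t c by exists (sect t g) => //; have [] := lg t Pt.
have trh : triv t h by apply: h2; rewrite (negPf nts) andbF.
have hc : h * c = c * h by apply: triv_comm trh; apply: supp_dl.
have trc t' : t' != t -> triv t' c.
  by move=> n; apply: sect_triv_dl; apply: incomp_size; rewrite ?size_tuple // eq_sym.
have [gt _] := lg t Pt.
exists (c * h); split.
- by apply: subM => //; [exact: lev_sub|have := cone_lev cc; rewrite size_tuple].
- by move=> M sM HM; apply: subM => //; [exact: HM|exact: Mh].
- move=> t' Pt'; have [-> _|n] := eqVneq t' t.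
    rewrite invgM -mulgA; apply: trivM; first exact: trivV.
    have ct : c t = t := dl_self _ _.
    apply/triv_aut_fix; have ct' : c^-1 t = t by rewrite -{1}ct autKV.
    rewrite autME gt sectM gt ct'; split=> //.
    by rewrite -{1}ct sectV sect_dl mulVg.
  rewrite inE (negPf n) => ts; rewrite -hc invgM -mulgA.
  by apply: trivM; [apply: trivV; apply: trc|apply: h1].
- move=> t'; rewrite inE => nP; apply: trivM.
    have [E|//] := eqVneq t' t; last exact: trc.
    by move: nP; rewrite E eqxx Pt.
  by apply: h2; apply: contra nP => /andP [-> ->]; rewrite orbT.
Qed.

(** In a decided [L] an element of [lev q] is trivial below the words whose cone is not in [L], so
    it is the product of its components in the cones of [L]. *)
Lemma lev_prod q L M g : lev q g -> L g -> decided L q -> is_subgroup M ->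
  (forall a, size a = q -> cone a `<=` L -> cone a `<=` M) -> M g.
Proof.
move=> lg Lg dL sM H.
have [t _|h [lh Mh h1 h2]] := @lev_part q g (fun t : q.-tuple X => `[< cone t `<=` L >]).
  by case: lg => _; apply; apply: size_tuple.
have -> : g = h.
  apply: (mulgI h^-1); rewrite mulVg; apply: (@triv_level_eq1 _ q) => v /eqP sv.
  have [/(h1 (Tuple sv))//|/[dup] n /(h2 (Tuple sv)) th] := boolP `[< cone (Tuple sv) `<=` L >].
  apply: trivM; first exact: trivV.
  have [aL|/(_ _ Lg)//] := dL v (eq_leq (esym (eqP sv))).
  by move/asboolP: n.
apply: Mh => // t /asboolP; have st := size_tuple t => /(H _ st); apply.
by exists (sect t g) => //; case: lg => _ /(_ t st) [].
Qed.

Lemma lev_K q : lev q `<=` K.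
Proof.
move=> g lg; apply: (lev_prod (L := G)) lg (lev_G lg) _ sK _ => [a _|a _ _].
  by left; apply: cone_G.
exact: cone_K.
Qed.

Lemma lev_norm q g x : G g -> lev q x -> lev q (g * x * g^-1).
Proof.
move=> Gg [Gx Hx]; split; first by apply: subM => //; [apply: subM|apply: subV].
move=> z sz; have [] := Hx (g^-1 z); first by rewrite size_aut.
move=> xz Kx; rewrite !autME xz autVK !sectM xz; split=> //.
have -> : sect z g^-1 = (sect (g^-1 z) g)^-1 by rewrite -sectV autVK.
by apply: (bdnorm D) => //; apply: (bdsect D).
Qed.

Lemma lev_fi q : has_finite_index G (lev q).
Proof.
pose B (t : q.-tuple X) := [set g | G g /\ (g t = t /\ K (sect t g))].
have sB t : is_subgroup (B t).
  split; first by split; [exact: sub1|rewrite sect1; split=> //; exact: sub1].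
    move=> g h [Gg [gz Kg]] [Gh [hz Kh]]; split; first exact: subM.
    by rewrite autME sectM hz gz; split=> //; apply: subM.
  move=> g [Gg [gz Kg]]; split; first exact: subV.
  have gz' : g^-1 t = t by rewrite -{1}gz autKV.
  by split=> //; rewrite -{1}gz sectV; apply: subV.
have fB t : has_finite_index G (B t).
  pose c (g : tree_aut X) := (g t, coset_of (sect t g) K).
  apply: (@fi_by _ _ c) => //; first by move=> g [].
    apply: finite_pair_image.
      apply: (@sub_finite_set _ _ (val @` [set: q.-tuple X])).
        move=> _ [g Gg <-]; have sz : size (g t) == q by rewrite size_aut size_tuple.
        by exists (Tuple sz).
      exact/finite_image/finite_finset.
    apply: sub_finite_set (fi_fin (bdfi D)) => _ [g Gg <-].
    by exists (sect t g) => //; apply: (bdsect D).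
  move=> g h Gg Gh [Et /(coset_ofP _ _ sK) Ks]; split.
    by apply: subM => //; apply: subV.
  have gh : (g^-1 * h) t = t by rewrite autME -Et autKV.
  by split=> //; rewrite sectM -Et sectV.
have := fi_bigI sG sB fB; congr has_finite_index; apply/seteqP; split.
  move=> g [Gg Hg]; split=> // z /eqP sz; have [_] := Hg (Tuple sz); by [].
move=> g [Gg Hg]; split=> // t; split=> //; apply: Hg; exact: size_tuple.
Qed.

Lemma cone_normal_lev a l x : lev (size a) l -> cone a x -> cone a (l * x * l^-1).
Proof. by move=> [Gl /(_ a erefl) [la _]]; apply: cone_conj_fix. Qed.

(** [cone a] need not be normal in [L], but it is in the finite index subgroup [E] fixing the level
    of [a]; both inheritance properties of decided subgroups are used in turn on the image side. *)
Lemma cone_image_decided L f a n n' : is_subgroup L -> L `<=` G ->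
  (forall g h, L g -> L h -> f (g * h) = f g * f h) -> f @` L `<=` G ->
  decided L n -> n <= size a -> cone a `<=` L -> decided (f @` L) n' ->
  exists m, decided (f @` cone a) m.
Proof.
move=> sL LG fM fG dL le aL dfL.
pose E := L `&` lev (size a).
have sE : is_subgroup E by apply: is_subgroupI => //; apply: lev_sub.
have fE : has_finite_index L E by apply: fi_setI (lev_fi _) => //; apply: lev_sub.
have EL := fi_sub fE.
have sfL : is_subgroup (f @` L) by apply: (hom_image sL fM).
have sfE : is_subgroup (f @` E) by apply: (hom_image sL fM).
have [m dfE] := fi_decided sfL fG sfE (fi_image sL sE fM fE) dfL.
apply: (normal_decided sfE _ _ _ _ dfE).
- by move=> _ [e /EL Le <-]; apply: fG; exists e.
- by apply: (hom_image sL fM) => //; apply: cone_sub.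
- by move=> _ [x cx <-]; exists x => //; split; [apply: aL|apply: cone_lev].
- move=> _ _ [e [Le le'] <-] [x cx <-]; exists (e * x * e^-1); first exact: cone_normal_lev.
  have Lx := aL _ cx; have Le' := subV sL Le; have Lex := subM sL Le Lx.
  by rewrite !fM // (homV sL fM).
Qed.

End Decided.

Section TupleAction.
Variables (X : finType) (q : nat).
Implicit Types (g h : tree_aut X) (t : q.-tuple X) (S : {set q.-tuple X}).

Definition tact g t : q.-tuple X :=
  Tuple (introT eqP (etrans (size_aut g t) (size_tuple t))).

Lemma tactM g h t : tact (g * h) t = tact g (tact h t).
Proof. exact: val_inj. Qed.

Lemma tact1 t : tact 1 t = t. Proof. exact: val_inj. Qed.

Lemma tactK g : cancel (tact g) (tact g^-1).
Proof. by move=> t; rewrite -tactM mulVg tact1. Qed.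

Lemma tactVK g : cancel (tact g^-1) (tact g).
Proof. by move=> t; rewrite -tactM mulgV tact1. Qed.

Lemma tact_inj g : injective (tact g). Proof. exact: can_inj (tactK g). Qed.

Definition acts g S : {set q.-tuple X} := [set tact g t | t in S]%SET.

Lemma acts1 S : acts 1 S = S.
Proof. by apply/setP => t; rewrite -{1}(tact1 t) mem_imset //; apply: tact_inj. Qed.

Lemma mem_acts g S t : (t \in acts g S) = (tact g^-1 t \in S).
Proof. by rewrite -{1}(tactVK g t) mem_imset //; apply: tact_inj. Qed.

Lemma actsM g h S : acts (g * h) S = acts g (acts h S).
Proof. by apply/setP => t; rewrite !mem_acts invgM tactM. Qed.

Lemma card_acts g S : #|acts g S| = #|S|.
Proof. by rewrite card_imset //; apply: tact_inj. Qed.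

Definition below v : {set q.-tuple X} := [set t : q.-tuple X | prefix v t]%SET.

Lemma below_acts g v : acts g (below v) = below (g v).
Proof. by apply/setP => t; rewrite mem_acts !inE -(aut_prefix g) /= autVK. Qed.

Lemma card_below v : size v <= q -> #|below v| = (#|X| ^ (q - size v))%N.
Proof.
move=> le; rewrite -card_tuple.
have sP (w : (q - size v).-tuple X) : size (v ++ w) == q.
  by rewrite size_cat size_tuple subnKC.
rewrite -(card_imset (f := fun w => Tuple (sP w))); last first.
  move=> w w' /(congr1 val) /= /eqP; rewrite eqseq_cat // eqxx /= => /eqP.
  exact: val_inj.
apply: eq_card => t; rewrite inE; apply/prefixP/imsetP => [[w E]|[w _ ->]]; last by exists w.
have sw : size w == q - size v by rewrite -(size_tuple t) E size_cat addKn.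
by exists (Tuple sw) => //; apply: val_inj.
Qed.

Definition sset S : set (seq X) := [set w | exists2 t, t \in S & val t = w].

Lemma sset_inj : injective sset.
Proof.
move=> S S' E; apply/setP => t; apply/idP/idP => tS.
  have : sset S' t by rewrite -E; exists t.
  by case=> t' ? /val_inj <-.
have : sset S t by rewrite E; exists t.
by case=> t' ? /val_inj <-.
Qed.

End TupleAction.

(** * The index potential and tight sets *)

Section Index.
Variables (X : finType) (G K : set (tree_aut X)) (n0 kk mm : nat).
Hypothesis D : branch_data G K n0 kk mm.
Implicit Types (g h k : tree_aut X) (a b u v w z : seq X).

Let sG := bdG D.
Let sK := bdK D.
Let KG := bdKG D.
Notation cone := (cone K).
Notation lev := (lev G K).
Notation d := #|X|.

Lemma lev_fiK q : has_finite_index K (lev q).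
Proof.
exact: (fi_lower sG sK (lev_sub D q) (lev_fi D q) (@lev_K _ _ _ _ _ _ D q) KG).
Qed.

Definition lidx j := idx K (lev j).
Definition iota := lidx 1.

Lemma lidx_gt0 j : 0 < lidx j.
Proof. by apply: idx_gt0 => //; apply: lev_fiK. Qed.

Lemma lev0 : lev 0 = K.
Proof.
apply/seteqP; split=> [g [_ /(_ [::] erefl) []]|g Kg]; first by rewrite sect_nil.
split=> [|z /size0nil ->]; first exact: KG.
by rewrite aut_nil sect_nil.
Qed.

(** Inside [lev 1] the sections at the d letters are independent and range over all of [K], whence
    the exponent d. *)
Lemma lidxS j : lidx j.+1 = (iota * lidx j ^ d)%N.
Proof.
pose V x := [set u | lev 1 u /\ lev j (sect [:: x] u)].
have fix1 (u : tree_aut X) x : lev 1 u -> u [:: x] = [:: x] /\ K (sect [:: x] u).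
  by case=> _; apply.
have sM (x : X) g h : lev 1 g -> lev 1 h -> sect [:: x] (g * h) = sect [:: x] g * sect [:: x] h.
  by move=> _ Lh; have [hx _] := fix1 h x Lh; rewrite sectM hx.
have sL1 := lev_sub D 1.
have sV x : is_subgroup (V x) := hom_preim sL1 (@sM x) (lev_sub D j).
have fV x : has_finite_index (lev 1) (V x).
  apply: (fi_preim sL1 (@sM x) (lev_sub D j) _ (lev_fiK j)).
  by move=> _ [u Lu <-]; have [] := fix1 u x Lu.
have EL : lev j.+1 = [set u | lev 1 u /\ forall x, x \in enum X -> V x u].
  apply/seteqP; split=> [g [Gg Hg]|g [[Gg H1] HV]].
    have Lj x : lev j (sect [:: x] g).
      split; first exact: (bdsect D).
      move=> z sz; have [|/eqP] := Hg ([:: x] ++ z); first by rewrite /= sz.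
      by rewrite sectE eqseq_cat ?size_aut // => /andP [_ /eqP E]; rewrite sect_cat.
    have L1 : lev 1 g.
      split=> // -[|x [|//]] // _; split; last exact: (lev_K D (Lj x)).
      have [x0 _] : exists x, x \in X by apply/card_gt0P; apply: ltnW (bdX D).
      by have [|/aut_catl] := Hg ([:: x] ++ nseq j x0); rewrite //= size_nseq.
    by split.
  split=> // -[//|x z] [sz]; have [|_ [_ /(_ z sz) [E1 E2]]] := HV x; first by rewrite mem_enum.
  rewrite -cat1s sectE sect_cat E1; have [-> _] := fix1 g x (conj Gg H1); by [].
have fLj : has_finite_index (lev 1) (lev j.+1).
  by rewrite EL; have [] := idx_inter_le (enum X) sL1 sV fV.
rewrite /lidx (idx_tower sK sL1 (lev_sub D j.+1) (lev_fiK 1) fLj).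
congr muln; rewrite EL idx_inter_eq ?enum_uniq //; last first.
  move=> u x L1u; have [ux Ku] := fix1 u x L1u.
  have cw : cone [:: x] (dl [:: x] (sect [:: x] u)) by exists (sect [:: x] u).
  have L1w := cone_lev D cw; exists (dl [:: x] (sect [:: x] u)); split=> //.
    have L1w' : lev 1 (dl [:: x] (sect [:: x] u))^-1 by apply: subV.
    split; first exact: subM.
    rewrite sM // -{1}(@dl_self _ [:: x] (sect [:: x] u)) sectV sect_dl mulVg.
    exact: sub1 (lev_sub D j).
  move=> y nyx; split=> //; have /triv_sect [_ ->] : triv [:: y] (dl [:: x] (sect [:: x] u)).
    apply: sect_triv_dl; apply: incomp_size => //; apply: contra nyx => /eqP [->]; exact: eqxx.
  exact: sub1 (lev_sub D j).
have idV x : idx (lev 1) (V x) = lidx j.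
  apply/eqP; rewrite eqn_leq; apply/andP; split.
    apply: (idx_hom sL1 (sV x) (lev_sub D j) _ (lev_fiK j) (@sM x)) => //.
    - by move=> u [].
    - by move=> u Lu; have [] := fix1 u x Lu.
  apply: (@idx_hom _ _ (dl [:: x]) _ _ _ _ sK (lev_sub D j) (sV x) _ (fV x)) => //.
  - exact: (@lev_K _ _ _ _ _ _ D).
  - by move=> g h _ _; rewrite dlM.
  - by move=> k Kk; apply: (cone_lev D (a := [:: x])); exists k.
  - by move=> k Kk [_]; rewrite sect_dl.
by rewrite (eq_bigr (fun=> lidx j)) // big_enum /= prod_nat_const.
Qed.

(** The recursion solved without division. This identity makes the potential constant on deep
    cones. *)
Lemma lidx_pow j : (lidx j ^ d.-1 * iota = iota ^ (d ^ j))%N.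
Proof.
have d0 : 0 < d by apply: ltnW (bdX D).
elim: j => [|j IH]; first by rewrite expn0 expn1 /lidx lev0 idx_id // exp1n mul1n.
rewrite lidxS expnMn -expnM mulnAC -expnSr prednK // (mulnC d) expnM -expnMn.
by rewrite (mulnC iota) IH -expnM -expnSr.
Qed.

Lemma supp_level q v g : size v <= q ->
  (forall z, size z = q -> ~~ prefix v z -> triv z g) -> supp v g.
Proof.
move=> le H w nw.
have [x0 _] : exists x, x \in X by apply/card_gt0P; apply: ltnW (bdX D).
have [le'|lt] := leqP q (size w).
  rewrite -(cat_take_drop q w); apply: H; first exact: size_takel.
  apply: contra nw => /prefixP [s E]; rewrite -(cat_take_drop q w) E -catA.
  exact: prefix_prefix.
have [s [ns sz]] : exists s, ~~ prefix v (w ++ s) /\ size (w ++ s) = q.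
  have [/prefixP [[|y s] Ev]|nwv] := boolP (prefix w v).
  - by move: nw; rewrite Ev cats0 prefix_refl.
  (* A proper prefix [w] of [v] is extended by a letter that leaves the path to [v]. *)
  - have [y' nyy] : exists y', y' != y.
      have /card_gt1P [y1 [y2 [_ _ n12]]] := bdX D.
      by have [E|] := eqVneq y1 y; [exists y2; rewrite -E eq_sym|exists y1].
    exists (y' :: nseq (q - size w).-1 x0); split.
      by rewrite Ev prefix_catr // eqxx prefix_cons eq_sym (negPf nyy).
    by rewrite size_cat /= size_nseq prednK ?subn_gt0 // subnKC // ltnW.
  - exists (nseq (q - size w) x0); split.
      apply: contra nw => /comparable_cat; rewrite /comparable_words (negPf nwv) orbF.
      by [].
    by rewrite size_cat size_nseq subnKC // ltnW.
by apply: (@aut_catl _ _ _ s); rewrite -{2}(cats0 (w ++ s)) -{1}(cats0 (w ++ s)); apply: H.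
Qed.

Section Level.
Variable q : nat.
Implicit Types (S : {set q.-tuple X}) (t : q.-tuple X).

(** Nothing is asked on [S], whose words may be permuted; this freedom is what [ridx] measures
    against [lev q]. *)
Definition Rb S : set (tree_aut X) :=
  [set g | G g /\ forall t, t \notin S -> g t = t /\ K (sect t g)].

Lemma Rb_sub S : is_subgroup (Rb S).
Proof.
split; first by split=> [|t _]; [exact: sub1|rewrite sect1; split=> //; exact: sub1].
  move=> g h [Gg Hg] [Gh Hh]; split=> [|t nt]; first exact: subM.
  have [gz Kg] := Hg t nt; have [hz Kh] := Hh t nt.
  by rewrite autME sectM hz gz; split=> //; apply: subM.
move=> g [Gg Hg]; split=> [|t nt]; first exact: subV.
have [gz Kg] := Hg t nt; have gz' : g^-1 t = t by rewrite -{1}gz autKV.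
by split=> //; rewrite -{1}gz sectV; apply: subV.
Qed.

Lemma Rb_G S : Rb S `<=` G. Proof. by move=> g []. Qed.

Lemma lev_Rb S : lev q `<=` Rb S.
Proof. by move=> g [Gg Hg]; split=> // t _; apply: Hg; apply: size_tuple. Qed.

Lemma Rb_mono S S' : S \subset S' -> Rb S `<=` Rb S'.
Proof.
move=> /fintype.subsetP SS' g [Gg Hg]; split=> // t nt; apply: Hg.
by apply: contra nt; apply: SS'.
Qed.

Lemma RbI S S' : Rb S `&` Rb S' = Rb (S :&: S').
Proof.
apply/seteqP; split=> [g [[Gg H] [_ H']]|g Hg].
  by split=> // t; rewrite inE negb_and => /orP [/H|/H'].
by split; apply: Rb_mono Hg; [exact: subsetIl|exact: subsetIr].
Qed.

Lemma Rb_fi S : has_finite_index (Rb S) (lev q).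
Proof.
exact: (fi_lower sG (Rb_sub S) (lev_sub D q) (lev_fi D q) (@lev_Rb S) (@Rb_G S)).
Qed.

Lemma Rb_conj S g x : G g -> Rb S x -> Rb (acts g S) (g * x * g^-1).
Proof.
move=> Gg [Gx Hx]; split; first by apply: subM => //; [apply: subM|apply: subV].
move=> t; rewrite mem_acts => nt; have [xz Kx] : x (g^-1 t) = g^-1 t /\ K (sect (g^-1 t) x) := Hx _ nt.
rewrite !autME xz autVK !sectM xz; split=> //.
have -> : sect t g^-1 = (sect (g^-1 t) g)^-1 by rewrite -sectV autVK.
by apply: (bdnorm D) => //; apply: (bdsect D).
Qed.

Definition ridx S := idx (Rb S) (lev q).

Lemma ridx_gt0 S : 0 < ridx S.
Proof. by apply: idx_gt0; [exact: Rb_sub|exact: Rb_fi]. Qed.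

Lemma ridx_acts_le S g : G g -> ridx (acts g S) <= ridx S.
Proof.
move=> Gg; apply: (@idx_le _ _ _ _ _ _ (fun x => g^-1 * x * g)).
- exact: (lev_sub D q).
- exact: (lev_sub D q).
- exact: lev_Rb.
- exact: Rb_fi.
- move=> x /(Rb_conj (subV sG Gg)); rewrite invgK -actsM mulVg acts1; by [].
- move=> x y _ _ /(lev_norm D Gg).
  by rewrite !invgM !invgK -!mulgA !mulVKg mulgV mulg1.
Qed.

Lemma ridx_acts S g : G g -> ridx (acts g S) = ridx S.
Proof.
move=> Gg; apply/eqP; rewrite eqn_leq ridx_acts_le //=.
by have := ridx_acts_le (acts g S) (subV sG Gg); rewrite -actsM mulVg acts1.
Qed.

Section Supermodular.
Variables S S' : {set q.-tuple X}.
Let U := Rb (S :|: S').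
Let AU : Rb S `<=` U. Proof. exact: Rb_mono (finset.subsetUl _ _). Qed.
Let BU : Rb S' `<=` U. Proof. exact: Rb_mono (finset.subsetUr _ _). Qed.
Let sU : is_subgroup U := Rb_sub _.
Let fUB : has_finite_index U (Rb S').
Proof. exact: (fi_upper sU (Rb_sub S') (lev_sub D q) (Rb_fi _) (@lev_Rb S') BU). Qed.

Let rS : (ridx S = idx (Rb S) (Rb S `&` Rb S') * ridx (S :&: S'))%N.
Proof.
rewrite {1}/ridx (idx_tower (Rb_sub S) (Rb_sub (S :&: S')) (lev_sub D q)).
- by rewrite RbI.
- rewrite -RbI; apply: fi_setI fUB => //; exact: Rb_sub.
- exact: Rb_fi.
Qed.

Let rU : ridx (S :|: S') = (idx U (Rb S') * ridx S')%N.
Proof. exact: (idx_tower sU (Rb_sub S') (lev_sub D q) fUB (Rb_fi _)). Qed.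

(** [Rb S] and [Rb S'] meet in the group of the intersection and lie in that of the union, so the
    index of the former intersection in [Rb S] is at most that of [Rb S'] in the latter. Equality
    means that the two groups factorise the group of the union. *)
Lemma ridx_supermod : (ridx S * ridx S' <= ridx (S :|: S') * ridx (S :&: S'))%N.
Proof.
rewrite rS rU mulnAC leq_mul2r leq_mul2r; apply/orP; right; apply/orP; right.
apply: idx_setI_le => //; exact: Rb_sub.
Qed.

Lemma ridx_modular (u : tree_aut X) : (ridx S * ridx S' = ridx (S :|: S') * ridx (S :&: S'))%N ->
  U u -> exists2 a, Rb S a & Rb S' (a^-1 * u).
Proof.
rewrite rS rU mulnAC => /eqP; rewrite eqn_pmul2r ?ridx_gt0 // eqn_pmul2r ?ridx_gt0 //.
move=> /eqP E Uu; apply: (idx_setI_eq (Rb_sub S) (Rb_sub S') AU fUB E Uu).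
Qed.

End Supermodular.

Lemma cone_idx v : size v <= q -> idx (cone v) (cone v `&` lev q) = lidx (q - size v).
Proof.
move=> le; have -> : cone v `&` lev q = dl v @` lev (q - size v).
  apply/seteqP; split.
    move=> _ [[k Kk <-] [Gk Hk]]; exists k => //; split; first exact: KG.
    move=> z sz; have [|/eqP] := Hk (v ++ z); first by rewrite size_cat sz subnKC.
    by rewrite dlE eqseq_cat // eqxx => /= /eqP E; rewrite sect_cat sect_dl.
  move=> _ [k lk <-]; have Kk := lev_K D lk; have ck : cone v (dl v k) by exists k.
  split=> //; split; first exact: (cone_G D ck).
  move=> z sz; have [/prefixP [w Ez]|n] := boolP (prefix v z).
    have [_ /(_ w)] := lk; rewrite Ez dlE sect_cat sect_dl => -[|-> Kw]; last by [].
    by rewrite -sz Ez size_cat addKn.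
  have /triv_sect [-> ->] : triv z (dl v k).
    by apply: supp_triv (@supp_dl _ _ _) (nprefix_incomp _ n); rewrite sz.
  by split=> //; apply: sub1.
apply: idx_iso => //; [exact: (lev_sub D)|exact: lev_fiK|by move=> g h _ _; rewrite dlM|].
by move=> g h _ _ /dl_inj.
Qed.

(** The part of [u] outside the cone of [v] lies in [lev q]; dividing it out leaves an element of
    the rigid stabiliser of [v], which is [cone v] at this depth. *)
Lemma Rb_below v (u : tree_aut X) : n0 <= size v -> size v <= q -> Rb (below q v) u ->
  exists2 a, cone v a & lev q (a^-1 * u).
Proof.
move=> le0 le Ru; have [Gu Hu] := Ru.
have [t nt|h [lh _ h1 h2]] := @lev_part _ _ _ _ _ _ D q u (fun t => ~~ prefix v t).
  by apply: Hu; rewrite inE.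
have Gh := lev_G lh.
exists (h^-1 * u).
  apply: (cone_of D) => //; first by apply: subM => //; apply: subV.
  apply: (supp_level le) => z /eqP sz nz; exact: (h1 (Tuple sz)).
rewrite invgM invgK.
by have := lev_norm D (subV sG Gu) lh; rewrite invgK.
Qed.

Lemma ridx_below v : n0 <= size v -> size v <= q -> ridx (below q v) = lidx (q - size v).
Proof.
move=> le0 le; rewrite -cone_idx //; apply/esym/idx_setI_prod.
- exact: (cone_sub D).
- exact: Rb_sub.
- exact: (lev_sub D q).
- move=> x cx; split; first exact: (cone_G D cx).
  move=> t; rewrite inE => nt; have sx := cone_supp cx.
  have /triv_sect [-> ->] : triv t x.
    by apply: supp_triv sx (nprefix_incomp _ nt); rewrite size_tuple.
  by split=> //; apply: sub1.
- exact: Rb_fi.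
- by move=> u; apply: Rb_below.
Qed.

(** The translates of such an [S] are pairwise equal or disjoint and cover the level by
    transitivity, so tree-primitivity applies to them. *)
Lemma block_below S : S != finset.set0 ->
  (forall g, G g -> acts g S :&: S != finset.set0 -> acts g S = S) ->
  exists2 v, size v <= q & S = below q v.
Proof.
move=> /set0Pn [t0 t0S] blk.
have blk2 g h : G g -> G h -> acts g S :&: acts h S != finset.set0 -> acts g S = acts h S.
  move=> Gg Gh /set0Pn [t /setIP [tg th]].
  have E : acts (h^-1 * g) S = S.
    apply: blk; first by apply: subM => //; apply: subV.
    apply/set0Pn; exists (tact h^-1 t); apply/setIP; split; last by rewrite -mem_acts.
    by rewrite actsM mem_acts tactK.
  by rewrite -{2}E -actsM mulVKg.
have [||m le E] := bdprim D (n := q) (P := [set sset (acts g S) | g in G]).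
- split.
  + apply/seteqP; split=> [w [_ [g Gg <-] [t _ <-]]|w /eqP sw]; first exact: size_tuple.
    have [g Gg gt] := bdLT D (size_tuple t0) (eqP sw).
    exists (sset (acts g S)); first by exists g.
    exists (Tuple sw) => //; rewrite mem_acts.
    by have -> : tact g^-1 (Tuple sw) = t0 by apply: val_inj; rewrite /= -gt; apply: autKV.
  + move=> _ _ [g Gg <-] [h Gh <-] [w [[t tg <-] [t' th /val_inj E]]] /=.
    by rewrite (blk2 g h) //; apply/set0Pn; exists t; rewrite inE tg -E th.
  + move=> _ [g Gg <-]; exists (tact g t0), (tact g t0) => //.
    by rewrite mem_acts tactK.
- move=> h _ Gh [g Gg <-]; exists (h * g); first exact: subM.
  apply/seteqP; split=> [_ [t tg <-]|_ [_ [t tg <-] <-]].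
    exists (h^-1 t); last by rewrite autVK.
    by exists (tact h^-1 t) => //; rewrite -mem_acts -actsM.
  by exists (tact h t) => //; rewrite actsM mem_acts tactK.
have : cone_partition q m (sset S) by rewrite -E; exists 1; [exact: sub1|rewrite acts1].
case=> v sv Sv; exists v; first by rewrite sv.
apply: sset_inj; rewrite -Sv; apply/seteqP; split=> [_ [w sw <-]|_ [t + <-]].
  have sz : size (v ++ w) == q by rewrite size_cat sv sw subnKC.
  by exists (Tuple sz) => //; rewrite inE /= prefix_prefix.
rewrite inE => /prefixP [w Et]; exists w => //.
by rewrite /level /= -(size_tuple t) Et size_cat sv addKn.
Qed.

(** Staying below one word of length [n0] ensures that any cone met is deep enough for its index to
    be known; overlapping members lie below the same word, so unions stay in the family. *)
Definition fam S := (S != finset.set0) && [exists u : n0.-tuple X, S \subset below q u].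
Let Q := #|{: q.-tuple X}|.
(* The potential r(S)^(d-1) / iota^|S|, multiplied by iota^Q to stay in nat. *)
Definition wt S := (ridx S ^ d.-1 * iota ^ (Q - #|S|))%N.

Lemma wt_acts S g : G g -> wt (acts g S) = wt S.
Proof. by move=> Gg; rewrite /wt ridx_acts // card_acts. Qed.

Lemma fam_acts S g : G g -> fam S -> fam (acts g S).
Proof.
move=> Gg /andP [/set0Pn [t tS] /existsP [u Su]]; apply/andP; split.
  by apply/set0Pn; exists (tact g t); rewrite mem_acts tactK.
have sz : size (g u) == n0 by rewrite size_aut size_tuple.
apply/existsP; exists (Tuple sz); rewrite -below_acts; exact: imsetS.
Qed.

Lemma card_le_Q S : #|S| <= Q. Proof. exact: max_card. Qed.

Let expUI S S' : (Q - #|S| + (Q - #|S'|) = Q - #|S :|: S'| + (Q - #|S :&: S'|))%N.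
Proof.
have := cardsUI S S'; have := card_le_Q (S :|: S'); have := card_le_Q (S :&: S').
have := card_le_Q S; have := card_le_Q S'; lia.
Qed.

Lemma wt_supermod S S' : (wt S * wt S' <= wt (S :|: S') * wt (S :&: S'))%N.
Proof.
rewrite /wt mulnACA [leqRHS]mulnACA -!expnMn -!expnD expUI leq_mul2r.
apply/orP; right; have := bdX D; case: d => [//|[//|s]] _.
by rewrite leq_exp2r //; apply: ridx_supermod.
Qed.

Lemma iota_gt0 : 0 < iota. Proof. exact: lidx_gt0. Qed.

Lemma wt_gt0 S : 0 < wt S.
Proof. by rewrite muln_gt0 !expn_gt0 ridx_gt0 iota_gt0. Qed.

Lemma fam_UI S S' : fam S -> fam S' -> S :&: S' != finset.set0 ->
  fam (S :|: S') && fam (S :&: S').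
Proof.
move=> /andP [nS /existsP [u Su]] /andP [nS' /existsP [u' Su']] /[dup] nI /set0Pn [t /setIP [tS tS']].
have E : u = u'.
  apply: val_inj => /=; have := fintype.subsetP Su _ tS; have := fintype.subsetP Su' _ tS'.
  by rewrite !inE !prefixE !size_tuple => /eqP <- /eqP <-.
subst u'; apply/andP; split; apply/andP; split => //.
- by apply/set0Pn; exists t; apply/setUP; left.
- by apply/existsP; exists u; rewrite finset.subUset Su Su'.
- by apply/existsP; exists u; apply: fintype.subset_trans Su; apply: finset.subsetIl.
Qed.

Hypothesis n0q : n0 <= q.

Lemma wt_below v : n0 <= size v -> size v <= q -> wt (below q v) = (iota ^ Q.-1)%N.
Proof.
move=> le0 le; have Q0 : 0 < Q.
  by rewrite /Q card_tuple expn_gt0; apply/orP; left; apply: ltnW (bdX D).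
apply/eqP; rewrite -(eqn_pmul2r iota_gt0) -expnSr prednK // /wt ridx_below //.
rewrite mulnAC lidx_pow -expnD -card_below // subnKC //; exact: card_le_Q.
Qed.

(* A maximiser of least cardinality does not overlap its translates, hence is a
   block of imprimitivity, hence a cone. *)
Lemma wt_bound S : fam S -> wt S <= (iota ^ Q.-1)%N.
Proof.
move=> fS; case: (arg_maxnP wt fS) => M fM maxM.
apply: leq_trans (maxM _ fS) _.
have PM : fam M && (wt M <= wt M) by rewrite fM leqnn.
case: (arg_minnP (fun T : {set q.-tuple X} => #|T|) (P := fun T => fam T && (wt M <= wt T)) PM).
move=> T /andP [fT wT] minT; apply: leq_trans (wT) _.
have [v le E] : exists2 v, size v <= q & T = below q v.
  apply: block_below; first by case/andP: fT.
  move=> g Gg ov; have fg := fam_acts Gg fT.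
  have /andP [fU fI] := fam_UI fg fT ov.
  have : wt M <= wt (acts g T :&: T).
    rewrite -(leq_pmul2l (wt_gt0 M)); apply: leq_trans (leq_mul wT wT) _.
    rewrite -{1}(wt_acts T Gg); apply: leq_trans (wt_supermod _ _) _.
    by rewrite leq_mul2r; apply/orP; right; apply: maxM.
  move=> wI; have := minT (acts g T :&: T); rewrite fI wI => /(_ isT) leT.
  have E : acts g T :&: T = T by apply/eqP; rewrite eqEcard finset.subsetIr leT.
  by apply/esym/eqP; rewrite eqEcard card_acts leqnn andbT -{1}E finset.subsetIl.
rewrite E wt_below //.
case/andP: fT => _ /existsP [u /subset_leq_card]; rewrite E !card_below ?size_tuple //.
rewrite leq_exp2l ?(bdX D) // => h; by rewrite -(leq_sub2lE _ n0q).
Qed.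

Definition tight S := fam S && (wt S == iota ^ Q.-1)%N.

Lemma tight_acts S g : G g -> tight S -> tight (acts g S).
Proof. by move=> Gg /andP [fS wS]; rewrite /tight fam_acts // wt_acts. Qed.

(** Supermodularity bounds the product of two maximal values by a product of two values at most
    maximal, so all are equalities; equality of the indices then yields the factorisation. *)
Lemma tight_union S S' : tight S -> tight S' -> S :&: S' != finset.set0 ->
  tight (S :|: S') /\
  (forall u : tree_aut X, Rb (S :|: S') u -> exists2 a, Rb S a & Rb S' (a^-1 * u)).
Proof.
move=> /andP [fS /eqP wS] /andP [fS' /eqP wS'] ov.
have /andP [fU fI] := fam_UI fS fS' ov.
have M0 : 0 < (iota ^ Q.-1)%N by rewrite expn_gt0 iota_gt0.
have bU := wt_bound fU; have bI := wt_bound fI.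
have := wt_supermod S S'; rewrite wS wS' => sm.
have EU : wt (S :|: S') = (iota ^ Q.-1)%N.
  apply/eqP; rewrite eqn_leq bU -(leq_pmul2r M0); apply: leq_trans sm _.
  by rewrite leq_mul2l bI orbT.
have EI : wt (S :&: S') = (iota ^ Q.-1)%N.
  apply/eqP; rewrite eqn_leq bI -(leq_pmul2l M0); apply: leq_trans sm _.
  by rewrite leq_mul2r bU orbT.
split; first by rewrite /tight fU EU eqxx.
move=> u; apply: ridx_modular; apply/eqP.
have : (wt S * wt S' == wt (S :|: S') * wt (S :&: S'))%N by rewrite wS wS' EU EI.
rewrite /wt mulnACA [X in _ == X]mulnACA -!expnMn -!expnD expUI eqn_pmul2r.
  by have := bdX D; case: d => [//|[//|s]] _; rewrite eqn_exp2r.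
by rewrite expn_gt0 iota_gt0.
Qed.

Let wt_iota S : S != finset.set0 ->
  (wt S * iota = ridx S ^ d.-1 * iota * iota ^ (Q - #|S|))%N /\
  (iota ^ Q.-1 * iota = iota ^ #|S| * iota ^ (Q - #|S|))%N.
Proof.
move=> n; rewrite /wt mulnAC -expnD subnKC ?card_le_Q // -expnSr prednK //.
by apply: leq_trans (card_le_Q S); rewrite card_gt0.
Qed.

(** [wt_bound] with the auxiliary power of [iota] cancelled, so that the size of the level no longer
    appears. *)
Lemma ridx_bound S : fam S -> (ridx S ^ d.-1 * iota <= iota ^ #|S|)%N.
Proof.
move=> fS; have [n _] := andP fS; have [E1 E2] := wt_iota n.
rewrite -(@leq_pmul2r (iota ^ (Q - #|S|))) ?expn_gt0 ?iota_gt0 // -E1 -E2.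
by rewrite leq_pmul2r ?iota_gt0 // wt_bound.
Qed.

Lemma ridx_tight S : fam S -> (iota ^ #|S| <= ridx S ^ d.-1 * iota)%N -> tight S.
Proof.
move=> fS; have [n _] := andP fS; have [E1 E2] := wt_iota n.
rewrite -(@leq_pmul2r (iota ^ (Q - #|S|))) ?expn_gt0 ?iota_gt0 // -E1 -E2.
by rewrite leq_pmul2r ?iota_gt0 // /tight fS eqn_leq wt_bound.
Qed.

End Level.

End Index.

(** * Tight sets move words as freely as a cone does *)

Section TightOrbit.
Variables (X : finType) (G K : set (tree_aut X)) (n0 kk mm : nat).
Hypothesis D : branch_data G K n0 kk mm.
Variable q : nat.
Hypothesis n0q : n0 <= q.
Let sG := bdG D.
Let sK := bdK D.
Notation cone := (cone K).
Notation below := (below q).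
Implicit Types (O S : {set q.-tuple X}) (t : q.-tuple X) (g h x : tree_aut X).

(** Overlapping translates of [O] are glued up to a block [C], which is a cone. At the last union,
    elements of [Rb] of the cone factor as one for a translate of [O] times one for a tight proper
    subset; on a word outside that subset the second factor only acts as [K], so the translate of
    [O] does all the moving. *)
Lemma tight_orbit O : tight G K n0 O -> exists v zeta,
  [/\ n0 <= size v <= q, O \subset below v, zeta \in O &
      forall x w, cone v x -> exists2 y, Rb G K O y & y (val zeta ++ w) = x (val zeta ++ w)].
Proof.
move=> tO; have /andP [/andP [/set0Pn [z0 z0O] /existsP [u0 Ou0]] _] := tO.
(* Two words are joined when one translate of [O] contains both; the connected components are blocks
   because translation preserves the relation. *)
pose e t t' := `[< exists g, [/\ G g, t \in acts g O & t' \in acts g O] >].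
have eP g t t' : G g -> t \in acts g O -> t' \in acts g O -> e t t'.
  by move=> Gg tg tg'; apply/asboolP; exists g.
have e_sym : symmetric e.
  by move=> t t'; apply/asboolP/asboolP => -[g [Gg tg tg']]; exists g.
have eact h t t' : G h -> e t t' -> e (tact h t) (tact h t').
  move=> Gh /asboolP [g [Gg tg tg']]; apply: (eP (h * g)); first exact: subM.
    by rewrite actsM mem_acts tactK.
  by rewrite actsM mem_acts tactK.
have cact h t t' : G h -> connect e t t' -> connect e (tact h t) (tact h t').
  move=> Gh /connectP [p ep ->]; elim: p t ep => [|t1 p IH] t /=; first by rewrite connect0.
  move=> /andP [e1 /IH]; apply: connect_trans (connect1 _); exact: eact.
have csym : connect_sym e by apply: sym_connect_sym.
pose C : {set q.-tuple X} := [set t | connect e z0 t]%SET.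
have Ctriv t t' : t \in C -> e t t' -> t' \in C.
  by move=> tC e1; move: tC; rewrite !inE => c1; exact: (connect_trans c1 (connect1 e1)).
have O1 t : (t \in acts 1 O) = (t \in O) by rewrite acts1.
have OC : O \subset C.
  apply/fintype.subsetP => t tO'; rewrite inE; apply: connect1.
  by apply: (eP 1); rewrite ?O1 //; apply: sub1.
have [v lev' EC] : exists2 v, size v <= q & C = below v.
  apply: (block_below D); first by apply/set0Pn; exists z0; rewrite inE connect0.
  move=> g Gg /set0Pn [t /setIP [tg]]; rewrite inE => ct.
  have ct' : connect e (tact g z0) t.
    by move: tg; rewrite mem_acts inE => /(cact g _ _ Gg); rewrite tactVK.
  apply/setP => t'; rewrite mem_acts !inE; apply/idP/idP => c1.
    apply: (connect_trans ct); rewrite csym in ct'; apply: (connect_trans ct').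
    by rewrite -(tactVK g t'); apply: cact.
  rewrite -(tactK g z0); apply: cact; first exact: subV.
  by apply: (connect_trans ct'); rewrite csym in ct; apply: connect_trans ct c1.
have Cu0 : C \subset below u0.
  have etake t t' : e t t' -> take n0 t = take n0 t'.
    move=> /asboolP [g [Gg tg tg']].
    have tk s : s \in acts g O -> take n0 s = g u0.
      rewrite mem_acts => /(fintype.subsetP Ou0); rewrite inE /= -(aut_prefix g).
      have -> : g (aut_inv g s) = s := autVK g s.
      by rewrite prefixE size_aut size_tuple => /eqP.
    by rewrite !tk.
  apply/fintype.subsetP => t; rewrite !inE => /connectP [p ep ->].
  have : prefix u0 z0 by have := fintype.subsetP Ou0 _ z0O; rewrite inE.
  elim: p (z0) ep => [|t1 p IH] t0 //= /andP [/etake e1 /IH {}IH] p0; apply: IH.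
  by move: p0; rewrite !prefixE size_tuple e1.
have len0 : n0 <= size v.
  move/subset_leq_card: Cu0; rewrite EC !card_below ?size_tuple //.
  by rewrite leq_exp2l ?(bdX D) // => h; rewrite -(leq_sub2lE _ n0q).
have coneRb (S : {set q.-tuple X}) x : S = below v -> cone v x -> Rb G K S x.
  move=> -> cx; split; first exact: (cone_G D cx).
  move=> t; rewrite inE => nt; have sx := cone_supp cx.
  have /triv_sect [-> ->] : triv t x.
    by apply: supp_triv sx (nprefix_incomp _ nt); rewrite size_tuple.
  by split=> //; apply: sub1.
have [EOC|nOC] := eqVneq O C.
  exists v, z0; split; rewrite ?len0 ?lev' //; first by rewrite -EC.
  by move=> x w cx; exists x => //; apply: coneRb => //; rewrite EOC.
(* A largest tight set strictly inside [C]: some translate of [O] overlaps it without being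
   contained in it, and by maximality their union is [C]. *)
pose F S := [&& tight G K n0 S, O \subset S, S \subset C & S != C].
have FO : F O by rewrite /F tO subxx OC nOC.
case: (arg_maxnP (fun S => #|S|) FO) => S /and4P [tS OS SC nSC] maxS.
have [g [Gg [t1 t1g t1S] [t2 t2g t2S]]] : exists g, [/\ G g,
    exists2 t1, t1 \in acts g O & t1 \in S & exists2 t2, t2 \in acts g O & t2 \notin S].
  apply/not_existsP => H; case/negP: nSC; rewrite finset.eqEsubset SC /=.
  apply/fintype.subsetP => t; rewrite inE => /connectP [p ep ->].
  have : z0 \in S by apply: (fintype.subsetP OS).
  elim: p (z0) ep => [|s p IH] t0 //= /andP [/asboolP [g [Gg tg sg]] /IH {}IH] t0S; apply: IH.
  apply/negPn/negP => nsS; apply: (H g); split=> //; by [exists t0|exists s].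
have gOC : acts g O \subset C.
  apply/fintype.subsetP => t tg; apply: (Ctriv t1); first exact: (fintype.subsetP SC).
  exact: eP Gg t1g tg.
have tg : tight G K n0 (acts g O) by apply: (tight_acts D).
have ov : acts g O :&: S != finset.set0 by apply/set0Pn; exists t1; rewrite inE t1g.
have [tU prodU] := tight_union D n0q tg tS ov.
have EU : acts g O :|: S = C.
  apply/eqP/negPn/negP => nUC.
  have FU : F (acts g O :|: S).
    by rewrite /F tU (fintype.subset_trans OS (finset.subsetUr _ _)) finset.subUset gOC SC nUC.
  have := maxS _ FU; apply/negP; rewrite -ltnNge; apply: proper_card.
  apply/properP; split; first exact: finset.subsetUr.
  by exists t2 => //; rewrite inE t2g.
have Gg' := subV sG Gg.
exists (g^-1 v), (tact g^-1 t2); split.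
- by rewrite size_aut len0 lev'.
- rewrite -below_acts -EC -(acts1 O) -(mulVg g) actsM; exact: imsetS.
- by rewrite -mem_acts.
move=> x w cx; have cx' : cone v (g * x * g^-1).
  by have := cone_conj D Gg cx; rewrite autVK.
have [a Ra] := prodU _ (coneRb _ _ (etrans EU EC) cx').
move: (a^-1 * _) (esym (mulVKg a (g * x * g^-1))) => b Eb Rb'.
have [_ /(_ t2 t2S) [bt Kb]] := Rb'.
(* [b] fixes [t2] and acts there through [K]; keeping only this component of [b] leaves the images
   of the words below [t2] unchanged and stays in [Rb] of the translate. *)
pose y := a * dl t2 (sect t2 b).
have Ry : Rb G K (acts g O) y.
  apply: subM => //; first exact: (Rb_sub D).
  have ct : cone t2 (dl t2 (sect t2 b)) by exists (sect t2 b).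
  by apply: lev_Rb; have := cone_lev D ct; rewrite size_tuple.
have ygx w' : y (t2 ++ w') = (g * x * g^-1) (t2 ++ w').
  by rewrite Eb /y !autME dlE (sectE t2 b) bt.
clearbody y; exists (g^-1 * y * g).
  by have := Rb_conj D Gg' Ry; rewrite invgK -actsM mulVg acts1.
have gt : g (val (tact g^-1 t2)) = t2 := autVK g t2.
rewrite !autME (sectE (val (tact g^-1 t2)) g) gt ygx -gt -sectE !autME.
by rewrite autKV autKV.
Qed.

End TightOrbit.

(** * Rigidity of isomorphisms between decided subgroups *)

Record iso_data (X : finType) (G K B B' : set (tree_aut X))
    (f f' : tree_aut X -> tree_aut X) (n : nat) : Prop := IsoData {
  idB : is_subgroup B;
  idB' : is_subgroup B';
  idBG : B `<=` G;
  idBG' : B' `<=` G;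
  idD : decided K B n;
  idD' : decided K B' n;
  idM : forall g h, B g -> B h -> f (g * h) = f g * f h;
  idM' : forall g h, B' g -> B' h -> f' (g * h) = f' g * f' h;
  idf : forall g, B g -> B' (f g);
  idf' : forall g, B' g -> B (f' g);
  idK : forall g, B g -> f' (f g) = g;
  idK' : forall g, B' g -> f (f' g) = g }.

Lemma iso_sym (X : finType) (G K B B' : set (tree_aut X)) f f' n :
  iso_data G K B B' f f' n -> iso_data G K B' B f' f n.
Proof. by case. Qed.

Section Iso.
Variables (X : finType) (G K B B' : set (tree_aut X)) (n0 kk mm : nat).
Variables (f f' : tree_aut X -> tree_aut X) (n : nat).
Hypothesis D : branch_data G K n0 kk mm.
Hypothesis I : iso_data G K B B' f f' n.
Let sG := bdG D.
Let sK := bdK D.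
Let sB := idB I.
Let sB' := idB' I.
Notation cone := (cone K).
Notation lev := (lev G K).
Implicit Types (g h : tree_aut X) (a b u v w z : seq X).

Lemma iso_inj g h : B g -> B h -> f g = f h -> g = h.
Proof. by move=> Bg Bh E; rewrite -(idK I Bg) E (idK I). Qed.

Lemma iso_image : f @` B = B'.
Proof.
apply/seteqP; split=> [_ [g Bg <-]|g Bg]; first exact: (idf I).
by exists (f' g); [exact: (idf' I)|exact: (idK' I)].
Qed.

Lemma iso_ntriv a : n <= size a -> forall w, cone (a ++ w) `<=` B -> cone a `<=` B.
Proof.
move=> le w aB; have [//|tr] := idD I le; case: (ncone_triv D aB) => g /tr.
exact: triv_cat.
Qed.

Lemma img_decided a : n <= size a -> cone a `<=` B -> exists m, decided K (f @` cone a) m.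
Proof.
move=> le aB; apply: (cone_image_decided D sB (idBG I) (idM I) _ (idD I) le aB (n' := n)).
  by rewrite iso_image; apply: (idBG' I).
by rewrite iso_image; apply: (idD' I).
Qed.

Lemma img_decided_level p : n <= p -> exists m, forall a, size a = p ->
  cone a `<=` B -> decided K (f @` cone a) m.
Proof.
move=> le; apply: (@word_bound _ p (fun a m => cone a `<=` B -> decided K (f @` cone a) m)).
  by move=> a m m' le' H aB; apply: decided_le le' (H aB).
move=> a sa; have [aB|nB] := pselect (cone a `<=` B); last by exists 0.
have [|m Hm] := img_decided _ aB; first by rewrite sa.
by exists m.
Qed.

Lemma img_cover p m z : n <= p ->
  (forall a, size a = p -> cone a `<=` B -> decided K (f @` cone a) m) ->
  m <= size z -> cone z `<=` B' ->
  exists a, [/\ size a = p, cone a `<=` B & cone z `<=` f @` cone a].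
Proof.
move=> le Hm lez zB; apply/not_existsP => H.
have tr a : size a = p -> cone a `<=` B -> forall x, cone a x -> triv z (f x).
  move=> sa aB x cx; have [za|tr] := Hm a sa aB z lez; first by case: (H a).
  by apply: tr; exists x.
have [x0 _] : exists x, x \in X by apply/card_gt0P; apply: ltnW (bdX D).
pose E := B `&` lev p.
have sE : is_subgroup E by apply: is_subgroupI => //; apply: (lev_sub D).
have fE : has_finite_index B E.
  by apply: (fi_setI sG (lev_sub D p) sB (idBG I)); apply: (lev_fi D).
have sfE : is_subgroup (f @` E) by apply: (hom_image sB (idM I)) => // x [].
have fiE : has_finite_index B' (f @` E).
  by rewrite -iso_image; apply: (fi_image sB sE (idM I)).
have [m' Hm'] := fi_cone D sB' (idBG' I) sfE fiE (idD' I).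
pose z' := z ++ nseq m' x0.
have z'B : cone z' `<=` B' by apply: subset_trans zB; apply: (cone_cat D).
have z'E : cone z' `<=` f @` E.
  by apply: Hm' => //; rewrite size_cat size_nseq leq_addl.
have [x cx nt] := cone_ntriv D z'; case: nt; apply: triv_cat.
have [y [By ly] <-] := z'E _ cx.
pose M := [set y | B y /\ triv z (f y)].
suff [] : M y by [].
have sM : is_subgroup M.
  split; first by split; [exact: sub1|rewrite (hom1 sB (idM I))].
    move=> g h [Bg tg] [Bh th]; split; first exact: subM.
    by rewrite (idM I) //; apply: trivM.
  move=> g [Bg tg]; split; first exact: subV.
  by rewrite (homV sB (idM I)) //; apply: trivV.
apply: (lev_prod D) ly By _ sM _; first exact: decided_le le (idD I).
by move=> a sa aB g cg; split; [exact: aB|exact: (tr a)].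
Qed.

Section Img.
Variables (q : nat) (a : seq X).
Hypothesis aB : cone a `<=` B.
Hypothesis dq : decided K (f @` cone a) q.

Definition imgO : {set q.-tuple X} := [set t : q.-tuple X | `[< cone t `<=` f @` cone a >]]%SET.

Lemma imgOP (t : q.-tuple X) : reflect (cone t `<=` f @` cone a) (t \in imgO).
Proof. by rewrite inE; apply: asboolP. Qed.

Lemma imgO_triv (t : q.-tuple X) x : t \notin imgO -> cone a x -> triv t (f x).
Proof.
move=> nt cx; have [tO|] := dq (eq_leq (esym (size_tuple t))).
  by case/negP: nt; apply/imgOP.
by apply; exists x.
Qed.

Lemma img_Rb : f @` cone a `<=` Rb G K imgO.
Proof.
move=> _ [x cx <-]; split; first by apply/(idBG' I)/(idf I)/aB.
move=> t nt; have /triv_sect [-> ->] := imgO_triv nt cx.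
by split=> //; apply: sub1.
Qed.

Lemma img_fam b : f @` cone a `<=` cone b -> n0 <= size b -> n0 <= q -> fam n0 imgO.
Proof.
move=> ab le leq; apply/andP; split.
  apply/negP => /eqP O0; have [x cx nt] := cone_ntriv D a; apply: nt.
  suff -> : x = 1 by [].
  apply: iso_inj; [exact: aB|exact: sub1|rewrite (hom1 sB (idM I))].
  apply: (@triv_level_eq1 _ q) => t /eqP st; apply: (@imgO_triv (Tuple st)) cx.
  by rewrite O0 inE.
have sz : size (take n0 b) == n0 by rewrite size_takel.
apply/existsP; exists (Tuple sz); apply/fintype.subsetP => t /imgOP /subset_trans - /(_ _ ab).
move=> /(cone_comparable D) /prefixP [s Et]; rewrite inE /= Et.
by rewrite -{2}(cat_take_drop n0 b) -catA prefix_prefix.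
Qed.

End Img.

End Iso.

(** * Comparison of indices for an isomorphism and its inverse *)

Section ImgTight.
Variables (X : finType) (G K B B' : set (tree_aut X)) (n0 kk mm : nat).
Variables (f f' : tree_aut X -> tree_aut X) (n : nat).
Hypothesis D : branch_data G K n0 kk mm.
Hypothesis I : iso_data G K B B' f f' n.
Let I' := iso_sym I.
Let sG := bdG D.
Let sB := idB I.
Let sB' := idB' I.
Notation cone := (cone K).
Notation lev := (lev G K).
Notation iota := (iota G K).
Notation d := #|X|.
Implicit Types (g h : tree_aut X) (v w : seq X).

Variables (q r : nat) (a b : seq X).
Hypothesis aB : cone a `<=` B.
Hypothesis (le0a : n0 <= size a) (lear : size a <= r) (le0q : n0 <= q) (le0b : n0 <= size b).
Hypothesis ab : f @` cone a `<=` cone b.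
Hypothesis dq : decided K (f @` cone a) q.
Hypothesis dr : forall z : seq X, size z = q -> cone z `<=` B' -> decided K (f' @` cone z) r.

Let O := imgO K f q a.
Let C (z : q.-tuple X) := imgO K f' r z.
Let A0 := f @` cone a.
Let Y := A0 `&` lev q.

Let le0r : n0 <= r. Proof. exact: leq_trans lear. Qed.
Let sA0 : is_subgroup A0.
Proof. by apply: (hom_image sB (idM I)) => //; apply: (cone_sub D). Qed.
Let sY : is_subgroup Y. Proof. by apply: is_subgroupI => //; apply: (lev_sub D). Qed.
Let A0B' : A0 `<=` B'. Proof. by move=> _ [x /aB Bx <-]; apply: (idf I). Qed.
Let OB' (z : q.-tuple X) : z \in O -> cone z `<=` B'.
Proof. by move/imgOP => zA; apply: subset_trans A0B'. Qed.
Let A0Rb : A0 `<=` Rb G K O. Proof. exact: (img_Rb D I). Qed.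
Let fYA0 : has_finite_index A0 Y.
Proof.
by apply: (fi_setI sG (lev_sub D q) sA0) (lev_fi D q); move=> x /A0B' /(idBG' I).
Qed.

Let famO : fam n0 O. Proof. exact: (img_fam D I aB dq ab). Qed.

Let f'za (z : q.-tuple X) : z \in O -> f' @` cone z `<=` cone a.
Proof.
move/imgOP => zA _ [y /zA [x cx <-] <-]; by rewrite (idK I) //; apply: aB.
Qed.

Let dC (z : q.-tuple X) : z \in O -> decided K (f' @` cone z) r.
Proof. by move=> zO; apply: dr; [exact: size_tuple|exact: OB']. Qed.

Let famC (z : q.-tuple X) : z \in O -> fam n0 (C z).
Proof. by move=> zO; apply: (img_fam D I' (OB' zO) (dC zO) (f'za zO)). Qed.

Let comp (z : seq X) g := dl z (sect z g).

(** The condition is void for [z] outside [O], because the intersection lemmas want a finite index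
    subgroup at every index. *)
Let V (z : q.-tuple X) := [set g | Y g /\ (z \in O -> lev r (f' (comp z g)))].

Let comp_cone z g : size z = q -> lev q g -> cone z (comp z g).
Proof. by move=> sz [_ /(_ z sz) [_ Kg]]; exists (sect z g). Qed.

Let compM z g h : size z = q -> lev q g -> lev q h -> comp z (g * h) = comp z g * comp z h.
Proof. by move=> sz lg [_ /(_ z sz) [hz _]]; rewrite /comp sectM hz dlM. Qed.

Let V_idx (z : q.-tuple X) :
  [/\ is_subgroup (V z), has_finite_index Y (V z) &
      z \in O -> idx Y (V z) <= ridx G K (C z)].
Proof.
have [zO|nzO] := boolP (z \in O); last first.
  have -> : V z = Y.
    apply/seteqP; split=> [g []|g Yg] //; split=> // zO; by rewrite zO in nzO.
  by split=> //; [exact: fi_refl].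
have cB g : Y g -> B' (comp z g).
  by move=> [_ lg]; apply: (OB' zO); apply: comp_cone lg; apply: size_tuple.
have hM g h : Y g -> Y h -> f' (comp z (g * h)) = f' (comp z g) * f' (comp z h).
  move=> Yg Yh; have [[_ lg] [_ lh]] := (Yg, Yh); rewrite compM ?size_tuple //.
  by apply: (idM' I); apply: cB.
have EV : V z = [set g | Y g /\ lev r (f' (comp z g))].
  by apply/seteqP; split=> g [Yg H]; split=> //; apply: H.
have sV : is_subgroup (V z) by rewrite EV; apply: (hom_preim sY hM); apply: (lev_sub D).
have toC g : Y g -> Rb G K (C z) (f' (comp z g)).
  move=> Yg; apply: (img_Rb D I' (OB' zO) (dC zO)); exists (comp z g) => //.
  by case: Yg => _; apply: comp_cone; apply: size_tuple.
split=> //.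
  rewrite EV; apply: (fi_preim sY hM (lev_sub D r) _ (Rb_fi D (C z))).
  by move=> _ [g Yg <-]; apply: toC.
move=> _; apply: (idx_hom sY sV (lev_sub D r) _ (Rb_fi D (C z)) hM toC).
  by move=> g [].
by move=> g Yg lg; rewrite EV.
Qed.

Let W := [set u | Y u /\ forall z, z \in enum O -> V z u].

Let W_sub : W `<=` f @` (cone a `&` lev r).
Proof.
move=> u [[[x cx Ex] lu] HV]; exists x => //; split=> //.
pose M := [set y | B' y /\ lev r (f' y)].
have sM : is_subgroup M by apply: (hom_preim sB' (idM' I)); apply: (lev_sub D).
suff [_] : M u by rewrite -Ex (idK I) //; apply: aB.
have [t tO|h [_ Mh h1 h2]] := @lev_part _ _ _ _ _ _ D q u (mem O).
  by case: lu => _; apply; apply: size_tuple.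
have -> : u = h.
  apply: (mulgI h^-1); rewrite mulVg; apply: (@triv_level_eq1 _ q) => v /eqP sv.
  have [/(h1 (Tuple sv))//|nO] := boolP (Tuple sv \in mem O).
  apply: (@trivM _ v); first by apply: trivV; apply: (h2 (Tuple sv)).
  by rewrite -Ex; apply: (imgO_triv dq (t := Tuple sv)).
apply: Mh => // t tO; split.
  by apply: (OB' tO); apply: comp_cone lu; apply: size_tuple.
by have [|_] := HV t; [rewrite mem_enum|apply].
Qed.

(** An element of [Y] whose components at all [z] in [O] pull back into [lev r] pulls back into
    [lev r] itself, so the index of [cone a] relative to level [r] is bounded by the one at level
    [q] times those of the pulled back cones. *)
Let count : lidx G K (r - size a) <= (idx A0 Y * \prod_(z in O) ridx G K (C z))%N.
Proof.
have sV z : is_subgroup (V z) by have [] := V_idx z.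
have fV z : has_finite_index Y (V z) by have [] := V_idx z.
have [sW fW leW] := idx_inter_le (enum O) sY sV fV; rewrite -/W in sW fW leW.
have scl : is_subgroup (cone a `&` lev r).
  by apply: is_subgroupI; [exact: (cone_sub D)|exact: (lev_sub D)].
have fcl : has_finite_index (cone a) (cone a `&` lev r).
  by apply: (fi_setI sG (lev_sub D r) (cone_sub D a) (@cone_G _ _ _ _ _ _ D a)); apply: (lev_fi D).
have fM g h : cone a g -> cone a h -> f (g * h) = f g * f h.
  by move=> cg ch; apply: (idM I); apply: aB.
have fI g h : cone a g -> cone a h -> f g = f h -> g = h.
  by move=> cg ch; apply: (iso_inj I); apply: aB.
rewrite -(cone_idx D lear) -(idx_iso (cone_sub D a) scl fcl fM fI) -/A0.
have fAW := fi_trans sA0 sY sW fYA0 fW.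
have sfcl : is_subgroup (f @` (cone a `&` lev r)).
  by apply: (hom_image (cone_sub D a) fM) => // x [].
apply: (@leq_trans (idx A0 W)).
  apply: idx_mono => //; exact: (fi_image (cone_sub D a) scl fM).
rewrite (idx_tower sA0 sY sW fYA0 fW) leq_mul2l; apply/orP; right.
apply: leq_trans leW _; rewrite big_enum_cond /=.
rewrite [leqLHS](eq_bigl (mem O)); last by move=> z; rewrite andbT.
by apply: leq_prod => z zO; have [_ _ ->] := V_idx z.
Qed.

(** Distinct cones at one level meet trivially, hence so do their preimages, and no cone at level
    [r] lies in two of them; all lie in [cone a]. *)
Let disj : \sum_(z in O) #|C z| <= d ^ (r - size a).
Proof.
rewrite -card_below // -sum1_card.
under eq_bigr do rewrite -sum1_card.
rewrite (exchange_big_dep (mem (below r a))) /=; last first.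
  move=> z y zO /imgOP yC; rewrite inE; apply: (cone_comparable D).
  exact: subset_trans (f'za zO).
apply: leq_sum => y _; rewrite sum1dep_card; apply/card_le1_eqP => z' z.
rewrite finset.in_set => /andP [zO /imgOP yC]; rewrite finset.in_set => /andP [zO' /imgOP yC'].
apply/eqP/negPn/negP => nzz.
have [x cx nt] := cone_ntriv D y; apply: nt.
have [x1 c1 E1] := yC _ cx; have [x2 c2 E2] := yC' _ cx.
have E12 : x1 = x2 by apply: (iso_inj I'); [exact: (OB' zO)|exact: (OB' zO')|rewrite E1 E2].
have : x1 = 1.
  have c2' : cone z x1 by rewrite E12.
  apply: (cone_inter _ c1 c2'); apply: incomp_size; first by rewrite !size_tuple.
  by apply: contra nzz => /eqP /val_inj ->.
by move=> E; rewrite -E1 E (hom1 sB' (idM' I)).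
Qed.

(** With s = d-1, [count] raised to the power s and [ridx_bound] for each [C z], whose exponents add
    up by [disj], give iota^|O| <= A^s iota. The same bound for [O] is the reverse inequality with
    the index of [Rb] of [O], which is at least A; all are equalities, and equality of indices gives
    the factorisation. *)
Lemma img_tight : tight G K n0 O /\
  (forall u : tree_aut X, Rb G K O u -> exists2 x, A0 x & lev q (x^-1 * u)).
Proof.
have i0 : 0 < iota by apply: (iota_gt0 D).
pose s := d.-1; pose A := idx A0 Y.
have leA : A <= ridx G K O.
  exact: (idx_setI_le sA0 (lev_sub D q) A0Rb (Rb_fi D O)).
have prodb : ((\prod_(z in O) ridx G K (C z)) ^ s * iota ^ #|O| <=
    iota ^ (d ^ (r - size a)))%N.
  apply: (@leq_trans (iota ^ (\sum_(z in O) #|C z|))); last by rewrite leq_pexp2l.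
  rewrite expn_sum -prod_nat_const (big_morph (fun x => x ^ s)%N (id1 := 1%N) (op1 := muln)).
  - rewrite -big_split /=.
    by apply: leq_prod => z zO; apply: (ridx_bound D le0r); apply: famC.
  - by move=> x y; rewrite expnMn.
  - by rewrite exp1n.
have main : (iota ^ #|O| <= A ^ s * iota)%N.
  have := lidx_pow D (r - size a) => Epow.
  have i1 : 0 < iota ^ (d ^ (r - size a)) by rewrite expn_gt0 i0.
  rewrite -(leq_pmul2l i1) -{1}Epow.
  have le1 : (lidx G K (r - size a) ^ s <= (A * \prod_(z in O) ridx G K (C z)) ^ s)%N.
    rewrite /s; have := bdX D; case: d => [//|[//|s']] _; rewrite leq_exp2r //; exact: count.
  apply: (@leq_trans ((A * \prod_(z in O) ridx G K (C z)) ^ s * iota * iota ^ #|O|)%N).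
    by rewrite leq_mul2r leq_mul2r le1 !orbT.
  rewrite expnMn [leqRHS]mulnC.
  rewrite -[leqLHS]mulnA -[leqLHS]mulnA [X in (_ * X <= _)%N]mulnCA -[leqRHS]mulnA.
  rewrite leq_mul2l; apply/orP; right; rewrite leq_mul2l; apply/orP; right.
  exact: prodb.
have EA : A = ridx G K O.
  apply/eqP; rewrite eqn_leq leA /=.
  have := leq_trans (ridx_bound D le0q famO) main.
  by rewrite leq_pmul2r // /s; have := bdX D; case: d => [//|[//|s']] _; rewrite leq_exp2r.
split.
  by apply: (ridx_tight D le0q famO); rewrite -EA.
move=> u Ru; apply: (idx_setI_eq sA0 (lev_sub D q) A0Rb _ EA Ru); exact: (Rb_fi D).
Qed.

End ImgTight.

(** * Isomorphisms between decided subgroups send deep cones to cones *)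

Section Rigid.
Variables (X : finType) (G K B B' : set (tree_aut X)) (n0 kk mm : nat).
Variables (f f' : tree_aut X -> tree_aut X) (n : nat).
Hypothesis D : branch_data G K n0 kk mm.
Hypothesis I : iso_data G K B B' f f' n.
Hypothesis nn0 : n <= n0.
Let I' := iso_sym I.
Let sG := bdG D.
Let sB := idB I.
Let sB' := idB' I.
Notation cone := (cone K).
Notation lev := (lev G K).
Implicit Types (g h : tree_aut X) (a b u v w z : seq X).

Let conj_image x a : B x -> cone a `<=` B ->
  f @` cone (x a) = [set f x * y * (f x)^-1 | y in f @` cone a].
Proof.
move=> Bx aB; have Gx := idBG I Bx; have Bx' := subV sB Bx.
have fxV : f x^-1 = (f x)^-1 by apply: (homV sB (idM I)).
apply/seteqP; split=> [_ [y cy <-]|_ [_ [y cy <-] <-]].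
  have cy' : cone a (x^-1 * y * x).
    by have := cone_conj D (subV sG Gx) cy; rewrite invgK autKV.
  have By' := aB _ cy'.
  exists (f (x^-1 * y * x)); first by exists (x^-1 * y * x).
  have -> : (f x)^-1 = f x^-1 by [].
  rewrite -!(idM I) //; last exact: subM.
  by congr f; rewrite -!mulgA mulgV mulg1 mulVKg.
have By := aB _ cy.
exists (x * y * x^-1); first exact: (cone_conj D).
by rewrite -fxV -!(idM I) //; exact: subM.
Qed.

Section Transitive.
Variables (p q : nat) (a v zeta : seq X).
Hypothesis (sa : size a = p) (aB : cone a `<=` B) (np : n <= p) (n0p : n0 <= p).
Hypothesis dq : forall a', size a' = p + kk -> cone a' `<=` B -> decided K (f @` cone a') q.
Hypothesis (n0v : n0 <= size v) (pv : prefix v zeta) (sz : size zeta = q).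
Let A0 := f @` cone a.
Hypothesis A0v : A0 `<=` cone v.
Hypothesis zA0 : cone zeta `<=` A0.
Hypothesis trA0 : forall x w, cone v x -> exists2 y, A0 y & y (zeta ++ w) = x (zeta ++ w).

Let A0B' : A0 `<=` B'. Proof. by move=> _ [x /aB Bx <-]; apply: (idf I). Qed.

(** Going down [kk] letters from [a] reaches a subgroup normal in [cone a], whose image [A1] is
    normal in [A0]. The free action of [A0] spreads the one known cone in [A1] over all deep words
    below [u]; centralisers then exclude anything else. *)
Lemma cone_child : exists w u, [/\ size w = kk, n0 <= size u & f @` cone (a ++ w) = cone u].
Proof.
have [x0 _] : exists x, x \in X by apply/card_gt0P; apply: ltnW (bdX D).
have [a' [sa' a'B za']] : exists a', [/\ size a' = p + kk, cone a' `<=` B & cone zeta `<=` f @` cone a'].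
  apply: (img_cover D I _ dq); rewrite ?sz //; first by rewrite (leq_trans np) ?leq_addr.
  exact: subset_trans zA0 A0B'.
have [w0 Ea'] : exists w0, a' = a ++ w0.
  apply/prefixP; apply/negPn/negP => npre.
  have [y cy nt] := cone_ntriv D zeta; apply: nt.
  have [x cx Ex] := zA0 cy; have [x' cx' Ex'] := za' _ cy.
  have E : x = x' by apply: (iso_inj I); [exact: aB|exact: a'B|rewrite Ex Ex'].
  have x1 : x = 1.
    apply: (cone_inter _ cx (b := a')); last by rewrite E.
    by apply: nprefix_incomp npre; rewrite sa sa' leq_addr.
  by rewrite -Ex x1 (hom1 sB (idM I)).
have sw0 : size w0 = kk by move: sa'; rewrite Ea' size_cat sa => /addnI.
have aw0B : cone (a ++ w0) `<=` B by apply: subset_trans aB; apply: (cone_cat D).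
pose A1 := f @` cone (a ++ w0).
have sA1 : is_subgroup A1 by apply: (hom_image sB (idM I)) => //; apply: (cone_sub D).
have sA0 : is_subgroup A0 by apply: (hom_image sB (idM I)) => //; apply: (cone_sub D).
have A1A0 : A1 `<=` A0 by move=> _ [x cx <-]; exists x => //; apply: (cone_cat D cx).
have zA1 : cone zeta `<=` A1 by rewrite /A1 -Ea'.
(* [K] fixes all words of length [kk], so [cone a] fixes [a ++ w0] and normalises its cone. *)
have A1n x y : A0 x -> A1 y -> A1 (x * y * x^-1).
  move=> [x' cx' <-] [y' cy' <-]; exists (x' * y' * x'^-1).
    apply: (cone_conj_fix D _ _ cy'); first exact: (cone_G D cx').
    by case: cx' => k Kk <-; rewrite dlE (bdfix D).
  have Bx' := aB cx'; have By' := aw0B _ cy'; have Bx'' := subV sB Bx'.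
  by rewrite !(idM I) ?(homV sB (idM I)) //; apply: subM.
(* [zeta] may have fewer than [kk] letters after [v]; padding guarantees that [c] has length [kk],
   below which [cone v] is transitive. *)
have [e Ez] := prefixP pv; pose zeta1 := zeta ++ nseq kk x0.
pose c := take kk (e ++ nseq kk x0); pose s := drop kk (e ++ nseq kk x0).
have sc : size c = kk by rewrite size_takel // size_cat size_nseq leq_addl.
have Ez1 : zeta1 = v ++ c ++ s by rewrite cat_take_drop /zeta1 Ez catA.
pose u := v ++ c.
have A0u y : A0 y -> y u = u.
  by move=> /A0v [k Kk <-]; rewrite dlE (bdfix D).
(* Some element of [A0] carries an extension of [zeta1] to [u ++ s']; conjugating the cone at [zeta]
   by it stays in the normal subgroup [A1]. *)
have small s' : size s <= size s' -> cone (u ++ s') `<=` A1.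
  move=> les; pose t := nseq (size s' - size s) x0.
  have st : size (s ++ t) = size s' by rewrite size_cat size_nseq subnKC.
  have [x cx Ex] := @cone_trans _ _ _ _ _ _ D v c (s ++ t) s' sc st.
  have [y Ay Ey] := trA0 (nseq kk x0 ++ t) cx.
  have Ey' : y (zeta ++ nseq kk x0 ++ t) = u ++ s'.
    by rewrite Ey catA -/zeta1 Ez1 -!catA Ex catA.
  move=> z cz; have Gy : G y by apply/(idBG' I)/A0B'.
  have := cone_conj D (subV sG Gy) cz; rewrite -Ey' autKV invgK => cz'.
  have := A1n y _ Ay (zA1 _ (cone_cat D cz')).
  by rewrite -!mulgA mulgV mulg1 mulVKg.
have n0u : n0 <= size u by rewrite size_cat (leq_trans n0v) ?leq_addr.
have nu : n <= size u := leq_trans nn0 n0u.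
have A1B' : A1 `<=` B' := subset_trans A1A0 A0B'.
have uB' : cone u `<=` B'.
  have [//|tr] := idD' I nu.
  case: (@ncone_triv _ _ _ _ _ _ D B' (u ++ s)) => [|g /tr]; last exact: triv_cat.
  exact: subset_trans (small _ (leqnn _)) A1B'.
have dA1 : decided K A1 q by apply: dq => //; rewrite size_cat sa sw0.
(* If [A1] contained a cone at some [t] off [u], the preimage of this cone would commute with all
   conjugates by [cone a] of the preimage of a cone at [b] below [u], as [A0] fixes [u]. These
   conjugates contain cones at all words below [a ++ w0] of one length, so the preimage of the cone
   at [t] would be trivial. *)
have supp1 y : A1 y -> supp u y.
  move=> Ay; apply: (supp_level D (q := maxn q (size u))); first exact: leq_maxr.
  move=> t st nt; have let_ : q <= size t by rewrite st leq_maxl.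
  have ut : ~~ comparable_words u t by apply: nprefix_incomp nt; rewrite st leq_maxr.
  have [tA|] := dA1 t let_; last by apply.
  pose b := u ++ s.
  have bA : cone b `<=` A1 := small _ (leqnn _).
  have bB : cone b `<=` B' := subset_trans bA A1B'.
  have nb : n <= size b by rewrite /b size_cat (leq_trans nu) ?leq_addr.
  have [m dm] := img_decided D I' nb bB.
  have [y1 [py1 y1b]] : exists y1, [/\ size (a ++ w0) <= size y1 & cone y1 `<=` f' @` cone b].
    pose q' := maxn m (size (a ++ w0)).
    apply/not_existsP => H; have [z cz nz] := cone_ntriv D b; apply: nz.
    suff -> : z = 1 by [].
    apply: (iso_inj I'); [exact: bB|exact: sub1|rewrite (hom1 sB' (idM' I))].
    apply: (@triv_level_eq1 _ q') => y1 sy1.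
    have my1 : m <= size y1 by rewrite sy1 leq_maxl.
    have [y1b|] := dm y1 my1.
      by case: (H y1); split=> //; rewrite sy1 leq_maxr.
    by apply; exists z.
  have y1aw : prefix (a ++ w0) y1.
    apply: (cone_comparable D); apply: subset_trans y1b _.
    move=> _ [z /bA [x cx <-] <-]; rewrite (idK I) //; exact: aw0B.
  have [y2 Ey1] := prefixP y1aw.
  suff H x : cone t x -> f' x = 1.
    have [x cx nt'] := cone_ntriv D t; case: nt'.
    suff -> : x = 1 by [].
    apply: (iso_inj I'); [exact/A1B'/tA|exact: sub1|rewrite (hom1 sB' (idM' I))].
    exact: H.
  move=> cx; have [x1 cx1 Ex1] := tA _ cx.
  have Ef'x : f' x = x1 by rewrite -Ex1 (idK I) //; apply: aw0B.
  have s1 := cone_supp cx1.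
  rewrite Ef'x; apply: (@triv_level_eq1 _ (size y1)) => y3 sy3.
  have [/prefixP [y4 Ey3]|n3] := boolP (prefix (a ++ w0) y3); last first.
    by apply: supp_triv s1 (nprefix_incomp _ n3); rewrite sy3.
  have sy4 : size y2 = size y4.
    by move: sy3; rewrite Ey1 Ey3 !size_cat => /addnI ->.
  have [k ck Ek] := @cone_trans _ _ _ _ _ _ D a w0 y2 y4 sw0 sy4.
  have Eky : k y1 = y3 by rewrite Ey1 Ey3 -!catA.
  have Bk := aB ck; have Ak : A0 (f k) by exists k.
  apply: (cone_centr D) => z cz.
  have cz1 : cone y1 (k^-1 * z * k).
    by rewrite -Eky in cz; have := cone_conj D (subV sG (idBG I Bk)) cz; rewrite invgK autKV.
  have [z1 cz1' Ez1'] := y1b _ cz1.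
  have Bz1 := bB _ cz1'.
  have Ezk : z = f' (f k * z1 * (f k)^-1).
    have Bfk := idf I Bk; have Bfk' := subV sB' Bfk.
    rewrite !(idM' I) //; last exact: subM.
    rewrite (homV sB' (idM' I)) // (idK I) // Ez1' -!mulgA mulgV mulg1 mulVKg //.
  have cfz : cone (f k b) (f k * z1 * (f k)^-1).
    by apply: (cone_conj D) cz1'; apply/(idBG' I)/(idf I).
  have Bfz : B' (f k * z1 * (f k)^-1).
    by have Bfk := idf I Bk; apply: subM => //; [exact: subM|exact: subV].
  have Bx : B' x := A1B' _ (tA _ cx).
  rewrite -Ef'x Ezk -!(idM' I) //; congr f'.
  apply: triv_comm (cone_supp cfz) _.
  apply: supp_triv (cone_supp cx) _; rewrite comparable_sym.
  have : prefix u (f k b) by rewrite -(A0u _ Ak) aut_prefix prefix_prefix.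
  case/prefixP => j ->; apply: contra ut; rewrite /comparable_words => /orP [|].
    by move=> /prefixP [l ->]; rewrite -catA prefix_prefix.
  by move=> /comparable_cat; rewrite comparable_sym.
exists w0, u; split=> //; apply/seteqP; split=> [y Ay|x cx].
  by apply: (cone_of D n0u); [apply/(idBG' I)/A1B'|exact: supp1].
(* Conversely, for [z] in a cone beside [a ++ w0], the image of [z] centralises the cones of [A1]
   deep below [u], so it is trivial below [u] and commutes with [x]. Hence [f' x] centralises the
   cones beside [a ++ w0] and is supported on that word. *)
have Bx := uB' _ cx.
exists (f' x); last exact: (idK' I).
have saw : size (a ++ w0) = p + kk by rewrite size_cat sa sw0.
apply: (cone_of D); first by rewrite saw (leq_trans n0p) ?leq_addr.
  exact/(idBG I)/(idf' I).
apply: (supp_level D (q := p + kk)); first by rewrite saw.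
move=> a2 sa2 na2.
have Bf'x := idf' I Bx.
have [|a2B|tr] := idD I (a := a2); first by rewrite sa2 (leq_trans np) ?leq_addr.
  apply: (cone_centr D) => z cz; have Bz := a2B _ cz; have Bfz := idf I Bz.
  rewrite -(idK I Bz) -!(idM' I) //; congr f'; apply/esym.
  apply: triv_comm (cone_supp cx) _.
  have tr s' : size s' = size s -> triv (u ++ s') (f z).
    move=> ss'; apply: (cone_centr D) => y cy.
    have [y1 cy1 <-] := small s' (eq_leq (esym ss')) _ cy.
    have By1 := aw0B _ cy1; rewrite -!(idM I) //; congr f.
    apply/esym/(triv_comm (cone_supp cz)).
    apply: supp_triv (cone_supp cy1) _; apply: nprefix_incomp => //.
    by rewrite saw sa2.
  move=> w; apply: (@aut_catl _ _ _ (nseq (size s) x0)); rewrite -!catA.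
  have := tr (take (size s) (w ++ nseq (size s) x0)) _ (drop (size s) (w ++ nseq (size s) x0)).
  rewrite -!catA cat_take_drop; apply.
  by rewrite size_takel // size_cat size_nseq leq_addl.
exact: tr.
Qed.

End Transitive.

(** Tightness of the image yields the free action that [cone_child] needs; one [w0] is enough, since
    conjugation permutes the words [a ++ w]. *)
Lemma rigid_children : exists p1, forall a, p1 <= size a -> cone a `<=` B ->
  forall w, size w = kk -> exists b, f @` cone (a ++ w) = cone b.
Proof.
have [p0 Hp0] := img_decided_level D I' nn0.
(* The extra [kk] letters leave room for the shorter word [a0], still deep, whose cone is transitive
   below [a]. *)
exists (maxn p0 n0 + kk) => a le aB.
have lea : maxn p0 n0 <= size a := leq_trans (leq_addr _ _) le.
have n0a : n0 <= size a := leq_trans (leq_maxr _ _) lea.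
have na : n <= size a := leq_trans nn0 n0a.
have [b0 [sb0 b0B ab0]] := img_cover D I' nn0 Hp0 (leq_trans (leq_maxl _ _) lea) aB.
have fab0 : f @` cone a `<=` cone b0.
  by move=> _ [x /ab0 [y cy <-] <-]; rewrite (idK' I) //; apply: b0B.
have [q1 dq1] := img_decided D I na aB.
have npk : n <= size a + kk := leq_trans na (leq_addr _ _).
have [q2 dq2] := img_decided_level D I npk.
pose q := maxn (maxn q1 q2) n0.
have n0q : n0 <= q := leq_maxr _ _.
have dq : decided K (f @` cone a) q.
  by apply: decided_le dq1; rewrite /q leq_max leq_maxl.
have dqk a' : size a' = size a + kk -> cone a' `<=` B -> decided K (f @` cone a') q.
  by move=> sa' a'B; apply: decided_le (dq2 a' sa' a'B); rewrite /q leq_max leq_maxr.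
have [r1 dr1] := img_decided_level D I' (leq_trans nn0 n0q).
pose r := maxn r1 (size a).
have dr z : size z = q -> cone z `<=` B' -> decided K (f' @` cone z) r.
  by move=> sz zB; apply: decided_le (dr1 z sz zB); apply: leq_maxl.
have n0b0 : n0 <= size b0 by rewrite sb0.
have [tO Oprod] := img_tight D I aB n0a (leq_maxr _ _) n0q n0b0 fab0 dq dr.
set O := imgO K f q a in tO Oprod.
have [v [zeta [/andP [n0v vq] Ov zO tr]]] := tight_orbit D n0q tO.
have sA0 : is_subgroup (f @` cone a).
  by apply: (hom_image sB (idM I)) => //; apply: (cone_sub D).
have A0v : f @` cone a `<=` cone v.
  move=> _ [x cx <-]; apply: (cone_of D n0v); first exact/(idBG I')/(idf I)/aB.
  apply: (supp_level D vq) => t /eqP st nt; apply: (imgO_triv dq (t := Tuple st)) cx.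
  by apply: contra nt => /(fintype.subsetP Ov); rewrite inE.
have zA0 : cone zeta `<=` f @` cone a by apply/imgOP.
have pv : prefix v zeta by have := fintype.subsetP Ov _ zO; rewrite inE.
have trA0 x w : cone v x -> exists2 y, (f @` cone a) y & y (zeta ++ w) = x (zeta ++ w).
  move=> /(tr _ w) [y /Oprod [e Ae le'] <-]; set l := e^-1 * y in le'.
  have [_ /(_ zeta (size_tuple zeta)) [lz Kl]] := le'.
  exists (e * dl zeta (sect zeta l)).
    by apply: subM => //; apply: zA0; exists (sect zeta l).
  have -> : y = e * l by rewrite /l mulVKg.
  by rewrite [LHS]autME [RHS]autME dlE (sectE zeta l) lz.
have [w0 [u [sw0 _ Eu]]] := cone_child erefl aB na n0a dqk n0v pv (size_tuple zeta) A0v zA0 trA0.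
move=> w sw.
pose a0 := take (size a - kk) a; pose c := drop (size a - kk) a.
have kka : kk <= size a := leq_trans (leq_addl _ _) le.
have sc : size c = kk by rewrite size_drop subKn.
have Ea : a = a0 ++ c by rewrite cat_take_drop.
have a0B : cone a0 `<=` B.
  apply: (@iso_ntriv _ _ _ _ _ _ _ _ _ _ _ D I a0 _ c); last by rewrite -Ea.
  rewrite size_takel ?leq_subr //; apply: (leq_trans nn0); apply: leq_trans (leq_maxr p0 n0) _.
  by rewrite leq_subRL // addnC.
have [x cx Ex] := @cone_trans _ _ _ _ _ _ D a0 c w0 w sc (etrans sw0 (esym sw)).
exists (f x u); rewrite !catA -Ea in Ex; rewrite -Ex conj_image; first 1 last.
- exact: a0B.
- by apply: subset_trans aB; apply: (cone_cat D).
rewrite Eu; have Gf : G (f x) by apply/(idBG' I)/(idf I)/a0B.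
apply/seteqP; split=> [_ [y cy <-]|y cy]; first exact: (cone_conj D).
exists ((f x)^-1 * y * f x); last by rewrite -!mulgA mulgV mulg1 mulVKg.
by have := cone_conj D (subV sG Gf) cy; rewrite autKV invgK.
Qed.

Lemma rigid_cones : exists N, forall a, N <= size a -> cone a `<=` B ->
  exists b, f @` cone a = cone b.
Proof.
have [p1 Hp1] := rigid_children; exists (maxn p1 n + kk) => a le aB.
pose a0 := take (size a - kk) a; pose c := drop (size a - kk) a.
have kka : kk <= size a := leq_trans (leq_addl _ _) le.
have sc : size c = kk by rewrite size_drop subKn.
have Ea : a = a0 ++ c by rewrite cat_take_drop.
have le0 : maxn p1 n <= size a0.
  by rewrite size_takel ?leq_subr // leq_subRL // addnC.
have a0B : cone a0 `<=` B.
  apply: (@iso_ntriv _ _ _ _ _ _ _ _ _ _ _ D I a0 _ c); last by rewrite -Ea.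
  exact: leq_trans (leq_maxr _ _) le0.
rewrite Ea; apply: Hp1 => //; exact: leq_trans (leq_maxl _ _) le0.
Qed.

(** The depth of the image word is controlled by [img_cover] for the inverse: a deep [cone a] lies
    in the preimage of some cone at level at least [Q]. *)
Lemma rigid_deep Q : exists N, forall a, N <= size a -> cone a `<=` B ->
  exists2 b, Q <= size b & f @` cone a = cone b.
Proof.
have nQ : n <= maxn Q n := leq_maxr _ _.
have [N HN] := rigid_cones; have [p0 Hp0] := img_decided_level D I' nQ.
exists (maxn N p0) => a; rewrite geq_max => /andP [le1 le2] aB.
have [b Eb] := HN a le1 aB; exists b => //.
have [b0 [sb0 b0B ab0]] := img_cover D I' nQ Hp0 le2 aB.
have /(cone_comparable D) /prefixP [s ->] : cone b `<=` cone b0.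
  by rewrite -Eb => _ [x /ab0 [y cy <-] <-]; rewrite (idK' I) //; apply: b0B.
by rewrite size_cat sb0; apply: leq_trans (leq_maxl _ _) (leq_addr _ _).
Qed.

End Rigid.

(** * Good subgroups *)

Section MulSet.
Variable gT : groupType.
Implicit Types A B C : set gT.

Definition mulset A B := [set a * b | a in A & b in B].

Definition commuting A B := forall a b, A a -> B b -> a * b = b * a.

Lemma commuting_sym A B : commuting A B -> commuting B A.
Proof. by move=> c b a Bb Aa; rewrite (c a b). Qed.

Lemma mulset_sub A B : is_subgroup A -> is_subgroup B -> commuting A B ->
  is_subgroup (mulset A B).
Proof.
move=> sA sB c; split.
- by exists 1; [exact: sub1|exists 1; [exact: sub1|rewrite mulg1]].
- move=> _ _ [a Aa [b Bb <-]] [a' Aa' [b' Bb' <-]].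
  exists (a * a'); first exact: subM; exists (b * b'); first exact: subM.
  by rewrite -!mulgA; congr (_ * _); rewrite !mulgA (c a' b).
- move=> _ [a Aa [b Bb <-]]; exists a^-1; first exact: subV.
  by exists b^-1; [exact: subV|rewrite -invgM (c a b)].
Qed.

Lemma mulset_fi A A1 C : is_subgroup A -> is_subgroup A1 -> is_subgroup C ->
  commuting A C -> has_finite_index A A1 ->
  has_finite_index (mulset A C) (mulset A1 C).
Proof.
move=> sA sA1 sC c fA; have A1A := fi_sub fA.
have c1 : commuting A1 C by move=> a b /A1A; apply: c.
pose p x := xget 1 [set a | A a /\ C (a^-1 * x)].
have pP x : mulset A C x -> A (p x) /\ C ((p x)^-1 * x).
  case=> a Aa [b Cb <-]; rewrite /p; case: xgetP => [y _ //|/(_ a)]; case; split=> //.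
  by rewrite mulKg.
apply: (@fi_by _ _ (fun x => coset_of (p x) A1)).
- exact: mulset_sub.
- by move=> _ [a /A1A Aa [b Cb <-]]; exists a => //; exists b.
- by apply: sub_finite_set (fi_fin fA) => _ [x /pP [Ap _] <-]; exists (p x).
- move=> x y /pP [Ax Cx] /pP [Ay Cy] /(coset_ofP _ _ sA1) H.
  exists ((p x)^-1 * p y) => //; exists (((p x)^-1 * x)^-1 * ((p y)^-1 * y)).
    by apply: subM => //; apply: subV.
  have -> : (p x)^-1 * p y * (((p x)^-1 * x)^-1 * ((p y)^-1 * y)) =
     ((p x)^-1 * p y * ((p x)^-1 * x)^-1) * ((p y)^-1 * y) by rewrite !mulgA.
  rewrite (c _ _ (A1A _ H) (subV sC Cx)) invgM invgK -!mulgA.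
  by rewrite (mulVKg (p x)) (mulVKg (p y)).
Qed.

Lemma mulsetC A B : commuting A B -> mulset A B = mulset B A.
Proof.
move=> c; apply/seteqP; split=> _ [a Aa [b Bb <-]]; exists b => //; exists a => //.
  by rewrite (c a b).
by rewrite (c b a).
Qed.

End MulSet.

Section KDiag.
Variables (X : finType) (G K : set (tree_aut X)) (n0 kk mm : nat).
Hypothesis D : branch_data G K n0 kk mm.
Let sG := bdG D.
Let sK := bdK D.
Notation cone := (cone K).
Notation lev := (lev G K).
Implicit Types (g h : tree_aut X) (a b u v w z : seq X) (A P : set (tree_aut X)).
Implicit Types (V : set (seq X)).

(* [A] is a diagonal copy of K supported on the antichain [V]. *)
Definition kdiag A V :=
  [/\ finite_set V, V !=set0, antichain V,
      forall x : tree_aut X, A x -> (forall v, V v -> x v = v) /\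
        (forall w, (forall v, V v -> ~~ comparable_words w v) -> x w = w) &
      forall v, V v -> set_inj A (sect v) /\ sect v @` A = K].

Lemma kdiag_triv A V x v : kdiag A V -> A x ->
  (forall v', V v' -> ~~ comparable_words v v') -> triv v x.
Proof.
case=> _ _ _ H _ /H [_ Hx] Hv w; apply: Hx => v' Vv'.
apply: contra (Hv v' Vv'); rewrite /comparable_words => /orP [|].
  by case/prefixP => s ->; rewrite -catA prefix_prefix.
by move/comparable_cat; rewrite comparable_sym.
Qed.

(** If [v1] were a prefix of [v2], the section at [v1] of an element of [A2] would commute with all
    sections of [A1] there, that is with [K], and so be trivial; but the sections of [A2] at [v2]
    fill [K]. *)
Lemma kdiag_nprefix A1 V1 A2 V2 v1 v2 : kdiag A1 V1 -> kdiag A2 V2 ->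
  commuting A1 A2 -> V1 v1 -> V2 v2 -> ~~ prefix v1 v2.
Proof.
move=> [_ _ _ F1 S1] [_ _ _ F2 S2] c Vv1 Vv2; apply/negP => /prefixP [w Ev].
have [k Kk nk] := bdne D; apply: nk.
have [_ E2] := S2 _ Vv2; have [_ E1] := S1 _ Vv1.
move: Kk; rewrite -E2 => -[y A2y <-].
have yv1 : y v1 = v1.
  by have [/(_ _ Vv2)] := F2 y A2y; rewrite Ev => /aut_catl.
have : triv [::] (sect v1 y).
  apply: (cone_centr D) => _ [k1 Kk1 <-] /=; move: Kk1; rewrite -E1 => -[x A1x <-].
  have [/(_ _ Vv1) xv1 _] := F1 x A1x.
  by have := congr1 (sect v1) (c _ _ A1x A2y); rewrite !sectM xv1 yv1 => ->.
by move=> t; rewrite Ev sect_cat (tree_aut_ext (h := 1) t) sect1.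
Qed.

Lemma kdiag_incomp A1 V1 A2 V2 v1 v2 : kdiag A1 V1 -> kdiag A2 V2 ->
  commuting A1 A2 -> V1 v1 -> V2 v2 -> ~~ comparable_words v1 v2.
Proof.
move=> d1 d2 c Vv1 Vv2; rewrite negb_or (kdiag_nprefix d1 d2) //=.
by apply: (kdiag_nprefix d2 d1) => //; apply: commuting_sym.
Qed.

Definition goodby P (al : tree_aut X -> tree_aut X) n :=
  [/\ forall g h, P g -> P h -> al (g * h) = al g * al h,
      forall g, P g -> al g = 1 -> g = 1,
      forall g, P g -> G (al g),
      decided K (al @` P) n &
      forall a, n <= size a -> cone a `<=` al @` P ->
        exists V, kdiag [set x | P x /\ cone a (al x)] V].

Definition good P := is_subgroup P /\ exists al n, goodby P al n.

Lemma goodby_fi P P1 al n : is_subgroup P -> is_subgroup P1 -> has_finite_index P P1 ->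
  goodby P al n -> exists m, goodby P1 al m.
Proof.
move=> sP sP1 fi [aM a1 aG ad aV]; have P1P := fi_sub fi.
have [|m dm] := fi_decided D (hom_image sP aM sP (fun _ H => H)) _ (hom_image sP aM sP1 P1P)
  (fi_image sP sP1 aM fi) ad; first by move=> _ [x /aG Gx <-].
exists (maxn n m); split=> //.
- by move=> g h /P1P Pg /P1P; apply: aM.
- by move=> g /P1P; apply: a1.
- by move=> g /P1P; apply: aG.
- exact: decided_le (leq_maxr _ _) dm.
move=> a; rewrite geq_max => /andP [le1 le2] aP1.
have [|V dV] := aV a le1; first by move=> x /aP1 [y /P1P Py <-]; exists y.
exists V; congr kdiag: dV; apply/seteqP; split=> x [Px cx]; split=> //; last exact: P1P.
have [y P1y Ey] := aP1 _ cx.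
by rewrite -(hom_inj sP aM a1 (P1P _ P1y) Px Ey).
Qed.

Lemma good_fi P P1 : is_subgroup P1 -> has_finite_index P P1 -> good P -> good P1.
Proof.
move=> sP1 fi [sP [al [n gP]]]; have [m gm] := goodby_fi sP sP1 fi gP.
by split=> //; exists al, m.
Qed.

Lemma good_1 : good [set 1].
Proof.
split; first exact: is_subgroup1.
exists id, 0; rewrite /goodby image_id; split=> //.
- by move=> _ ->; apply: sub1.
- by move=> a _; right=> _ ->; apply: triv1.
- move=> a _ a1; case: (ncone_triv D a1) => _ ->; exact: triv1.
Qed.

Lemma kdiag_cone a : kdiag (cone a) [set a].
Proof.
split.
- exact: finite_set1.
- by exists a.
- by move=> u v -> ->.
- move=> x cx; have sx := cone_supp cx; split=> [_ ->|w /(_ a erefl) n]; first exact: supp_self.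
  by apply: sx; apply: contra n; rewrite /comparable_words => ->; rewrite orbT.
- move=> _ ->; split.
    by move=> x y /set_mem [k _ <-] /set_mem [k' _ <-]; rewrite !sect_dl => ->.
  apply/seteqP; split=> [_ [x cx <-]|k Kk]; first exact: cone_sect cx.
  by exists (dl a k); [exists k|rewrite sect_dl].
Qed.

Lemma good_G : good G.
Proof.
split=> //; exists id, 0; rewrite /goodby image_id; split=> //.
- by move=> a _; left; apply: (cone_G D).
- move=> a _ aG; exists [set a]; congr kdiag: (kdiag_cone a).
  by apply/seteqP; split=> [x cx|x []] //; split=> //; apply: aG.
Qed.

Lemma good_dl x P : good P -> good (dl [:: x] @` P).
Proof.
move=> [sP [al [n [aM a1 aG ad aV]]]]; split.
  by apply: (@hom_image _ _ (dl [:: x]) P sP _ P sP) => // g h _ _; rewrite dlM.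
exists (al \o sect [:: x]), n.
have Eim : (al \o sect [:: x]) @` (dl [:: x] @` P) = al @` P.
  apply/seteqP; split=> [_ [_ [p Pp <-] <-]|_ [p Pp <-]].
    by exists p => //; rewrite /= (sect_dl [:: x] p).
  by exists (dl [:: x] p); [exists p|rewrite /= (sect_dl [:: x] p)].
split.
- by move=> _ _ [p Pp <-] [p' Pp' <-]; rewrite -dlM /= !(sect_dl [:: x]) aM.
- by move=> _ [p Pp <-]; rewrite [X in X = 1]/= (sect_dl [:: x]) => /(a1 _ Pp) ->; rewrite dl_1.
- by move=> _ [p Pp <-]; rewrite [X in G X]/= (sect_dl [:: x]); apply: aG.
- by rewrite Eim.
- rewrite Eim => a le aP; have [V [fV nV acV HV SV]] := aV a le aP; exists (cons x @` V).
  have key y : (dl [:: x] @` P) y /\ cone a ((al \o sect [:: x]) y) ->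
      exists2 p, P p /\ cone a (al p) & dl [:: x] p = y.
    by move=> [[p Pp <-]]; rewrite [X in cone a X]/= (sect_dl [:: x]) => cp; exists p.
  have cc u v : comparable_words (x :: u) (x :: v) = comparable_words u v.
    by rewrite /comparable_words /= !eqxx.
  have sx v p : sect (x :: v) (dl [:: x] p) = sect v p.
    by rewrite -cat1s sect_cat sect_dl.
  split.
  + exact: finite_image.
  + by case: nV => v Vv; exists (x :: v), v.
  + by move=> _ _ [u Vu <-] [v Vv <-]; rewrite cc => /(acV _ _ Vu Vv) ->.
  + move=> _ /key [p Hp <-]; have [H1 H2] := HV p Hp; split.
      by move=> _ [v Vv <-]; rewrite -cat1s dlE H1.
    move=> w Hw; have [/prefixP [w' Ew]|n'] := boolP (prefix [:: x] w); last exact: dl_out.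
    rewrite Ew dlE H2 // => v Vv; rewrite -cc; have := Hw (x :: v); rewrite Ew; apply.
    by exists v.
  + move=> _ [v Vv <-]; have [inj surj] := SV v Vv; split.
      move=> y y' /set_mem Hy /set_mem Hy'; have [p Hp <-] := key y Hy.
      have [p' Hp' <-] := key y' Hy'; rewrite !sx => E.
      by rewrite (inj p p') // inE.
    have surjP k : K k <-> (sect v @` [set z | P z /\ cone a (al z)]) k by rewrite surj.
    apply/seteqP; split=> [_ [y Hy <-]|k /surjP [p [Pp cp] <-]].
      by have [p Hp <-] := key y Hy; rewrite sx; apply/surjP; exists p.
    exists (dl [:: x] p); last exact: sx.
    by split; [exists p|rewrite /= (sect_dl [:: x])].
Qed.

Section GoodMul.
Variables (A A' : set (tree_aut X)) (al al' : tree_aut X -> tree_aut X) (n n' : nat).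
Hypotheses (sA : is_subgroup A) (sA' : is_subgroup A').
Hypotheses (gA : goodby A al n) (gA' : goodby A' al' n').
Hypotheses (cAA : commuting A A') (triv_int : forall x, A x -> A' x -> x = 1).
Hypotheses (alK : forall x, A x -> K (al x)) (alK' : forall x, A' x -> K (al' x)).

Let p1 x := xget 1 [set a | A a /\ A' (a^-1 * x)].
Let p1E (a b : tree_aut X) : A a -> A' b -> p1 (a * b) = a.
Proof.
move=> Aa Ab; rewrite /p1; case: xgetP => [y _ [Ay Aby]|nex]; last by case: (nex a); split; rewrite ?mulKg.
apply/esym; apply: (mulgI y^-1); rewrite mulVg; apply: triv_int.
  by apply: subM => //; apply: subV.
by move: Aby; rewrite mulgA; apply: subMr.
Qed.

Variables (x0 x1 : X).
Hypothesis x01 : x0 != x1.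

(** The two embeddings are placed below distinct letters; their values lie in [K], so the copies
    remain in [G]. *)
Let be x := dl [:: x0] (al (p1 x)) * dl [:: x1] (al' ((p1 x)^-1 * x)).

Let beE (a b : tree_aut X) : A a -> A' b -> be (a * b) = dl [:: x0] (al a) * dl [:: x1] (al' b).
Proof. by move=> Aa Ab; rewrite /be p1E // mulKg. Qed.

Let inc01 : ~~ comparable_words [:: x0] [:: x1].
Proof. by apply: incomp_size => //; apply: contra x01 => /eqP [->]. Qed.
Let inc10 : ~~ comparable_words [:: x1] [:: x0].
Proof. by rewrite comparable_sym. Qed.

Let sect0 g h : sect [:: x0] (dl [:: x0] g * dl [:: x1] h) = g.
Proof.
have [E1 E2] := triv_sect (@sect_triv_dl _ _ _ h inc10).
by rewrite sectM E1 E2 mulg1 sect_dl.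
Qed.

Let sect1' g h : sect [:: x1] (dl [:: x0] g * dl [:: x1] h) = h.
Proof.
have [E1 E2] := triv_sect (@sect_triv_dl _ _ _ g inc01).
by rewrite sectM dl_self E2 mul1g sect_dl.
Qed.

Let im0 a : cone a `<=` al @` A <-> cone (x0 :: a) `<=` be @` mulset A A'.
Proof.
split=> [aA _ [k Kk <-]|xA _ [k Kk <-]].
  have [|y Ay Ey] := aA (dl a k); first by exists k.
  exists (y * 1); first by exists y => //; exists 1 => //; apply: sub1.
  rewrite beE //; last exact: sub1.
  by case: gA' => aM' _ _ _ _; rewrite (hom1 sA' aM') dl_1 mulg1 Ey.
have [|_ [a1 Aa1 [b Ab <-]]] := xA (dl (x0 :: a) k); first by exists k.
by rewrite beE // => /(congr1 (sect [:: x0])); rewrite sect0 /= (sect_dl [:: x0]) => <-; exists a1.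
Qed.

Let im1 a : cone a `<=` al' @` A' <-> cone (x1 :: a) `<=` be @` mulset A A'.
Proof.
split=> [aA _ [k Kk <-]|xA _ [k Kk <-]].
  have [|y Ay Ey] := aA (dl a k); first by exists k.
  exists (1 * y); first by exists 1; [exact: sub1|exists y].
  rewrite beE //; last exact: sub1.
  by case: gA => aM _ _ _ _; rewrite (hom1 sA aM) dl_1 mul1g Ey.
have [|_ [a1 Aa1 [b Ab <-]]] := xA (dl (x1 :: a) k); first by exists k.
by rewrite beE // => /(congr1 (sect [:: x1])); rewrite sect1' /= (sect_dl [:: x1]) => <-; exists b.
Qed.

Let diag0 a : [set x | mulset A A' x /\ cone (x0 :: a) (be x)] = [set x | A x /\ cone a (al x)].
Proof.
have [aM' a1' _ _ _] := gA'; apply/seteqP; split=> x.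
  case=> -[y Ay [b Ab <-]]; rewrite beE // => -[k Kk E].
  have := congr1 (sect [:: x1]) E; rewrite sect1' /= (_ : dl1 _ _ = dl [:: x0] (dl a k)) //.
  have [_ ->] := triv_sect (@sect_triv_dl _ _ _ (dl a k) inc01) => /esym /(a1' _ Ab) b1.
  rewrite b1 mulg1; split=> //.
  have := congr1 (sect [:: x0]) E; rewrite sect0 /= (sect_dl [:: x0]) => <-.
  by exists k.
case=> Ax [k Kk E]; split; first by exists x => //; exists 1; [exact: sub1|rewrite mulg1].
rewrite -(mulg1 x) beE //; last exact: sub1.
by rewrite (hom1 sA' aM') dl_1 mulg1 -E; exists k.
Qed.

Let diag1 a : [set x | mulset A A' x /\ cone (x1 :: a) (be x)] = [set x | A' x /\ cone a (al' x)].
Proof.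
have [aM a1 _ _ _] := gA; apply/seteqP; split=> x.
  case=> -[y Ay [b Ab <-]]; rewrite beE // => -[k Kk E].
  have := congr1 (sect [:: x0]) E; rewrite sect0 /= (_ : dl1 _ _ = dl [:: x1] (dl a k)) //.
  have [_ ->] := triv_sect (@sect_triv_dl _ _ _ (dl a k) inc10) => /esym /(a1 _ Ay) b1.
  rewrite b1 mul1g; split=> //.
  have := congr1 (sect [:: x1]) E; rewrite sect1' /= (sect_dl [:: x1]) => <-.
  by exists k.
case=> Ax [k Kk E]; split; first by exists 1; [exact: sub1|exists x => //; rewrite mul1g].
rewrite -(mul1g x) beE //; last exact: sub1.
by rewrite (hom1 sA aM) dl_1 mul1g -E; exists k.
Qed.

Lemma good_mulK : good (mulset A A').
Proof.
have [aM a1 aG ad aV] := gA; have [aM' a1' aG' ad' aV'] := gA'.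
split; first exact: mulset_sub.
(* One level deeper, as the first letter of a word selects the factor. *)
exists be, (maxn n n').+1; split.
- move=> _ _ [a Aa [b Ab <-]] [c Ac [e Ae <-]].
  have -> : (a * b) * (c * e) = (a * c) * (b * e).
    by rewrite -!mulgA; congr (_ * _); rewrite !mulgA (cAA Ac Ab).
  rewrite !beE //; try exact: subM.
  rewrite aM // aM' // !dlM -!mulgA; congr (_ * _); rewrite !mulgA; congr (_ * _).
  exact: triv_comm (@supp_dl _ _ _) (sect_triv_dl _ inc01).
- move=> _ [a Aa [b Ab <-]]; rewrite beE // => E.
  have := congr1 (sect [:: x0]) E; rewrite sect0 sect1 => /(a1 _ Aa) ->.
  by have := congr1 (sect [:: x1]) E; rewrite sect1' sect1 => /(a1' _ Ab) ->; rewrite mulg1.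
- move=> _ [a Aa [b Ab <-]]; rewrite beE //.
  by apply: subM => //; apply/(bdKG D)/(bddl D); [apply: alK|apply: alK'].
- move=> [//|y a] /=; rewrite ltnS geq_max => /andP [le1 le2].
  have [->|ny0] := eqVneq y x0.
    have [aA|tr] := ad a le1; first by left; apply/im0.
    right=> _ [_ [c Ac [e Ae <-]] <-]; rewrite beE //.
    apply: trivM.
      move=> w'; rewrite (_ : (x0 :: a) ++ w' = [:: x0] ++ (a ++ w')) // dlE.
      by congr (_ ++ _); apply: tr; exists c.
    by apply: (@triv_cat _ [:: _] a); apply: sect_triv_dl.
  have [->|ny1] := eqVneq y x1.
    have [aA|tr] := ad' a le2; first by left; apply/im1.
    right=> _ [_ [c Ac [e Ae <-]] <-]; rewrite beE //.
    apply: trivM; first by apply: (@triv_cat _ [:: _] a); apply: sect_triv_dl.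
    move=> w'; rewrite (_ : (x1 :: a) ++ w' = [:: x1] ++ (a ++ w')) // dlE.
    by congr (_ ++ _); apply: tr; exists e.
  right=> _ [_ [c Ac [e Ae <-]] <-]; rewrite beE //.
  have inc (z : X) : y != z -> ~~ comparable_words [:: z] [:: y].
    by move=> nz; apply: incomp_size => //; apply: contra nz => /eqP [->].
  by apply: trivM; apply: (@triv_cat _ [:: _] a); apply: sect_triv_dl; apply: inc.
- move=> [//|y a] /=; rewrite ltnS geq_max => /andP [le1 le2] ya.
  have [E|ny0] := eqVneq y x0; first by rewrite E in ya *; rewrite diag0; apply: aV => //; apply/im0.
  have [E|ny1] := eqVneq y x1; first by rewrite E in ya *; rewrite diag1; apply: aV' => //; apply/im1.
  case: (ncone_triv D ya) => _ [_ [c Ac [e Ae <-]] <-]; rewrite beE //.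
  have inc (z : X) : y != z -> ~~ comparable_words [:: z] [:: y].
    by move=> nz; apply: incomp_size => //; apply: contra nz => /eqP [->].
  by apply: trivM; apply: (@triv_cat _ [:: _] a); apply: sect_triv_dl; apply: inc.
Qed.

End GoodMul.

(** Passing to the preimages of [K], of finite index in each factor, makes the re-embedding of
    [good_mulK] available. *)
Lemma good_mul A A' : good A -> good A' -> commuting A A' ->
  (forall x, A x -> A' x -> x = 1) ->
  exists2 P, good P & is_subgroup (mulset A A') /\ has_finite_index (mulset A A') P.
Proof.
move=> [sA [al [n gA]]] [sA' [al' [n' gA']]] c ti.
have [aM a1 aG ad aV] := gA; have [aM' a1' aG' ad' aV'] := gA'.
pose A1 := [set a | A a /\ K (al a)]; pose A1' := [set a | A' a /\ K (al' a)].
have sA1 : is_subgroup A1 by apply: hom_preim.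
have sA1' : is_subgroup A1' by apply: hom_preim.
have f1 : has_finite_index A A1.
  by apply: (fi_preim sA aM sK _ (bdfi D)) => _ [x /aG Gx <-].
have f1' : has_finite_index A' A1'.
  by apply: (fi_preim sA' aM' sK _ (bdfi D)) => _ [x /aG' Gx <-].
have [m g1] := goodby_fi sA sA1 f1 gA; have [m' g1'] := goodby_fi sA' sA1' f1' gA'.
have /card_gt1P [x0 [x1 [_ _ x01]]] := bdX D.
have c1 : commuting A1 A' by move=> x y [Ax _]; apply: c.
have c11 : commuting A1 A1' by move=> x y Ax [Ay _]; apply: c1.
exists (mulset A1 A1').
  apply: (good_mulK sA1 sA1' g1 g1' c11 _ _ _ x01).
  - by move=> x [Ax _] [Ax' _]; apply: ti.
  - by move=> x [].
  - by move=> x [].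
have sAA := mulset_sub sA sA' c; split=> //.
have sM1 := mulset_sub sA1 sA' c1; have sM2 := mulset_sub sA1 sA1' c11.
apply: (fi_trans sAA sM1 sM2); first exact: mulset_fi.
rewrite (mulsetC c1) (mulsetC c11); apply: mulset_fi => //; exact: commuting_sym.
Qed.

End KDiag.

(** * Subdirect products *)

Section Kernel.
Variables (X : finType) (G K : set (tree_aut X)) (n0 kk mm : nat).
Hypothesis D : branch_data G K n0 kk mm.
Notation cone := (cone K).
Notation kdiag := (kdiag K).
Notation goodby := (goodby G K).
Notation good := (good G K).

Lemma normal_image_decided (P N : set (tree_aut X)) al n :
  is_subgroup P -> (forall g h, P g -> P h -> al (g * h) = al g * al h) ->
  (forall g, P g -> G (al g)) -> decided K (al @` P) n ->
  is_subgroup N -> N `<=` P -> (forall g x, P g -> N x -> N (g * x * g^-1)) ->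
  exists m, decided K (al @` N) m.
Proof.
move=> sP aM aG dP sN NP nN.
apply: (normal_decided D (hom_image sP aM sP (fun _ H => H)) _ (hom_image sP aM sN NP) _ _ dP).
- by move=> _ [p Pp <-]; apply: aG.
- by move=> _ [p Np <-]; exists p => //; apply: NP.
- move=> _ _ [g Pg <-] [x Nx <-]; exists (g * x * g^-1); first exact: nN.
  have Px := NP _ Nx; have Pg' := subV sP Pg.
  by rewrite !aM ?(homV sP aM) //; apply: subM.
Qed.

(** [z] permutes the words whose cones lie in [L], where [y] is trivial; at the other words of the
    level [z] is trivial and [y] fixes them. *)
Lemma lev_commute L q y z : is_subgroup L -> L `<=` G -> decided K L q -> L z ->
  lev G K q y -> (forall a, size a = q -> cone a `<=` L -> triv a y) -> y * z = z * y.
Proof.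
move=> sL LG dL Lz [Gy Hy] ty; apply: (mulgI (z * y)^-1); rewrite mulVg.
apply: (@triv_level_eq1 _ q) => a sa w; apply: (@aut_inj _ (z * y)).
rewrite -autME mulVKg !autME; have [aL|tr] := dL a (eq_leq (esym sa)).
  rewrite (ty a) // sectE; apply: ty; first by rewrite size_aut.
  move=> x cx; have := cone_conj D (subV (bdG D) (LG _ Lz)) cx.
  rewrite autKV invgK => /aL Lx; have := subM sL (subM sL Lz Lx) (subV sL Lz).
  by rewrite -!mulgA mulgV mulg1 mulVKg.
have [ya _] := Hy a sa; by rewrite (tr z Lz) sectE ya (tr z Lz).
Qed.

Section OneKernel.
Variables (P A : set (tree_aut X)) (pi pi' al : tree_aut X -> tree_aut X) (n : nat).
Hypotheses (sP : is_subgroup P) (sA : is_subgroup A) (gA : goodby A al n).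
Hypothesis piM : forall g h, P g -> P h -> pi (g * h) = pi g * pi h.
Hypothesis piM' : forall g h, P g -> P h -> pi' (g * h) = pi' g * pi' h.
Hypothesis EA : pi @` P = A.
Hypothesis pi1 : forall p, P p -> pi' p = 1 -> pi p = p.

Definition kernel := [set p | P p /\ pi' p = 1].

Lemma kernel_sub : is_subgroup kernel.
Proof. exact: (hom_preim sP piM' (@is_subgroup1 _)). Qed.

Lemma kernel_normal g x : P g -> kernel x -> kernel (g * x * g^-1).
Proof.
move=> Pg [Px x1]; have Pg' := subV sP Pg; have Pgx := subM sP Pg Px.
split; first exact: subM.
by rewrite !piM' // x1 mulg1 (homV sP piM') // mulgV.
Qed.

Let piA p : P p -> A (pi p). Proof. by move=> Pp; rewrite -EA; exists p. Qed.

Lemma comp_hom g h : P g -> P h -> al (pi (g * h)) = al (pi g) * al (pi h).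
Proof. by move=> Pg Ph; have [aM _ _ _ _] := gA; rewrite piM // aM //; apply: piA. Qed.

Lemma comp_G p : P p -> G (al (pi p)).
Proof. by move=> Pp; have [_ _ aG _ _] := gA; apply/aG/piA. Qed.

Lemma comp_decided : decided K ((fun p => al (pi p)) @` P) n.
Proof.
have [_ _ _ ad _] := gA; have -> // : (fun p => al (pi p)) @` P = al @` A.
rewrite -EA; apply/seteqP; split=> [_ [p Pp <-]|_ [_ [p Pp <-] <-]]; last by exists p.
by exists (pi p) => //; exists p.
Qed.

Lemma comp_eq1 p : P p -> al (pi p) = 1 -> pi p = 1.
Proof. by move=> Pp; have [_ a1 _ _ _] := gA; apply: a1; apply: piA. Qed.

Lemma kernel_decided : exists m, decided K ((fun p => al (pi p)) @` kernel) m.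
Proof.
apply: (normal_image_decided sP comp_hom comp_G comp_decided kernel_sub).
  by move=> p [].
exact: kernel_normal.
Qed.

(** On the kernel [pi] is the identity, so the kernel sits inside [A] and inherits its diagonal
    preimages; its image is decided because it is normal in that of [P]. *)
Lemma good_kernel : good kernel.
Proof.
have [aM a1 aG ad aV] := gA.
split; first exact: kernel_sub.
have [m dm] := kernel_decided.
exists (fun p => al (pi p)), (maxn n m); split.
- by move=> g h [Pg _] [Ph _]; apply: comp_hom.
- by move=> p [Pp p1] /(comp_eq1 Pp); rewrite pi1.
- by move=> p [Pp _]; apply: comp_G.
- exact: decided_le (leq_maxr _ _) dm.
- move=> a; rewrite geq_max => /andP [le1 _] aN.
  have [|V dV] := aV a le1.
    by move=> x /aN [p [Pp _] <-]; exists (pi p) => //; apply: piA.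
  exists V; congr kdiag: dV; apply/seteqP; split=> x [Ax cx].
    have [p [Pp p1] E] := aN _ cx.
    have Ex : x = p.
      rewrite -(pi1 Pp p1); apply: (hom_inj sA aM a1) => //; by apply: piA.
    by rewrite Ex; split=> //; rewrite pi1 // -Ex.
  have [Px x1] := Ax; rewrite (pi1 Px x1) in cx; split=> //.
  by rewrite -(pi1 Px x1); apply: piA.
Qed.

End OneKernel.

Section Goursat.
Variables (P A A' : set (tree_aut X)) (pi pi' al al' : tree_aut X -> tree_aut X) (n n' : nat).
Hypotheses (sP : is_subgroup P) (sA : is_subgroup A) (sA' : is_subgroup A').
Hypotheses (gA : goodby A al n) (gA' : goodby A' al' n').
Hypothesis piM : forall g h, P g -> P h -> pi (g * h) = pi g * pi h.
Hypothesis piM' : forall g h, P g -> P h -> pi' (g * h) = pi' g * pi' h.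
Hypotheses (EA : pi @` P = A) (EA' : pi' @` P = A').
Hypothesis piE : forall p, P p -> p = pi p * pi' p.
Hypothesis cAA : commuting A A'.

Let at_ p := al (pi p).
Let at' p := al' (pi' p).
Let N := kernel P pi'.
Let N' := kernel P pi.
Let piA p : P p -> A (pi p). Proof. by move=> Pp; rewrite -EA; exists p. Qed.
Let piA' p : P p -> A' (pi' p). Proof. by move=> Pp; rewrite -EA'; exists p. Qed.
Let atM : forall g h, P g -> P h -> at_ (g * h) = at_ g * at_ h.
Proof. exact: (comp_hom gA piM EA). Qed.
Let atM' : forall g h, P g -> P h -> at' (g * h) = at' g * at' h.
Proof. exact: (comp_hom gA' piM' EA'). Qed.
Let atG p : P p -> G (at_ p). Proof. exact: (comp_G gA EA). Qed.
Let atG' p : P p -> G (at' p). Proof. exact: (comp_G gA' EA'). Qed.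
Let sN : is_subgroup N := kernel_sub sP piM'.
Let sN' : is_subgroup N' := kernel_sub sP piM.
Let NP : N `<=` P. Proof. by move=> p []. Qed.
Let NP' : N' `<=` P. Proof. by move=> p []. Qed.

Let pi1 p : P p -> pi' p = 1 -> pi p = p.
Proof. by move=> Pp p1; rewrite [RHS]piE // p1 mulg1. Qed.
Let pi1' p : P p -> pi p = 1 -> pi' p = p.
Proof. by move=> Pp p1; rewrite [RHS]piE // p1 mul1g. Qed.

Let at_N' p : N' p -> at_ p = 1.
Proof. by case=> Pp E; rewrite /at_ E; have [aM _ _ _ _] := gA; apply: (hom1 sA aM). Qed.
Let at_N p : N p -> at' p = 1.
Proof. by case=> Pp E; rewrite /at' E; have [aM _ _ _ _] := gA'; apply: (hom1 sA' aM). Qed.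

Let joint p q : P p -> P q -> at_ p = at_ q -> at' p = at' q -> p = q.
Proof.
move=> Pp Pq E E'; rewrite (piE Pp) (piE Pq).
have [aM a1 _ _ _] := gA; have [aM' a1' _ _ _] := gA'.
by rewrite (hom_inj sA aM a1 (piA Pp) (piA Pq) E) (hom_inj sA' aM' a1' (piA' Pp) (piA' Pq) E').
Qed.

Let cNN : commuting N N'.
Proof.
move=> x y [Px x1] [Py y1]; rewrite -(pi1 Px x1) -(pi1' Py y1).
by apply: cAA; [apply: piA|apply: piA'].
Qed.

(* On the common centraliser of the two kernels both projections are injective,
   so they are related by an isomorphism of decided subgroups: rigidity applies. *)
Let P2 := [set p | [/\ P p, forall m, N m -> p * m = m * p & forall m, N' m -> p * m = m * p]].

Let sP2 : is_subgroup P2.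
Proof.
split.
- by split; [exact: sub1|move=> m _; rewrite mul1g mulg1|move=> m _; rewrite mul1g mulg1].
- move=> x y [Px x1 x2] [Py y1 y2]; split; first exact: subM.
    by move=> m Nm; rewrite -mulgA y1 // mulgA x1 // mulgA.
  by move=> m Nm; rewrite -mulgA y2 // mulgA x2 // mulgA.
- move=> x [Px x1 x2]; split; first exact: subV.
    by move=> m Nm; apply: (mulgI x); rewrite mulVKg mulgA x1 // mulgK.
  by move=> m Nm; apply: (mulgI x); rewrite mulVKg mulgA x2 // mulgK.
Qed.

Let P2P : P2 `<=` P. Proof. by move=> p []. Qed.

Let P2n g x : P g -> P2 x -> P2 (g * x * g^-1).
Proof.
move=> Pg [Px x1 x2]; have Pg' := subV sP Pg; split.
- by apply: subM => //; apply: subM.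
- move=> m Nm; have Nm' : N (g^-1 * m * g).
    by have := kernel_normal sP piM' Pg' Nm; rewrite invgK.
  have -> : m = g * (g^-1 * m * g) * g^-1 by rewrite -!mulgA mulgV mulg1 mulVKg.
  have := x1 _ Nm'; move: (g^-1 * m * g) => m' E.
  by rewrite -!mulgA !mulKg (mulgA x) E !mulgA.
- move=> m Nm; have Nm' : N' (g^-1 * m * g).
    by have := kernel_normal sP piM Pg' Nm; rewrite invgK.
  have -> : m = g * (g^-1 * m * g) * g^-1 by rewrite -!mulgA mulgV mulg1 mulVKg.
  have := x2 _ Nm'; move: (g^-1 * m * g) => m' E.
  by rewrite -!mulgA !mulKg (mulgA x) E !mulgA.
Qed.

Let dN : exists m, decided K (at_ @` N) m.
Proof. exact: (kernel_decided sP gA piM piM' EA). Qed.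
Let dN' : exists m, decided K (at' @` N') m.
Proof. exact: (kernel_decided sP gA' piM' piM EA'). Qed.
Let dP2 : exists m, decided K (at_ @` P2) m.
Proof. exact: (normal_image_decided sP atM atG (comp_decided gA EA) sP2 P2P P2n). Qed.
Let dP2' : exists m, decided K (at' @` P2) m.
Proof. exact: (normal_image_decided sP atM' atG' (comp_decided gA' EA') sP2 P2P P2n). Qed.

(** Such a [p] lies in [N'] and centralises it, so [at' p] is trivial below the cones contained in
    the image of [N'], and elsewhere because that image is. *)
Let P2_inj p : P2 p -> at_ p = 1 -> p = 1.
Proof.
move=> P2p E; have [Pp _ p2] := P2p.
have E1 : pi p = 1 by apply: (comp_eq1 gA EA).
have N'p : N' p by [].
apply: (joint Pp (sub1 sP)); first by rewrite E (hom1 sP atM).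
rewrite (hom1 sP atM').
have [m dm] := dN'; apply: (@triv_level_eq1 _ m) => a sa.
have [aN|tr] := dm a (eq_leq (esym sa)); last by apply: tr; exists p.
apply: (cone_centr D) => x /aN [y Ny <-].
by rewrite -!atM' //; [rewrite p2|exact: NP'|exact: NP'].
Qed.

Let P2_inj' p : P2 p -> at' p = 1 -> p = 1.
Proof.
move=> P2p E; have [Pp p2 _] := P2p.
have E1 : pi' p = 1 by apply: (comp_eq1 gA' EA').
have N'p : N p by [].
apply: (joint Pp (sub1 sP)); last by rewrite E (hom1 sP atM').
rewrite (hom1 sP atM).
have [m dm] := dN; apply: (@triv_level_eq1 _ m) => a sa.
have [aN|tr] := dm a (eq_leq (esym sa)); last by apply: tr; exists p.
apply: (cone_centr D) => x /aN [y Ny <-].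
by rewrite -!atM //; [rewrite p2|exact: NP|exact: NP].
Qed.

(** Rigidity matches [cone a] under [at_] with some [cone b] under [at']. The preimage in [P2] then
    projects onto copies of [K] diagonal on [V] and on [V'], whose supports are incomparable because
    [A] and [A'] commute; it is diagonal on the union. *)
Let good_P2 : good P2.
Proof.
have [aM a1 aG ad aV] := gA; have [aM' a1' aG' ad' aV'] := gA'.
split=> //; have [m dm] := dP2; have [m' dm'] := dP2'.
pose M := maxn m m'.
have hM g h : P2 g -> P2 h -> at_ (g * h) = at_ g * at_ h.
  by move=> /P2P Pg /P2P; apply: atM.
have hM' g h : P2 g -> P2 h -> at' (g * h) = at' g * at' h.
  by move=> /P2P Pg /P2P; apply: atM'.
have inj := hom_inj sP2 hM P2_inj; have inj' := hom_inj sP2 hM' P2_inj'.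
pose lft y := xget 1 [set p | P2 p /\ at_ p = y].
pose lft' y := xget 1 [set p | P2 p /\ at' p = y].
have lftE p : P2 p -> lft (at_ p) = p.
  move=> Pp; rewrite /lft; case: xgetP => [q _ [Pq E]|/(_ p)]; last by case.
  exact: inj.
have lftE' p : P2 p -> lft' (at' p) = p.
  move=> Pp; rewrite /lft'; case: xgetP => [q _ [Pq E]|/(_ p)]; last by case.
  exact: inj'.
have I : iso_data G K (at_ @` P2) (at' @` P2) (fun y => at' (lft y)) (fun y => at_ (lft' y)) M.
  split.
  - exact: (hom_image sP2 hM).
  - exact: (hom_image sP2 hM').
  - by move=> _ [p /P2P Pp <-]; apply: atG.
  - by move=> _ [p /P2P Pp <-]; apply: atG'.
  - exact: decided_le (leq_maxl _ _) dm.
  - exact: decided_le (leq_maxr _ _) dm'.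
  - by move=> _ _ [p Pp <-] [q Pq <-]; rewrite -hM // !lftE ?hM' //; apply: subM.
  - by move=> _ _ [p Pp <-] [q Pq <-]; rewrite -hM' // !lftE' ?hM //; apply: subM.
  - by move=> _ [p Pp <-]; rewrite lftE //; exists p.
  - by move=> _ [p Pp <-]; rewrite lftE' //; exists p.
  - by move=> _ [p Pp <-]; rewrite lftE // lftE'.
  - by move=> _ [p Pp <-]; rewrite lftE' // lftE.
(* [n0] is raised above [M] as rigidity requires, and [b] is asked to have length at least [n'] so
   that the description of preimages under [al'] applies to it. *)
have [L HL] := rigid_deep (bd_weaken D (leq_maxl n0 M)) I (leq_maxr _ _) n'.
exists at_, (maxn (maxn m n) L); split=> //.
- by move=> g /P2P; apply: atG.
- by apply: decided_le dm; rewrite leq_max leq_maxl.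
move=> a; rewrite !geq_max => /andP [/andP [_ lea] leL] aP2.
have [b leb Eb] := HL a leL aP2.
have [|V dV] := aV a lea.
  by move=> x /aP2 [p /P2P Pp <-]; exists (pi p) => //; apply: piA.
have bP2 : cone b `<=` at' @` P2.
  by rewrite -Eb => _ [x /aP2 [p Pp <-] <-]; rewrite lftE //; exists p.
have [|V' dV'] := aV' b leb.
  by move=> x /bP2 [p /P2P Pp <-]; exists (pi' p) => //; apply: piA'.
exists (V `|` V').
set E1 := [set x | _] in dV; set E2 := [set x | _] in dV'.
have c12 : commuting E1 E2 by move=> x y [Ax _] [Ay _]; apply: cAA.
have ab p : P2 p -> (cone a (at_ p) <-> cone b (at' p)).
  move=> Pp; split=> [ca|]; first by rewrite -Eb; exists (at_ p) => //; rewrite lftE.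
  rewrite -Eb => -[y cy]; have [q Pq Ey] := aP2 _ cy.
  by rewrite -Ey lftE // => /(inj' _ _ Pq Pp) <-; rewrite Ey.
have toE1 p : P2 p -> cone a (at_ p) -> E1 (pi p).
  by move=> /P2P Pp ca; split=> //; apply: piA.
have toE2 p : P2 p -> cone a (at_ p) -> E2 (pi' p).
  by move=> Pp /(ab _ Pp) cb; split=> //; apply/piA'/P2P.
have sect1 p v : P2 p -> cone a (at_ p) -> V v -> p v = v /\ sect v p = sect v (pi p).
  move=> Pp ca Vv; have e2 := toE2 _ Pp ca.
  have [t1 t2] : pi' p v = v /\ sect v (pi' p) = 1.
    by apply/triv_sect/(kdiag_triv dV' e2) => v' Vv'; apply: (kdiag_incomp D dV dV').
  have [_ _ _ H _] := dV; have [/(_ _ Vv) t3 _] := H _ (toE1 _ Pp ca).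
  by rewrite {1 2}(piE (P2P Pp)) autME sectM t1 t2 t3 mulg1.
have sect2 p v : P2 p -> cone a (at_ p) -> V' v -> p v = v /\ sect v p = sect v (pi' p).
  move=> Pp ca Vv; have e1 := toE1 _ Pp ca.
  have [t1 t2] : pi p v = v /\ sect v (pi p) = 1.
    apply/triv_sect/(kdiag_triv dV e1) => v' Vv'; apply: (kdiag_incomp D dV' dV) => //.
    exact: commuting_sym.
  have [_ _ _ H _] := dV'; have [/(_ _ Vv) t3 _] := H _ (toE2 _ Pp ca).
  by rewrite {1 2}(piE (P2P Pp)) autME sectM t3 t1 t2 mul1g.
have [fV nV acV HV SV] := dV; have [fV' nV' acV' HV' SV'] := dV'.
split.
- by rewrite finite_setU.
- by case: nV => v Vv; exists v; left.
- move=> u v [Vu|Vu] [Vv|Vv] cuv; [exact: acV| | |exact: acV'].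
    by have := kdiag_incomp D dV dV' c12 Vu Vv; rewrite cuv.
  by have := kdiag_incomp D dV dV' c12 Vv Vu; rewrite comparable_sym cuv.
- move=> p [Pp ca]; split=> [v [Vv|Vv]|w Hw].
  + by have [] := sect1 p v Pp ca Vv.
  + by have [] := sect2 p v Pp ca Vv.
  + rewrite (piE (P2P Pp)) autME; have [_ ->] := HV' _ (toE2 _ Pp ca).
      by have [_ ->] := HV _ (toE1 _ Pp ca) => // v Vv; apply: Hw; left.
    by move=> v Vv; apply: Hw; right.
- move=> v [Vv|Vv].
  + have [ij sj] := SV v Vv; split.
      move=> p q /set_mem [Pp cp] /set_mem [Pq cq].
      have [_ ->] := sect1 p v Pp cp Vv; have [_ ->] := sect1 q v Pq cq Vv => E.
      apply: inj => //; congr al; apply: ij => //; rewrite inE; exact: toE1.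
    apply/seteqP; split=> [_ [p [Pp cp] <-]|k].
      by have [_ ->] := sect1 p v Pp cp Vv; rewrite -sj; exists (pi p) => //; apply: toE1.
    rewrite -{1}sj => -[x [Ax cx] <-]; have [p Pp Ep] := aP2 _ cx.
    have Ex : pi p = x by apply: (hom_inj sA aM a1) => //; apply/piA/P2P.
    have cp : cone a (at_ p) by rewrite Ep.
    by exists p => //; have [_ ->] := sect1 p v Pp cp Vv; rewrite Ex.
  + have [ij sj] := SV' v Vv; split.
      move=> p q /set_mem [Pp cp] /set_mem [Pq cq].
      have [_ ->] := sect2 p v Pp cp Vv; have [_ ->] := sect2 q v Pq cq Vv => E.
      apply: inj' => //; congr al'; apply: ij => //; rewrite inE; exact: toE2.
    apply/seteqP; split=> [_ [p [Pp cp] <-]|k].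
      by have [_ ->] := sect2 p v Pp cp Vv; rewrite -sj; exists (pi' p) => //; apply: toE2.
    rewrite -{1}sj => -[x [Ax cx] <-]; have [p Pp Ep] := bP2 _ cx.
    have Ex : pi' p = x by apply: (hom_inj sA' aM' a1') => //; apply/piA'/P2P.
    have cp : cone a (at_ p) by apply/ab => //; rewrite Ep.
    by exists p => //; have [_ ->] := sect2 p v Pp cp Vv; rewrite Ex.
Qed.

Let good_N : good N := good_kernel sP sA gA piM piM' EA pi1.
Let good_N' : good N' := good_kernel sP sA' gA' piM' piM EA' pi1'.

Let P2N x : P2 x -> N x -> x = 1.
Proof. by move=> P2x /at_N; apply: P2_inj'. Qed.
Let P2N' x : P2 x -> N' x -> x = 1.
Proof. by move=> P2x /at_N'; apply: P2_inj. Qed.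

Let sNN : is_subgroup (mulset N N') := mulset_sub sN sN' cNN.

Let cNP2 : commuting (mulset N N') P2.
Proof.
move=> _ y [a Na [b Nb <-]] [_ y1 y2].
by rewrite -mulgA -(y2 b Nb) mulgA -(y1 a Na) -mulgA.
Qed.

Let NNP2 x : mulset N N' x -> P2 x -> x = 1.
Proof.
move=> [a Na [b Nb <-]] [Pab ab1 ab2].
have a1 : a = 1.
  apply: P2N => //; split; first exact: NP.
    by move=> e Ne; apply: (mulIg b); rewrite -mulgA (cNN Ne Nb) mulgA ab1 // mulgA.
  by move=> e Ne; apply: cNN.
rewrite a1 mul1g in Pab ab1 ab2 *; exact: P2N'.
Qed.

Let T := mulset (mulset N N') P2.

(** Any [p] whose two images lie in [lev q] is in [T]: its components in the cones of the two kernel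
    images are divided out by elements of [N] and [N'], and the rest centralises both kernels. *)
Let T_fi : has_finite_index P T.
Proof.
have [m1 d1] := dN; have [m2 d2] := dN'; pose q := maxn m1 m2.
have dq1 := decided_le (leq_maxl m1 m2) d1; have dq2 := decided_le (leq_maxr m1 m2) d2.
rewrite -/q in dq1 dq2.
have sL := lev_sub D q.
pose B1 := [set p | P p /\ lev G K q (at_ p)]; pose B2 := [set p | P p /\ lev G K q (at' p)].
have f1 : has_finite_index P B1.
  by apply: (fi_preim sP atM sL _ (lev_fi D q)) => _ [p Pp <-]; apply: atG.
have f2 : has_finite_index P B2.
  by apply: (fi_preim sP atM' sL _ (lev_fi D q)) => _ [p Pp <-]; apply: atG'.
have sB1 : is_subgroup B1 by apply: hom_preim.
have sB2 : is_subgroup B2 by apply: hom_preim.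
have sT : is_subgroup T by apply: mulset_sub.
have sB := is_subgroupI sB1 sB2.
apply: (fi_upper sP sT sB (fi_I sP sB1 sB2 f1 f2)); last first.
  by move=> _ [_ [a [Pa _] [b [Pb _] <-]] [c [Pc _ _] <-]]; apply: subM => //; apply: subM.
have sI1 : is_subgroup (at_ @` N) := hom_image sP atM sN NP.
have sI2 : is_subgroup (at' @` N') := hom_image sP atM' sN' NP'.
have GI1 : at_ @` N `<=` G by move=> _ [x /NP Px <-]; apply: atG.
have GI2 : at' @` N' `<=` G by move=> _ [x /NP' Px <-]; apply: atG'.
move=> p [[Pp l1] [_ l2]].
have [t _|h [lh Mh h1 _]] := @lev_part _ _ _ _ _ _ D q (at_ p)
    (fun t : q.-tuple X => `[< cone t `<=` at_ @` N >]).
  by case: l1 => _; apply; apply: size_tuple.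
have [t _|h' [lh' Mh' h1' _]] := @lev_part _ _ _ _ _ _ D q (at' p)
    (fun t : q.-tuple X => `[< cone t `<=` at' @` N' >]).
  by case: l2 => _; apply; apply: size_tuple.
have [m Nm Em] : (at_ @` N) h.
  apply: Mh => // t /asboolP; apply; exists (sect t (at_ p)) => //.
  by case: l1 => _ /(_ t (size_tuple t)) [].
have [m' Nm' Em'] : (at' @` N') h'.
  apply: Mh' => // t /asboolP; apply; exists (sect t (at' p)) => //.
  by case: l2 => _ /(_ t (size_tuple t)) [].
(* [m] does not affect [at'] and [m'] does not affect [at_], so the two corrections are
   independent. *)
pose p2 := m'^-1 * (m^-1 * p).
have Vm := subV sP (NP Nm); have Vm' := subV sP (NP' Nm').
have Vmp := subM sP Vm Pp; have Pp2 : P p2 := subM sP Vm' Vmp.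
have E1 : at_ p2 = h^-1 * at_ p.
  rewrite /p2 atM // atM // !(homV sP atM) //; [|exact: NP|exact: NP'].
  by rewrite (at_N' Nm') invg1 mul1g Em.
have E2 : at' p2 = h'^-1 * at' p.
  rewrite /p2 atM' // atM' // !(homV sP atM') //; [|exact: NP|exact: NP'].
  by rewrite (at_N Nm) invg1 mul1g Em'.
have le1 : lev G K q (at_ p2) by rewrite E1; apply: subM => //; apply: subV.
have le2 : lev G K q (at' p2) by rewrite E2; apply: subM => //; apply: subV.
have Ep : m * m' * p2 = p by rewrite /p2 -mulgA mulVKg mulVKg.
clearbody p2; exists (m * m'); first by exists m => //; exists m'.
exists p2 => //.
split=> // e Ne.
  have Pe := NP Ne; apply: joint; try exact: subM.
    rewrite !atM //; apply: (lev_commute sI1 GI1 dq1) => //.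
    by move=> a /eqP sa aN; rewrite E1; apply: (h1 (Tuple sa)); apply/asboolP.
  by rewrite !atM' // (at_N Ne) mulg1 mul1g.
have Pe := NP' Ne; apply: joint; try exact: subM.
  by rewrite !atM // (at_N' Ne) mulg1 mul1g.
rewrite !atM' //; apply: (lev_commute sI2 GI2 dq2) => //.
by move=> a /eqP sa aN; rewrite E2; apply: (h1' (Tuple sa)); apply/asboolP.
Qed.

Lemma goursat : exists2 Q, good Q & has_finite_index P Q.
Proof.
have NN1 x : N x -> N' x -> x = 1.
  move=> Nx N'x; apply: (joint (NP Nx) (sub1 sP)).
    by rewrite (at_N' N'x) (hom1 sP atM).
  by rewrite (at_N Nx) (hom1 sP atM').
have [Q1 gQ1 [_ f1]] := good_mul D good_N good_N' cNN NN1.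
have [sQ1 _] := gQ1; have Q1N := fi_sub f1.
have c1 : commuting Q1 P2 by move=> x y /Q1N; apply: cNP2.
have t1 x : Q1 x -> P2 x -> x = 1 by move=> /Q1N; apply: NNP2.
have [Q2 gQ2 [sQP f2]] := good_mul D gQ1 good_P2 c1 t1.
exists Q2 => //; have [sQ2 _] := gQ2.
have sT : is_subgroup T by apply: mulset_sub.
apply: (fi_trans sP sT sQ2 T_fi); apply: (fi_trans sT sQP sQ2) f2.
exact: mulset_fi.
Qed.

End Goursat.

End Kernel.

Local Arguments dl : simpl never.

(** * Assembling the sections at the letters *)

Section Assembly.
Variables (X : finType) (G K : set (tree_aut X)) (n0 kk mm : nat).
Hypothesis D : branch_data G K n0 kk mm.
Notation cone := (cone K).
Notation good := (good G K).
Implicit Types (g h : tree_aut X) (H : set (tree_aut X)) (x : X) (s : seq X).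

Lemma letter_incomp x y : x != y -> ~~ comparable_words [:: x] [:: y].
Proof. by move=> n; apply: incomp_size => //; apply: contra n => /eqP [->]. Qed.

(** Keeps the components of [h] at the letters of [s] and forgets the others, so that letters can be
    treated one at a time. *)
Fixpoint rho s h : tree_aut X :=
  if s is x :: s' then dl [:: x] (sect [:: x] h) * rho s' h else 1.

Lemma rho_cons x s h : rho (x :: s) h = dl [:: x] (sect [:: x] h) * rho s h.
Proof. by []. Qed.

Lemma rho_triv s h x : x \notin s -> triv [:: x] (rho s h).
Proof.
elim: s => [|y s IH] /=; first by move=> _; apply: triv1.
rewrite inE negb_or => /andP [ny ns]; apply: trivM; last exact: IH.
by apply: sect_triv_dl; apply: letter_incomp; rewrite eq_sym.
Qed.

Lemma rho_comm s h k x : x \notin s ->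
  dl [:: x] k * rho s h = rho s h * dl [:: x] k.
Proof. by move=> /(@rho_triv _ h) t; apply/esym/(triv_comm (@supp_dl _ _ _) t). Qed.

Lemma rhoM s g h : uniq s -> (forall x, h [:: x] = [:: x]) ->
  rho s (g * h) = rho s g * rho s h.
Proof.
move=> us hx; elim: s us => [|x s IH] /=; first by rewrite mulg1.
move=> /andP [ns us]; rewrite IH // sectM hx dlM -!mulgA; congr (_ * _).
by rewrite !mulgA rho_comm.
Qed.

Lemma sect_rho s h x : uniq s -> x \in s -> rho s h [:: x] = [:: x] /\ sect [:: x] (rho s h) = sect [:: x] h.
Proof.
elim: s => [//|y s IH]; rewrite cons_uniq inE rho_cons => /andP [ns us].
case: eqVneq => [-> _|nxy].
  have [E1 E2] := triv_sect (@rho_triv s h y ns).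
  by rewrite autME E1 sectM E1 E2 mulg1 sect_dl dl_self.
rewrite orFb => /(IH us) [E1 E2].
have nyx : y != x by rewrite eq_sym.
have [E3 E4] := triv_sect (sect_triv_dl (sect [:: y] h) (letter_incomp nyx)).
by rewrite autME E1 E3 sectM E1 E4 mul1g.
Qed.

Lemma rho_all h : (forall x, h [:: x] = [:: x]) -> rho (enum X) h = h.
Proof.
move=> hx; apply: tree_aut_ext => -[|x w]; first by rewrite !aut_nil.
have [|E1 E2] := @sect_rho (enum X) h x (enum_uniq _); first by rewrite mem_enum.
by rewrite -cat1s !sectE E1 E2 hx.
Qed.

Lemma goursat_good P A A' pi pi' : is_subgroup P -> good A -> good A' ->
  (forall g h, P g -> P h -> pi (g * h) = pi g * pi h) ->
  (forall g h, P g -> P h -> pi' (g * h) = pi' g * pi' h) ->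
  pi @` P = A -> pi' @` P = A' -> (forall p, P p -> p = pi p * pi' p) ->
  commuting A A' -> exists2 Q, good Q & has_finite_index P Q.
Proof.
move=> sP [sA [al [n gA]]] [sA' [al' [n' gA']]] piM piM' EA EA' piE c.
exact: (goursat D sP sA sA' gA gA' piM piM' EA EA' piE c).
Qed.

Definition virtually_good H := exists2 P, good P & has_finite_index H P.

(** Induction on the list of letters: after passing to a finite index subgroup, [rho (x :: s)] has a
    subdirect image in the commuting groups formed by the component at [x] and by [rho s], to which
    Goursat applies. *)
Lemma virtually_good_St H : is_subgroup H -> (forall h x, H h -> h [:: x] = [:: x]) ->
  (forall x, virtually_good (sect [:: x] @` H)) -> virtually_good H.
Proof.
move=> sH fixH HV.
have sM x g h : H g -> H h -> sect [:: x] (g * h) = sect [:: x] g * sect [:: x] h.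
  by move=> _ Hh; rewrite sectM fixH.
have rM s : uniq s -> forall g h, H g -> H h -> rho s (g * h) = rho s g * rho s h.
  by move=> us g h _ Hh; apply: rhoM => // x; apply: fixH.
suff claim s : uniq s -> exists Hs, [/\ is_subgroup Hs, has_finite_index H Hs & good (rho s @` Hs)].
  have [Hs [sHs fHs gHs]] := claim (enum X) (enum_uniq _).
  exists Hs => //; congr good: gHs; apply/seteqP; split=> [_ [h Hsh <-]|h Hsh].
    by rewrite rho_all // => x; apply: fixH; apply: fi_sub fHs _ Hsh.
  exists h => //; apply: rho_all => x; apply: fixH; exact: fi_sub fHs _ Hsh.
elim: s => [_|x s IH] /=.
  exists H; split=> //; first exact: fi_refl.
  congr good: (good_1 D); apply/seteqP; split=> [_ ->|_ [h _ <-] //].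
  by exists 1 => //; apply: sub1.
move=> /andP [ns us]; have [Hs [sHs fHs gHs]] := IH us.
have [Px gPx fPx] := HV x; have [sPx _] := gPx; have HsH := fi_sub fHs.
pose Hx := [set h | H h /\ Px (sect [:: x] h)].
have sHx : is_subgroup Hx := hom_preim sH (sM x) sPx.
have fHx : has_finite_index H Hx by apply: (fi_preim sH (sM x) sPx) fPx.
pose H1 := Hs `&` Hx.
have sH1 : is_subgroup H1 by apply: is_subgroupI.
have fH1 : has_finite_index H H1 by apply: fi_I.
have H1H := fi_sub fH1.
have gA' : good (rho s @` H1).
  apply: (good_fi D _ _ gHs).
    exact: (hom_image sH (rM s us) sH1 H1H).
  apply: (fi_image sHs sH1); last by apply: (fi_lower sH sHs sH1 fH1) => // h [].
  by move=> g h /HsH Hg /HsH; apply: rM.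
have sS : is_subgroup (sect [:: x] @` H) := hom_image sH (sM x) sH (fun _ i => i).
have sS1 : is_subgroup (sect [:: x] @` H1) := hom_image sH (sM x) sH1 H1H.
have gA : good (dl [:: x] @` (sect [:: x] @` H1)).
  apply/good_dl/(good_fi D sS1 _ gPx).
  apply: (fi_lower sS sPx sS1); [exact: (fi_image sH sH1 (sM x) fH1)| |exact: fi_sub fPx].
  by move=> _ [h [_ [_ Ph]] <-].
pose pi (p : tree_aut X) := dl [:: x] (sect [:: x] p).
pose pi' (p : tree_aut X) := (pi p)^-1 * p.
have sxr h : H h -> sect [:: x] (rho (x :: s) h) = sect [:: x] h.
  by move=> Hh; have [] := @sect_rho (x :: s) h x; rewrite ?mem_head //= ns.
have pir h : H h -> pi (rho (x :: s) h) = dl [:: x] (sect [:: x] h).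
  by move=> Hh; rewrite /pi sxr.
have pir' h : H h -> pi' (rho (x :: s) h) = rho s h.
  by move=> Hh; rewrite /pi' pir // mulKg.
have rMx := rM (x :: s); rewrite /= ns us in rMx; have {}rMx := rMx isT.
pose P := rho (x :: s) @` H1.
have sP : is_subgroup P := hom_image sH rMx sH1 H1H.
have [||||||Q gQ fQ] := @goursat_good P _ _ pi pi' sP gA gA'.
- move=> _ _ [g /H1H Hg <-] [h /H1H Hh <-]; rewrite -rMx //= !pir //; last exact: subM.
  by rewrite sM // dlM.
- move=> _ _ [g /H1H Hg <-] [h /H1H Hh <-]; rewrite -rMx //= !pir' //; last exact: subM.
  exact: rM.
- apply/seteqP; split=> [_ [_ [h Hh <-] <-]|_ [_ [h Hh <-] <-]].
    by rewrite pir; [exists (sect [:: x] h) => //; exists h|exact: H1H].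
  by exists (rho (x :: s) h); [exists h|rewrite pir //; apply: H1H].
- apply/seteqP; split=> [_ [_ [h Hh <-] <-]|_ [h Hh <-]].
    by rewrite pir'; [exists h|exact: H1H].
  by exists (rho (x :: s) h); [exists h|rewrite pir' //; apply: H1H].
- by move=> p _; rewrite /pi' mulVKg.
- by move=> _ _ [_ [g _ <-] <-] [h _ <-]; apply: rho_comm.
exists [set h | H1 h /\ Q (rho (x :: s) h)].
have [sQ _] := gQ.
have rM1 g h : H1 g -> H1 h -> rho (x :: s) (g * h) = rho (x :: s) g * rho (x :: s) h.
  by move=> /H1H Hg /H1H; apply: rMx.
have sHQ := hom_preim sH1 rM1 sQ; split=> //.
  by apply: (fi_trans sH sH1 sHQ fH1); apply: (fi_preim sH1 rM1 sQ) fQ.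
congr good: gQ; apply/seteqP; split=> [q Qq|_ [h [_ Qh] <-] //].
by have [h H1h E] := fi_sub fQ Qq; exists h => //; split=> //; rewrite E.
Qed.

End Assembly.

Section ProdSets.
Variables (gT : groupType) (b : nat) (E : 'I_b -> set gT).
Hypothesis sE : forall i, is_subgroup (E i).
Hypothesis cE : forall i j, i != j -> commuting (E i) (E j).

Lemma prod_commuting (h h' : 'I_b -> gT) : (forall i, E i (h i)) -> (forall i, E i (h' i)) ->
  \prod_(i < b) (h i * h' i) = (\prod_(i < b) h i) * \prod_(i < b) h' i.
Proof.
move=> Eh Eh'; suff H (s : seq 'I_b) : uniq s ->
    \prod_(i <- s) (h i * h' i) = (\prod_(i <- s) h i) * \prod_(i <- s) h' i.
  exact/H/index_enum_uniq.
elim: s => [_|i s IH] /=; first by rewrite !big_nil mulg1.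
move=> /andP [nis us]; rewrite !big_cons IH // -!mulgA; congr (_ * _).
rewrite !mulgA; congr (_ * _); elim: s nis {us IH} => [_|j s IH].
  by rewrite !big_nil mulg1 mul1g.
rewrite inE negb_or => /andP [nij nis]; rewrite !big_cons mulgA (cE nij (Eh' i) (Eh j)).
by rewrite -!mulgA IH.
Qed.

Lemma prod_sets_sub : is_subgroup (prod_sets E).
Proof.
split.
- by exists (fun=> 1); [move=> i; apply: sub1|rewrite big1].
- move=> _ _ [h Eh <-] [h' Eh' <-]; exists (fun i => h i * h' i).
    by move=> i; apply: subM.
  exact: prod_commuting.
- move=> _ [h Eh <-]; exists (fun i => (h i)^-1); first by move=> i; apply: subV.
  apply: (mulgI (\prod_(i < b) h i)); rewrite mulgV -prod_commuting //.
    by rewrite big1 // => i _; rewrite mulgV.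
  by move=> i; apply: subV.
Qed.

Lemma sub_prod_sets i : E i `<=` prod_sets E.
Proof.
move=> x Ex; exists (fun j => if j == i then x else 1).
  by move=> j /=; case: eqVneq => [->//|_]; apply: sub1.
by rewrite -big_mkcond big_pred1_eq.
Qed.

Lemma prod_sets_min M : is_subgroup M -> (forall i, E i `<=` M) -> prod_sets E `<=` M.
Proof.
move=> sM EM _ [h Eh <-]; elim/big_ind: _ => [|x y Mx My|i _]; first exact: sub1.
  exact: subM.
by apply: EM; apply: Eh.
Qed.

End ProdSets.

(** * From good subgroups to regular block subgroups *)

Section Conclusion.
Variables (X : finType) (G K : set (tree_aut X)) (n0 kk mm : nat).
Hypothesis D : branch_data G K n0 kk mm.
Let sG := bdG D.
Let sK := bdK D.
Notation cone := (cone K).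
Notation lev := (lev G K).
Notation good := (good G K).
Notation kdiag := (kdiag K).
Notation virtually_good := (virtually_good G K).

(** [L] is the preimage of [lev n], hence the product of the preimages of the cones at level [n]
    contained in the image. These commute pairwise, so their supports are incomparable, and at a
    vertex of one block the other factors are trivial. *)
Lemma good_regular_block H : is_subgroup H -> H `<=` G -> virtually_good H ->
  virtually_regular_block G K H.
Proof.
move=> sH HG [P [sP [al [n [aM a1 aG ad aV]]]] fP].
have PH := fi_sub fP; have inj := hom_inj sP aM a1.
pose I := [set t : n.-tuple X | `[< cone t `<=` al @` P >]]%SET.
pose a (i : 'I_#|I|) : n.-tuple X := enum_val i.
have aP i : cone (a i) `<=` al @` P.
  by have := enum_valP i; rewrite inE => /asboolP.
pose E i := [set x | P x /\ cone (a i) (al x)].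
have sE i : is_subgroup (E i) by apply: hom_preim => //; apply: (cone_sub D).
have /choice [V dV] : forall i, exists V, kdiag (E i) V.
  by move=> i; apply: aV; rewrite ?size_tuple.
have anij i j : i != j -> ~~ comparable_words (a i) (a j).
  move=> nij; apply: incomp_size; rewrite ?size_tuple //.
  by apply: contra nij => /eqP /val_inj /enum_val_inj ->.
have cE i j : i != j -> commuting (E i) (E j).
  move=> nij x y [Px cx] [Py cy]; apply: inj; [exact: subM|exact: subM|].
  rewrite !aM //; apply: triv_comm (cone_supp cy) _.
  exact: supp_triv (cone_supp cx) (anij _ _ nij).
pose L := [set x | P x /\ lev n (al x)].
have sL : is_subgroup L by apply: hom_preim => //; apply: (lev_sub D).
have fL : has_finite_index P L.
  by apply: (fi_preim sP aM (lev_sub D n) _ (lev_fi D n)) => _ [x Px <-]; apply: aG.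
have LE : L = prod_sets E.
  apply/seteqP; split=> [x [Px lx]|]; last first.
    apply: prod_sets_min => // i x [Px cx]; split=> //.
    by have := cone_lev D cx; rewrite size_tuple.
  have sM := prod_sets_sub sE cE.
  have MP : prod_sets E `<=` P by apply: prod_sets_min => // i y [].
  have [y My Ey] : (al @` prod_sets E) (al x).
    apply: (lev_prod D) lx _ ad (hom_image sP aM sM MP) _; first by exists x.
    move=> v /eqP sv vP z cz; have [y Py Ey] := vP _ cz; exists y => //.
    have vI : Tuple sv \in I by rewrite inE; apply/asboolP.
    apply: (@sub_prod_sets _ _ _ sE (enum_rank_in vI (Tuple sv))); split=> //.
    by rewrite /a enum_rankK_in // Ey.
  by rewrite -(inj _ _ (MP _ My) Px Ey).
exists L; split.
- by split=> // x [Px _]; apply: PH.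
- exact: (fi_trans sH sP sL fP fL).
exists (\bigcup_i V i), #|I|, V; split.
  have fV i : finite_set (V i) by have [] := dV i.
  have acV : antichain (\bigcup_i V i).
    move=> u v [i _ Vu] [j _ Vv] cuv; have [eij|nij] := eqVneq i j.
      by subst j; have [_ _ acV _ _] := dV i; apply: acV.
    by have := kdiag_incomp D (dV i) (dV j) (cE _ _ nij) Vu Vv; rewrite cuv.
  split=> //.
  - by apply: bigcup_finite => //; apply: finite_finset.
  - split=> //; last by move=> i _; have [] := dV i.
    move=> i j _ _ [v [Vi Vj]]; apply/eqP/negPn/negP => nij.
    have := kdiag_incomp D (dV i) (dV j) (cE _ _ nij) Vi Vj.
    by rewrite /comparable_words prefix_refl.
  - exists E => // i; have [fVi nVi acVi HVi SVi] := dV i; split=> //.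
    + split; first exact: sE.
      move=> x Ex; have [Hx1 Hx2] := HVi x Ex; have Gx : G x by apply/HG/PH; case: Ex.
      by split.
    (* The section of the block is [K], that of the whole stabiliser is [G] by self-replication. *)
    + move=> v Vv; have [_ ->] := SVi v Vv; rewrite (bdsurj D); exact: (bdfi D).
    + by move=> v Vv; have [] := SVi v Vv.
move=> v [i _ Vv]; have [_ _ _ HVi SVi] := dV i; have [_ Si] := SVi v Vv.
have trj j x : j != i -> E j x -> triv v x.
  move=> nji Ex; apply: (kdiag_triv (dV j) Ex) => v' Vv'.
  by apply: (kdiag_incomp D (dV i) (dV j)) => //; apply: cE; rewrite eq_sym.
apply/seteqP; split=> [_ [x Lx <-]|k Kk].
  pose M := [set x : tree_aut X | x v = v /\ K (sect v x)].
  suff [] : M x by [].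
  have sM : is_subgroup M.
    split; first by split=> //; rewrite sect1; apply: sub1.
      move=> g h [gv Kg] [hv Kh]; rewrite /M /= hv gv sectM hv; split=> //.
      exact: subM.
    move=> g [gv Kg]; have gv' : g^-1 v = v by rewrite -{1}gv autKV.
    by split=> //; rewrite -{1}gv sectV; apply: subV.
  rewrite LE in Lx; apply: prod_sets_min Lx => // j y Ey.
  have [eji|nji] := eqVneq j i.
    subst j; have [/(_ _ Vv) yv _] := HVi y Ey; split=> //.
    by rewrite -Si; exists y.
  have /triv_sect [yv yv1] := trj j y nji Ey.
  by split=> //; rewrite yv1; apply: sub1.
have [x Ex <-] : (sect v @` E i) k by rewrite Si.
exists x => //.
by rewrite LE; apply: (sub_prod_sets sE Ex).
Qed.

Lemma virtually_good_inductive : inductive_collection G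
  [set H | subgroup_of G H /\ virtually_good H].
Proof.
split.
- by move=> H [].
- split; split.
  + by split; [exact: is_subgroup1|move=> _ ->; apply: sub1].
  + by exists [set 1]; [exact: (good_1 D)|exact/fi_refl/is_subgroup1].
  + by split.
  + by exists G; [exact: (good_G D)|exact: fi_refl].
- move=> H L [[sH HG] [P gP fP]] [sL LG] fL; split=> //; exists P => //.
  by have [sP _] := gP; apply: (fi_trans sL sH sP).
- move=> H [sH HS] _ HC; split; first by split=> // h /HS [].
  apply: (virtually_good_St D sH).
    by move=> h x /HS [_]; apply.
  by move=> x; have [] := HC x.
Qed.

End Conclusion.

Theorem theorem1p2 (X : finType) (G K : set (tree_aut X))
  (hG : is_subgroup G)
  (hfg : finitely_generated G)
  (hrep : self_replicating G)
  (hreg : regular_branch G)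
  (hker : trivial_branch_kernel G)
  (hind : subgroup_induction_property G)
  (hprim : tree_primitive G)
  (hK : maximal_branching_subgroup G K)
  (H : set (tree_aut X))
  (hH : subgroup_of G H)
  (hHfg : finitely_generated H) :
  virtually_regular_block G K H.
Proof.
have [n0 [kk [mm D]]] := base_data hG hfg hrep hker hind hprim hK.
have [_ _ /(_ _ (virtually_good_inductive D) H hH hHfg) [[sH HG] vH]] := hind.
exact: (good_regular_block D sH HG vH).
Qed.
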